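(* Let $X$ be a separable, locally compact, metrizable space, and let $\alpha X = X\cup\{\infty\}$ be its one-point compactification. (1) If $C_0(X)$ is weakly semiprojective with respect to unital $C^*$-algebras (WSP1), then $\alpha X$ is an approximative absolute neighborhood retract (AANR). (2) If $\alpha X$ is an AANR, then $C_0(X)$ is WSP1 within the commutative category.
   Context: A compactum is a compact metrizable space. If $X$ is already compact, $\alpha X$ is $X$ together with a new isolated point $\infty$. A compactum $X$ is an AANR if, for every homeomorphic embedding $\theta:X\to Y$ into a compact metric space $(Y,d)$ and every $\epsilon>0$, there exist $\delta>0$ and a continuous function $r:U_\delta\to X$ such that $d(r(\theta(x)),x)\le\epsilon$ for all $x\in X$, where $U_\delta=\{y\in Y : d(y,\theta(X))\le\delta\}$. Here the metric on $X$ is the one obtained by identifying $X$ with $\theta(X)$, i.e. the condition means $d(\theta(r(\theta(x))),\theta(x))\le\epsilon$. Ideals are closed and two-sided. A separable $C^*$-algebra $A$ (not necessarily unital) is weakly semiprojective with respect to unital $C^*$-algebras (WSP1) if for every unital separable $C^*$-algebra $B$, every increasing sequence of ideals $J_1\subseteq J_2\subseteq\cdots$ of $B$ with $J=\overline{\bigcup_n J_n}$, and every $*$-homomorphism $\varphi:A\to B/J$, there is a sequence of $*$-homomorphisms $\psi_n:A\to B/J_n$ such that $\pi_n\circ\psi_n(a)\to\varphi(a)$ in norm for all $a\in A$, where $\pi_n:B/J_n\to B/J$ is the quotient map $\pi_n(b+J_n)=b+J$. Neither $\varphi$ nor the $\psi_n$ is required to be unital. A commutative separable $A$ is WSP1 within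 the commutative category if this holds whenever $B$ is a commutative unital separable $C^*$-algebra. *)

(* Defs.v *)
From HB Require Import structures.
From mathcomp Require Import all_boot all_order all_algebra.
From mathcomp Require Import complex lra.
From mathcomp Require Import all_classical all_reals ereal topology normedtype.

Set Implicit Arguments.
Unset Strict Implicit.
Unset Printing Implicit Defensive.

Import Order.TTheory GRing.Theory Num.Theory.
Import numFieldNormedType.Exports.

Local Open Scope classical_set_scope.
Local Open Scope ring_scope.
Local Open Scope complex_scope.
Local Open Scope quotient_scope.

Definition separable_space (T : topologicalType) : Prop :=
  exists2 D : set T, countable D & dense D.

Definition metrizable (R : realType) (T : topologicalType) : Prop :=
  exists d : T -> T -> R,
    [/\ forall x y, d x y = 0 <-> x = y,
        forall x y, d x y = d y x,
        forall x y z, d x z <= d x y + d y z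
      & forall (x : T) (U : set T),
          nbhs x U <-> exists2 e : R, 0 < e & [set y | d x y < e] `<=` U].

Definition compactum (R : realType) (T : topologicalType) : Prop :=
  compact [set: T] /\ metrizable R T.

Definition top_embedding (X Y : topologicalType) (f : X -> Y) : Prop :=
  injective f /\
  forall U : set X, open U <-> exists2 V : set Y, open V & f @^-1` V = U.

(* The distance to a set is an infimum in the extended reals, so that the
   distance to the empty set is +oo. *)
Definition closed_nbhd (R : realType) (Y : metricType R) (A : set Y)
    (delta : R) : set Y :=
  [set y | (ereal_inf [set (mdist y z)%:E | z in A] <= delta%:E)%E].

(* In [AANR], [r] is defined on the subtype of [Y] carved out by the closed
   neighbourhood, and [r u] with [\val u = theta x] stands for r(theta(x)). *)
Definition AANR (R : realType) (X : topologicalType) : Prop :=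
  compactum R X /\
  forall (Y : metricType R) (theta : X -> Y),
    compact [set: Y] -> top_embedding theta ->
    forall eps : R, 0 < eps ->
    exists2 delta : R, 0 < delta &
    exists2 r : closed_nbhd (range theta) delta -> X, continuous r &
    forall (x : X) (u : closed_nbhd (range theta) delta),
      \val u = theta x -> mdist (theta (r u)) (theta x) <= eps.

Section RealNorm.
Context {R : realType} {V : normedZmodType R[i]}.
Implicit Types v w : V.

(* The norm of a complex normed space takes its values in R[i]; [renorm] is the
   same norm, valued in R. *)
Definition renorm v : R := complex.Re `|v|.

Lemma renormE v : `|v| = (renorm v)%:C.
Proof.
by apply/eqP; rewrite eq_complex eqxx/= -(ger0_Im (normr_ge0 v)) eqxx.
Qed.

Lemma renorm_ge0 v : 0 <= renorm v.
Proof. by rewrite -ler0c -renormE. Qed.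

Lemma renorm_le v (e : R) : (`|v| <= e%:C) = (renorm v <= e).
Proof. by rewrite renormE lecR. Qed.

Lemma renorm_lt v (e : R) : (`|v| < e%:C) = (renorm v < e).
Proof. by rewrite renormE ltcR. Qed.

Lemma renormD v w : renorm (v + w) <= renorm v + renorm w.
Proof. by rewrite -renorm_le rmorphD/= -!renormE ler_normD. Qed.

Lemma renormN v : renorm (- v) = renorm v.
Proof. by rewrite /renorm normrN. Qed.

Lemma renorm_eq0 v : renorm v = 0 -> v = 0.
Proof. by move=> v0; apply/normr0_eq0; rewrite renormE v0. Qed.

Lemma renorm_distB v w : `|renorm v - renorm w| <= renorm (v - w).
Proof.
rewrite ler_norml lerBrDr lerBlDr; apply/andP; split.
  rewrite addrC lerBlDr addrC -(renormN (v - w)) opprB.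
  by rewrite (le_trans _ (renormD _ _))// subrK.
by rewrite (le_trans _ (renormD _ _))// subrK.
Qed.

End RealNorm.

Section ComplexComplete.
Context {R : realType}.
Implicit Types z w : R[i].

Lemma renormM z w :
  renorm (z * w : R[i]^o) = renorm (z : R[i]^o) * renorm (w : R[i]^o).
Proof.
by apply: complexI; rewrite rmorphM/= -!renormE normrM.
Qed.

Lemma renorm_Re z : `|complex.Re z| <= renorm (z : R[i]^o).
Proof. by rewrite -lecR -renormE normc_ge_Re. Qed.

Lemma norm_i : `|'i%C| = 1 :> R[i].
Proof. by rewrite normc_def/= expr0n/= expr1n add0r sqrtr1. Qed.

Lemma norm_real (x : R) : `|x%:C| = `|x|%:C :> R[i].
Proof. by rewrite normc_def/= expr0n/= addr0 sqrtr_sqr. Qed.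

Lemma renorm_Im z : `|complex.Im z| <= renorm (z : R[i]^o).
Proof.
rewrite -lecR -renormE (_ : _%:C = `|complex.Re (z * 'i%C)|%:C).
  by rewrite (le_trans (normc_ge_Re _))// normrM norm_i mulr1.
by rewrite ReiNIm normrN.
Qed.

Lemma renorm_ReIm z :
  renorm (z : R[i]^o) <= `|complex.Re z| + `|complex.Im z|.
Proof.
rewrite -renorm_le {1}(complexE z) (le_trans (ler_normD _ _))// normrM.
by rewrite norm_i mul1r !norm_real rmorphD.
Qed.

Lemma complex_cauchy_cvg (F : set_system R[i]^o) :
  ProperFilter F -> cauchy F -> cvg F.
Proof.
move=> FF /cauchy_ballP Fc.
have FcvgR (p : R[i]^o -> R) : (forall z w, `|p z - p w| <= renorm (z - w)) ->
    cvg (p @ F).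
  move=> plip; apply: (@cauchy_cvg R); apply/cauchy_ballP => e e0.
  have /Fc : 0 < e%:C :> R[i] by rewrite ltcR.
  rewrite !near_simpl => -[[P Q] [/= FP FQ] PQ].
  exists (p @` P, p @` Q) => /=.
    by split; [apply: filterS FP|apply: filterS FQ] => z ?; exists z.
  move=> [_ _] [/= [z Pz <-] [w Qw <-]].
  rewrite /ball/= (le_lt_trans (plip _ _))//.
  have := PQ (z, w) (conj Pz Qw).
  by rewrite -ball_normE/= renorm_lt.
have /cvg_ex[/= a aF] : cvg ((@complex.Re R : R[i]^o -> R) @ F).
  apply: FcvgR => -[x y] [x' y'].
  exact: (renorm_Re ((x +i* y) - (x' +i* y'))).
have /cvg_ex[/= b bF] : cvg ((@complex.Im R : R[i]^o -> R) @ F).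
  apply: FcvgR => -[x y] [x' y'].
  exact: (renorm_Im ((x +i* y) - (x' +i* y'))).
apply/cvg_ex; exists (a +i* b); apply/cvgrPdist_lt => /= e e0.
have eE : e = (complex.Re e)%:C by rewrite RRe_real// gtr0_real.
have e20 : 0 < complex.Re e / 2 by rewrite divr_gt0// -ltcR -eE.
near=> z; rewrite eE renorm_lt (le_lt_trans (renorm_ReIm _))//.
rewrite (splitr (complex.Re e)).
rewrite (_ : complex.Re _ = a - complex.Re z); last by case: (z).
rewrite (_ : complex.Im (_ - _) = b - complex.Im z); last by case: (z).
rewrite ltrD//; near: z.
- by move/cvgrPdist_lt : aF => /(_ _ e20).
- by move/cvgrPdist_lt : bF => /(_ _ e20).
Unshelve. all: by end_near. Qed.

End ComplexComplete.

HB.mixin Record isCStarAlgebra (R : realType) A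
    & CompleteNormedModule R[i] A := {
  cmul : A -> A -> A;
  cstar : A -> A;
  cmulA : associative cmul;
  cmulDl : left_distributive cmul +%R;
  cmulDr : right_distributive cmul +%R;
  cscalerAl : forall (k : R[i]) (a b : A), k *: cmul a b = cmul (k *: a) b;
  cscalerAr : forall (k : R[i]) (a b : A), k *: cmul a b = cmul a (k *: b);
  cstarK : involutive cstar;
  cstarD : forall a b : A, cstar (a + b) = cstar a + cstar b;
  cstarZ : forall (k : R[i]) (a : A), cstar (k *: a) = k^*%C *: cstar a;
  cstarM : forall a b : A, cstar (cmul a b) = cmul (cstar b) (cstar a);
  cnormM : forall a b : A, `|cmul a b| <= `|a| * `|b|;
  cnorm_star : forall a : A, `|cmul (cstar a) a| = `|a| ^+ 2
}.

#[short(type="cstarType")]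
HB.structure Definition CStarAlgebra (R : realType) :=
  {A of CompleteNormedModule R[i] A & isCStarAlgebra R A}.

(* In the zero algebra the unit is 0. *)
Definition unital (R : realType) (A : cstarType R) : Prop :=
  exists e : A, forall a : A, cmul e a = a /\ cmul a e = a.

Definition commutative_cstar (R : realType) (A : cstarType R) : Prop :=
  commutative (@cmul R A).

(* Closed two-sided ideals; the whole algebra is one of them. *)
Record cideal (R : realType) (A : cstarType R) := CIdeal {
  cideal_set :> A -> Prop;
  cideal0 : cideal_set 0;
  cidealD : forall a b : A, cideal_set a -> cideal_set b -> cideal_set (a + b);
  cidealZ : forall (k : R[i]) (a : A), cideal_set a -> cideal_set (k *: a);
  cidealMl : forall a b : A, cideal_set b -> cideal_set (cmul a b);
  cidealMr : forall a b : A, cideal_set a -> cideal_set (cmul a b);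
  cideal_closed : closed (cideal_set : set A)
}.

Section CStarTheory.
Context {R : realType} {A : cstarType R}.
Implicit Types a b : A.

Lemma cmulNl a b : cmul (- a) b = - cmul a b.
Proof. by rewrite -scaleN1r -cscalerAl scaleN1r. Qed.

Lemma cmulNr a b : cmul a (- b) = - cmul a b.
Proof. by rewrite -scaleN1r -cscalerAr scaleN1r. Qed.

Lemma cmulBl a b c : cmul (a - b) c = cmul a c - cmul b c.
Proof. by rewrite cmulDl cmulNl. Qed.

Lemma cmulBr a b c : cmul c (a - b) = cmul c a - cmul c b.
Proof. by rewrite cmulDr cmulNr. Qed.

Lemma cstar0 : cstar 0 = 0 :> A.
Proof. by apply: (addrI (cstar 0)); rewrite -cstarD !addr0. Qed.

Lemma cstarB a b : cstar (a - b) = cstar a - cstar b.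
Proof.
rewrite cstarD; congr (_ + _); apply: (addIr (cstar b)).
by rewrite -cstarD !addNr cstar0.
Qed.

Lemma cidealB (J : cideal A) a b : J a -> J b -> J (a - b).
Proof.
by move=> Ja Jb; apply/cidealD => //; rewrite -scaleN1r; exact: cidealZ.
Qed.

End CStarTheory.

Section Quotient.
Context {R : realType} {A : cstarType R}.

Definition ideal_pred (J : cideal A) : A -> bool := fun a => `[< J a >].

Lemma ideal_predE (J : cideal A) a : (a \in ideal_pred J) = `[< J a >].
Proof. by []. Qed.

Lemma ideal_pred_zmod (J : cideal A) : zmod_closed (ideal_pred J).
Proof.
split=> [|a b]; rewrite ?ideal_predE; first exact/asboolP/cideal0.
by move=> /asboolP Ja /asboolP Jb; apply/asboolP/cidealB.
Qed.

HB.instance Definition _ (J : cideal A) :=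
  GRing.isZmodClosed.Build A (ideal_pred J) (ideal_pred_zmod J).

Definition quo (J : cideal A) : Type :=
  Quotient.quot (GRing.ZmodClosed.clone A (ideal_pred J) _).

HB.instance Definition _ (J : cideal A) := GRing.Zmodule.on (quo J).
HB.instance Definition _ (J : cideal A) := Quotient.on (quo J).

Definition quo_pi (J : cideal A) (a : A) : quo J := \pi_(quo J) a.

Lemma quo_piP (J : cideal A) a b : quo_pi J a = quo_pi J b <-> J (a - b).
Proof.
rewrite /quo_pi -[J (a - b)]asboolE -ideal_predE Quotient.idealrBE.
by split=> [->//|/eqP].
Qed.

Lemma quo_piK (J : cideal A) (u : quo J) : quo_pi J (repr u) = u.
Proof. exact: reprK. Qed.

Lemma quo_pi_repr (J : cideal A) a : J (repr (quo_pi J a) - a).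
Proof. by apply/quo_piP; rewrite quo_piK. Qed.

Lemma quo_piD (J : cideal A) : {morph quo_pi J : a b / a + b}.
Proof. exact: Quotient.pi_add. Qed.

Definition quo_scale (J : cideal A) (k : R[i]) (u : quo J) : quo J :=
  quo_pi J (k *: repr u).

Lemma quo_scaleE (J : cideal A) k a :
  quo_scale k (quo_pi J a) = quo_pi J (k *: a).
Proof. by apply/quo_piP; rewrite -scalerBr; apply/cidealZ/quo_pi_repr. Qed.

Lemma quo_scaleA (J : cideal A) k l (u : quo J) :
  quo_scale k (quo_scale l u) = quo_scale (k * l) u.
Proof. by rewrite -(quo_piK u) !quo_scaleE scalerA. Qed.

Lemma quo_scale1 (J : cideal A) : left_id 1 (@quo_scale J).
Proof. by move=> u; rewrite -(quo_piK u) quo_scaleE scale1r. Qed.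

Lemma quo_scaleDr (J : cideal A) : right_distributive (@quo_scale J) +%R.
Proof.
move=> k u v; rewrite -(quo_piK u) -(quo_piK v).
by rewrite !(quo_scaleE, =^~ quo_piD) scalerDr.
Qed.

Lemma quo_scaleDl (J : cideal A) (u : quo J) :
  {morph (@quo_scale J)^~ u : k l / k + l}.
Proof.
move=> k l; rewrite -(quo_piK u).
by rewrite !(quo_scaleE, =^~ quo_piD) scalerDl.
Qed.

HB.instance Definition _ (J : cideal A) :=
  GRing.Zmodule_isLmodule.Build R[i] (quo J)
    (@quo_scaleA J) (@quo_scale1 J) (@quo_scaleDr J) (@quo_scaleDl J).

Definition quo_mul (J : cideal A) (u v : quo J) : quo J :=
  quo_pi J (cmul (repr u) (repr v)).

Lemma quo_mulE (J : cideal A) a b :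
  quo_mul (quo_pi J a) (quo_pi J b) = quo_pi J (cmul a b).
Proof.
apply/quo_piP; set a' := repr _; set b' := repr _.
rewrite (_ : _ - _ = cmul (a' - a) b' + cmul a (b' - b)).
  by apply: cidealD; [apply/cidealMr|apply/cidealMl]; exact: quo_pi_repr.
by rewrite cmulBl cmulBr addrA subrK.
Qed.

(* Independent of the chosen representative, because a closed two-sided ideal
   of a C*-algebra is self-adjoint. *)
Definition quo_star (J : cideal A) (u : quo J) : quo J :=
  quo_pi J (cstar (repr u)).

Lemma quo_starE (J : cideal A) a :
  (forall b, J b -> J (cstar b)) ->
  quo_star (quo_pi J a) = quo_pi J (cstar a).
Proof.
move=> Jstar; apply/quo_piP.
by rewrite -cstarB; apply/Jstar/quo_pi_repr.
Qed.

(* The quotient norm, i.e., the infimum of the norms of the elements of the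
   coset [u]. *)
Definition quo_norm (J : cideal A) (u : quo J) : R :=
  inf [set renorm a | a in [set a : A | quo_pi J a = u]].

(* For J included in K, the map sending the coset b + J to b + K. *)
Definition quo_map (J K : cideal A) (u : quo J) : quo K := quo_pi K (repr u).

Lemma quo_mapE (J K : cideal A) a :
  cideal_set J `<=` cideal_set K -> quo_map K (quo_pi J a) = quo_pi K a.
Proof. by move=> JK; apply/quo_piP/JK/quo_pi_repr. Qed.

End Quotient.

Section C0.
Context {R : realType} {X : topologicalType}.

Definition vanishes_at_infinity (f : X -> R[i]^o) : Prop :=
  forall eps : R, 0 < eps ->
  exists2 K : set X, compact K & forall x, ~ K x -> `|f x| < eps%:C.

Definition C0_pred : {pred X -> R[i]^o} :=
  fun f => `[< continuous f /\ vanishes_at_infinity f >].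

Lemma C0_predP (f : X -> R[i]^o) :
  reflect (continuous f /\ vanishes_at_infinity f) (f \in C0_pred).
Proof. exact: asboolP. Qed.

Lemma vanishes_le (M : R) (f g h : X -> R[i]^o) :
  (forall x, renorm (f x) <= M * (renorm (g x) + renorm (h x))) ->
  vanishes_at_infinity g -> vanishes_at_infinity h -> vanishes_at_infinity f.
Proof.
move=> fgh gv hv e e0; have M0 : 0 < `|M| + 1 by rewrite ltr_wpDl.
have d0 : 0 < e / (`|M| + 1) / 2 by rewrite !divr_gt0.
have [K cK gK] := gv _ d0; have [L cL hL] := hv _ d0.
exists (K `|` L); first exact: compactU.
move=> x /not_orP[/gK + /hL]; rewrite !renorm_lt => gx hx.
rewrite (le_lt_trans (fgh x))//.
rewrite (@le_lt_trans _ _ ((`|M| + 1) * (renorm (g x) + renorm (h x))))//.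
  rewrite ler_wpM2r ?addr_ge0 ?renorm_ge0//.
  by rewrite (le_trans (ler_norm _))// lerDl.
by rewrite -ltr_pdivlMl// mulrC (splitr (e / _)) ltrD.
Qed.

Lemma continuous_renorm (f : X -> R[i]^o) :
  continuous f -> continuous (fun x => renorm (f x) : R^o).
Proof.
move=> cf x; apply/cvgrPdist_lt => e e0.
have /cvgrPdist_lt/(_ e%:C) := cf x; rewrite ltcR => /(_ e0).
apply: filterS => y; rewrite renorm_lt; apply: le_lt_trans.
exact: renorm_distB.
Qed.

Lemma C0_bounded (f : X -> R[i]^o) : f \in C0_pred ->
  has_ubound (range (fun x => renorm (f x))).
Proof.
move=> /C0_predP[cf /(_ _ ltr01)[K cK fK]].
have : compact ((fun x => renorm (f x) : R^o) @` K).
  apply: continuous_compact => //.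
  exact/continuous_subspaceT/continuous_renorm.
move=> /compact_bounded[M [_ /(_ (M + 1))]].
rewrite ltrDl ltr01 => /(_ isT) Mb.
exists (Num.max 1 (M + 1)) => _ [x _ <-]; rewrite le_max.
have [Kx|nKx] := pselect (K x); last by rewrite ltW// -renorm_lt fK.
apply/orP; right; rewrite (le_trans (ler_norm _))//.
by apply: Mb; exists x.
Qed.

Lemma C0_pred_submod : submod_closed C0_pred.
Proof.
split=> [|a f g /C0_predP[cf fv] /C0_predP[cg gv]]; apply/C0_predP; split.
- by move=> x; exact: cvg_cst.
- by move=> e e0; exists set0 => [|x _]; [exact: compact0|rewrite normr0 ltcR].
- move=> x; apply: (@cvgD _ _ _ _ _ (fun y => a *: f y) g); last exact: cg.
  exact: (@cvgZl_tmp R[i] R[i]^o X (nbhs x) _ a f (f x) (cf x)).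
- apply: (@vanishes_le (renorm (a : R[i]^o) + 1) _ f g) => // x.
  rewrite (le_trans (renormD _ _))// mulrDr lerD//.
    rewrite [X in X <= _](_ : _ = renorm (a : R[i]^o) * renorm (f x)).
      by rewrite ler_wpM2r ?renorm_ge0// lerDl.
    exact: renormM.
  by rewrite ler_peMl ?renorm_ge0// lerDr renorm_ge0.
Qed.

HB.instance Definition _ :=
  GRing.isSubmodClosed.Build R[i] (X -> R[i]^o) C0_pred C0_pred_submod.

Record C0 := MkC0 { C0_fun :> X -> R[i]^o; _ : C0_fun \in C0_pred }.

HB.instance Definition _ := [isSub for C0_fun].
HB.instance Definition _ := [Choice of C0 by <:].
HB.instance Definition _ := [SubChoice_isSubLmodule of C0 by <:].

Implicit Types f g : C0.

Lemma C0P f : (f : X -> R[i]^o) \in C0_pred.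
Proof. exact: valP. Qed.

Lemma C0_ext f g : f =1 g -> f = g.
Proof. by move=> fg; apply/val_inj/funext. Qed.

Definition C0_sup f : R := sup (range (fun x => renorm (f x))).

Lemma C0_sup_empty f : ~ ([set: X] !=set0) -> C0_sup f = 0.
Proof.
move=> X0; rewrite /C0_sup -[RHS](@sup0 R); congr (sup _).
by rewrite -subset0 => r [x _ _]; case: X0; exists x.
Qed.

Lemma C0_sup_le f x : renorm (f x) <= C0_sup f.
Proof. by apply: ub_le_sup; [exact/C0_bounded/C0P|exists x]. Qed.

Lemma C0_sup_ge0 f : 0 <= C0_sup f.
Proof.
have [[x _]|X0] := pselect ([set: X] !=set0).
  exact: le_trans (renorm_ge0 _) (C0_sup_le f x).
by rewrite C0_sup_empty.
Qed.

Lemma C0_sup_ge f (M : R) :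
  0 <= M -> (forall x, renorm (f x) <= M) -> C0_sup f <= M.
Proof.
move=> M0 fM; have [[x _]|X0] := pselect ([set: X] !=set0).
  apply: ge_sup; first by exists (renorm (f x)), x.
  by move=> _ [y _ <-].
by rewrite C0_sup_empty.
Qed.

Definition C0_norm f : R[i] := (C0_sup f)%:C.

Lemma C0_normD f g : C0_norm (f + g) <= C0_norm f + C0_norm g.
Proof.
rewrite -rmorphD lecR; apply: C0_sup_ge; first by rewrite addr_ge0 ?C0_sup_ge0.
by move=> x; rewrite (le_trans (renormD _ _))// lerD ?C0_sup_le.
Qed.

Lemma C0_normZ (k : R[i]) f : C0_norm (k *: f) = `|k| * C0_norm f.
Proof.
have le (l : R[i]) h : C0_sup (l *: h) <= renorm (l : R[i]^o) * C0_sup h.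
  apply: C0_sup_ge; first by rewrite mulr_ge0 ?renorm_ge0 ?C0_sup_ge0.
  move=> x; rewrite [X in X <= _](_ : _ = renorm (l : R[i]^o) * renorm (h x)).
    by rewrite ler_wpM2l ?renorm_ge0 ?C0_sup_le.
  exact: renormM.
rewrite [`|k|](@renormE _ R[i]^o) -rmorphM; congr (_%:C).
apply/eqP; rewrite eq_le le/=.
have [->|k0] := eqVneq k 0.
  by rewrite (_ : renorm _ = 0) ?mul0r ?C0_sup_ge0// /renorm normr0.
have rk0 : 0 < renorm (k : R[i]^o).
  rewrite lt_neqAle renorm_ge0 andbT eq_sym.
  by apply: contra_neq k0 => /renorm_eq0.
rewrite -ler_pdivlMl//.
have := le k^-1 (k *: f); rewrite scalerA mulVf// scale1r.
rewrite (_ : renorm _ = (renorm (k : R[i]^o))^-1)//.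
apply: (mulfI (lt0r_neq0 rk0)); rewrite -renormM divff// divff ?lt0r_neq0//.
by rewrite /renorm normr1.
Qed.

Lemma C0_norm0_eq0 f : C0_norm f = 0 -> f = 0.
Proof.
move=> [f0]; apply: C0_ext => x; apply: renorm_eq0.
by apply/eqP; rewrite eq_le renorm_ge0 -f0 C0_sup_le.
Qed.

HB.instance Definition _ :=
  Lmodule_isNormed.Build R[i] C0 C0_normD C0_normZ C0_norm0_eq0.

Lemma C0_normE f : `|f| = (C0_sup f)%:C.
Proof. by []. Qed.

Lemma gt0_complexE (e : R[i]) : 0 < e ->
  exists2 e' : R, 0 < e' & e = e'%:C.
Proof.
move=> e0; exists (complex.Re e); last by rewrite RRe_real// gtr0_real.
by move: e0; rewrite ltcE => /andP[].
Qed.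

Lemma C0_cauchy_unif (F : set_system C0) (g : X -> R[i]^o) :
  ProperFilter F -> cauchy F ->
  (forall x, (fun f : C0 => f x) @ F --> g x) ->
  forall e : R, 0 < e ->
    \forall f \near F, forall x, renorm ((f : C0) x - g x) <= e.
Proof.
move=> FF /cauchy_ballP Fc Fg e e0.
have /Fc : 0 < e%:C :> R[i] by rewrite ltcR.
rewrite !near_simpl => -[[P Q] [/= FP FQ] PQ].
apply: filterS FP => f Pf x; apply/ler_addgt0Pr => d d0.
have /cvgrPdist_lt/(_ d%:C) := Fg x; rewrite ltcR => /(_ d0) gd.
have [h [Qh hd]] := filter_ex (filterI FQ gd).
have := PQ (f, h) (conj Pf Qh); rewrite -ball_normE/= renorm_lt => fh.
rewrite (_ : f x - g x = (f - h) x - (g x - h x)); last first.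
  by rewrite opprB addrA subrK.
rewrite (le_trans (renormD _ _))// renormN lerD//.
  by rewrite (le_trans (C0_sup_le (f - h) x))// ltW.
by rewrite ltW// -renorm_lt.
Qed.

Lemma C0_cauchy_cvg (F : set_system C0) : ProperFilter F -> cauchy F -> cvg F.
Proof.
move=> FF Fc.
have Fx x : cvg ((fun f : C0 => f x) @ F).
  apply: (@complex_cauchy_cvg R _ (fmap_proper_filter _ FF)).
  move/cauchy_ballP : Fc => Fc; apply/cauchy_ballP => e e0.
  have := Fc e e0; rewrite !near_simpl => -[[P Q] [/= FP FQ] PQ].
  exists ((fun f : C0 => f x) @` P, (fun f : C0 => f x) @` Q) => /=.
    by split; [apply: filterS FP|apply: filterS FQ] => z ?; exists z.
  move=> [_ _] [/= [f Pf <-] [h Qh <-]].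
  have := PQ (f, h) (conj Pf Qh); rewrite -!ball_normE/=; apply: le_lt_trans.
  by rewrite !renormE lecR; exact: (C0_sup_le (f - h) x).
pose g x : R[i]^o := lim ((fun f : C0 => f x) @ F).
have Fg := C0_cauchy_unif FF Fc (Fx : forall x, _ --> g x).
have cg : continuous g.
  move=> x; apply/cvgrPdist_lt => _ /gt0_complexE[e e0 ->].
  have e40 : 0 < e / 4 by rewrite divr_gt0.
  have [f fg] := filter_ex (Fg _ e40).
  have [cf _] := C0_predP _ (C0P f).
  have /cvgrPdist_lt/(_ (e / 4)%:C) := cf x; rewrite ltcR => /(_ e40).
  apply: filterS => y; rewrite !renorm_lt => fxy.
  rewrite (_ : g x - g y = - (f x - g x) + ((f x - f y) + (f y - g y)));
    last first.
    by rewrite [f x - f y + _]addrA subrK addrA opprB subrK.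
  rewrite (@le_lt_trans _ _ (e / 4 + (e / 4 + e / 4)))//.
    rewrite (le_trans (renormD _ _))// renormN lerD//.
    by rewrite (le_trans (renormD _ _))// lerD// ltW.
  lra.
have vg : vanishes_at_infinity g.
  move=> e e0; have e20 : 0 < e / 2 by rewrite divr_gt0.
  have [f fg] := filter_ex (Fg _ e20).
  have [_ /(_ _ e20)[K cK fK]] := C0_predP _ (C0P f).
  exists K => // x /fK; rewrite !renorm_lt => fx.
  rewrite (_ : g x = f x - (f x - g x)); last by rewrite subKr.
  rewrite (le_lt_trans (renormD _ _))// renormN [ltRHS]splitr ltr_leD//.
apply/cvg_ex; exists (MkC0 (introT (C0_predP g) (conj cg vg))).
apply/cvgrPdist_le => _ /gt0_complexE[e e0 ->].
apply: filterS (Fg _ e0) => f fg; rewrite distrC lecR.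
apply: C0_sup_ge; [exact: ltW|exact: fg].
Qed.

HB.instance Definition _ := Uniform_isComplete.Build C0 C0_cauchy_cvg.

Lemma C0_mul_subproof f g :
  (fun x => (f x : R[i]) * g x : R[i]^o) \in C0_pred.
Proof.
have [cf vf] := C0_predP _ (C0P f); have [cg vg] := C0_predP _ (C0P g).
apply/C0_predP; split.
  move=> x.
  exact: (@cvgZ R[i] R[i]^o X (nbhs x) _ f g (f x) (g x) (cf x) (cg x)).
apply: (@vanishes_le (C0_sup f) _ g g) => // x.
rewrite renormM mulrDr ler_wpDr ?mulr_ge0 ?C0_sup_ge0 ?renorm_ge0//.
by rewrite ler_wpM2r ?renorm_ge0 ?C0_sup_le.
Qed.

Definition C0_mul f g : C0 := MkC0 (C0_mul_subproof f g).

Lemma renormJ (z : R[i]) : renorm (z^*%C : R[i]^o) = renorm (z : R[i]^o).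
Proof. by rewrite /renorm normcJ. Qed.

Lemma C0_star_subproof f : (fun x => (f x)^*%C : R[i]^o) \in C0_pred.
Proof.
have [cf vf] := C0_predP _ (C0P f); apply/C0_predP; split.
  move=> x; apply/cvgrPdist_lt => e e0.
  have /cvgrPdist_lt/(_ e e0) := cf x; apply: filterS => y.
  by rewrite -rmorphB/= normcJ.
by move=> e /vf[K cK fK]; exists K => // x /fK; rewrite normcJ.
Qed.

Definition C0_star f : C0 := MkC0 (C0_star_subproof f).

Lemma C0_mulA : associative C0_mul.
Proof. by move=> f g h; apply: C0_ext => x; exact: mulrA. Qed.

Lemma C0_mulDl : left_distributive C0_mul +%R.
Proof. by move=> f g h; apply: C0_ext => x; exact: mulrDl. Qed.

Lemma C0_mulDr : right_distributive C0_mul +%R.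
Proof. by move=> f g h; apply: C0_ext => x; exact: mulrDr. Qed.

Lemma C0_scalerAl (k : R[i]) f g : k *: C0_mul f g = C0_mul (k *: f) g.
Proof. by apply: C0_ext => x; exact: mulrA. Qed.

Lemma C0_scalerAr (k : R[i]) f g : k *: C0_mul f g = C0_mul f (k *: g).
Proof. by apply: C0_ext => x; exact: mulrCA. Qed.

Lemma C0_starK : involutive C0_star.
Proof. by move=> f; apply: C0_ext => x; exact: conjcK. Qed.

Lemma C0_starD f g : C0_star (f + g) = C0_star f + C0_star g.
Proof. by apply: C0_ext => x; exact: (rmorphD (@conjc R)). Qed.

Lemma C0_starZ (k : R[i]) f : C0_star (k *: f) = k^*%C *: C0_star f.
Proof. by apply: C0_ext => x; exact: (rmorphM (@conjc R)). Qed.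

Lemma C0_starM f g : C0_star (C0_mul f g) = C0_mul (C0_star g) (C0_star f).
Proof.
by apply: C0_ext => x; rewrite /= [RHS]mulrC; exact: (rmorphM (@conjc R)).
Qed.

Lemma C0_normM f g : `|C0_mul f g| <= `|f| * `|g|.
Proof.
rewrite !C0_normE -rmorphM lecR; apply: C0_sup_ge.
  by rewrite mulr_ge0 ?C0_sup_ge0.
by move=> x; rewrite renormM ler_pM ?renorm_ge0 ?C0_sup_le.
Qed.

Lemma C0_norm_star f : `|C0_mul (C0_star f) f| = `|f| ^+ 2.
Proof.
apply/eqP; rewrite eq_le; apply/andP; split; rewrite !C0_normE -rmorphXn lecR/=.
  apply: C0_sup_ge; first by rewrite sqr_ge0.
  move=> x; rewrite renormM renormJ -expr2.
  by rewrite lerXn2r ?nnegrE ?renorm_ge0 ?C0_sup_ge0 ?C0_sup_le.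
rewrite -[leRHS]sqr_sqrtr ?C0_sup_ge0//.
rewrite lerXn2r ?nnegrE ?C0_sup_ge0 ?sqrtr_ge0//.
apply: C0_sup_ge; first exact: sqrtr_ge0.
move=> x; rewrite -(ger0_norm (renorm_ge0 (f x))) -sqrtr_sqr.
rewrite ler_sqrt ?C0_sup_ge0//.
by rewrite (le_trans _ (C0_sup_le _ x))//= renormM renormJ -expr2.
Qed.

HB.instance Definition _ := isCStarAlgebra.Build R C0
  C0_mulA C0_mulDl C0_mulDr C0_scalerAl C0_scalerAr
  C0_starK C0_starD C0_starZ C0_starM C0_normM C0_norm_star.

End C0.

Arguments C0 : clear implicits.

Definition is_star_hom_quo (R : realType) (A B : cstarType R) (J : cideal B)
    (f : A -> quo J) : Prop :=
  [/\ linear f,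
      forall a b : A, f (cmul a b) = quo_mul (f a) (f b)
    & forall a : A, f (cstar a) = quo_star (f a)].

Definition weakly_lifts (R : realType) (A B : cstarType R) : Prop :=
  forall (Jn : nat -> cideal B) (J : cideal B),
    (forall n, cideal_set (Jn n) `<=` cideal_set (Jn n.+1)) ->
    cideal_set J = closure (\bigcup_n cideal_set (Jn n)) ->
  forall phi : A -> quo J, is_star_hom_quo phi ->
  exists2 psi : forall n, A -> quo (Jn n),
    (forall n, is_star_hom_quo (psi n)) &
    forall a : A,
      (fun n => quo_norm (quo_map J (psi n a) - phi a)) @ \oo --> (0 : R).

Definition WSP1 (R : realType) (A : cstarType R) : Prop :=
  separable_space A /\
  forall B : cstarType R, unital B -> separable_space B -> weakly_lifts A B.

Definition WSP1_commutative (R : realType) (A : cstarType R) : Prop :=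
  [/\ separable_space A, commutative_cstar A &
  forall B : cstarType R,
    unital B -> separable_space B -> commutative_cstar B -> weakly_lifts A B].

(* Main.v *)
Require Import Defs.
From HB Require Import structures.
From mathcomp Require Import all_boot all_order all_algebra.
From mathcomp Require Import complex ring lra.
From mathcomp Require Import all_classical all_reals ereal topology normedtype.
From mathcomp Require Import sequences numfun.

Set Implicit Arguments.
Unset Strict Implicit.
Unset Printing Implicit Defensive.

Import Order.TTheory GRing.Theory Num.Theory.
Import numFieldNormedType.Exports.

Local Open Scope classical_set_scope.
Local Open Scope ring_scope.
Local Open Scope complex_scope.

(* (1) Take B = C(Y), J = the functions vanishing on theta(alpha X) and J_n =
   the functions vanishing on the closed 1/(n+1)-neighbourhood of it.
   Restriction gives C_0(X) -> B/J; for a lift psi_n and a point y of the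
   n-th neighbourhood, f |-> psi_n(f)(y) is a multiplicative functional on
   C_0(X), hence the evaluation at a point r(y) of alpha X (infinity for the
   zero functional).  Closeness of psi_n to the restriction map on the distance
   functions to a finite net makes r almost the identity on alpha X.

   (2) Embed alpha X in the Hilbert cube Q by a sequence (h_i) in C_0(X) and
   lift the phi(h_i) to elements of B with values in [0, 1]; they define a map g
   from the characters of B to Q sending the hull of J into alpha X.  The
   distance to alpha X, composed with g, is represented by an element of J, so
   it is small on the hull of J_n for large n, and f |-> f o r o g, with r
   given by the AANR property, is a homomorphism into B/J_n.

   The Gelfand theory used in (2) is obtained by the Kadison-Dubois method:
   positive elements are those with |t - a| <= t for some t, a maximal
   preordering containing them is total, and a |-> sup {r | a - r >= 0} is
   then a character. *)

(** * Unital commutative C*-algebras *)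

(** In (2) no topology is put on the characters of [B]. Everything is read off from their values,
    through three facts: they compute the norm, an ideal is determined by its hull, and uniform
    limits of represented functions are represented. Nor are the quotients shown to be C*-algebras;
    their norm is bounded by correcting a representative by an element of the ideal. For each
    precision the AANR property gives a map [r] defined only near the compactification, hence a
    homomorphism into [B/J_n] only for [n] beyond a rank depending on the precision; a diagonal
    choice turns these into one sequence. The precision is measured on points and does not mention
    [f], so by uniform continuity a single homomorphism serves all [f]. In (1) nothing says at the
    outset that [r(y)] depends continuously on [y]; continuity at [y] is recovered by testing
    [psi_n] on the distance function to [theta(r(y))] itself. *)

Section RenormLimits.
Context {R : realType}.

Lemma renormZ (V : normedModType R[i]) (k : R[i]) (v : V) :
  renorm (k *: v) = renorm (k : R[i]^o) * renorm v.
Proof. by apply: complexI; rewrite rmorphM/= -!renormE normrZ. Qed.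

Lemma renorm_real (x : R) : renorm (x%:C : R[i]^o) = `|x|.
Proof. by rewrite /renorm norm_real. Qed.

Lemma renorm0 (V : normedZmodType R[i]) : renorm (0 : V) = 0.
Proof. by rewrite /renorm normr0. Qed.

Lemma renormB (V : normedZmodType R[i]) (v w : V) :
  renorm (v - w) = renorm (w - v).
Proof. by rewrite -renormN opprB. Qed.

Lemma renormBD (V : normedZmodType R[i]) (u v w : V) :
  renorm (v - w) <= renorm (v - u) + renorm (u - w).
Proof. by rewrite (le_trans _ (renormD _ _))// addrA subrK. Qed.

Lemma cvg_renormP (V : normedModType R[i]) (T : Type) (F : set_system T)
    (f : T -> V) (l : V) : Filter F ->
  f @ F --> l <->
  (forall eps : R, 0 < eps -> \forall t \near F, renorm (l - f t) < eps).
Proof.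
move=> FF; split=> [/cvgrPdist_lt fl d d0|fl].
  have := fl d%:C; rewrite ltcR => /(_ d0); apply: filterS => t.
  by rewrite renorm_lt.
apply/cvgrPdist_lt => _ /gt0_complexE[d d0 ->].
by apply: filterS (fl _ d0) => t; rewrite renorm_lt.
Qed.

Lemma complete_renorm (V : completeNormedModType R[i]) (u : nat -> V)
    (eps : nat -> R) : eps @ \oo --> (0 : R^o) ->
  (forall n m, (n <= m)%N -> renorm (u m - u n) <= eps n) ->
  exists l, forall n, renorm (l - u n) <= eps n.
Proof.
move=> eps0 ueps; have /cauchy_cvg/cvg_ex[/= l ul] : cauchy (u @ \oo).
  apply/cauchy_ballP => _ /gt0_complexE[d d0 ->].
  have d20 : 0 < d / 2 by rewrite divr_gt0.
  have /cvgrPdist_lt/(_ _ d20)[N _ /(_ N (leqnn N))/=] := eps0.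
  rewrite sub0r normrN => epsN; rewrite !near_simpl.
  exists ([set n | N <= n]%N, [set n | N <= n]%N).
    by split; exists N.
  move=> [n m] /= [Nn Nm]; rewrite -ball_normE/= renorm_lt.
  rewrite (le_lt_trans (renormBD (u N) _ _))// (splitr d) ltrD//.
    by rewrite (le_lt_trans (ueps _ _ Nn))// (le_lt_trans (ler_norm _)).
  rewrite renormB.
  by rewrite (le_lt_trans (ueps _ _ Nm))// (le_lt_trans (ler_norm _)).
exists l => n; apply/ler_addgt0Pr => d d0.
move/cvg_renormP : ul => /(_ _ d0)[N _ ulN].
rewrite (le_trans (renormBD (u (maxn N n)) _ _))// addrC lerD//.
  by apply: ueps; exact: leq_maxr.
by apply/ltW/ulN; exact: leq_maxl.
Qed.

Lemma le_cvg0_le0 (v C : R) (eps : nat -> R) : eps @ \oo --> (0 : R^o) ->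
  (forall n, v <= C * eps n) -> v <= 0.
Proof.
move=> eps0 vC; apply/ler_addgt0Pr => d d0; rewrite add0r.
have C0 : 0 < `|C| + 1 by rewrite ltr_wpDl.
have dC0 : 0 < d / (`|C| + 1) by rewrite divr_gt0.
have /cvgrPdist_lt/(_ _ dC0)[N _ /(_ N (leqnn N))/=] := eps0.
rewrite sub0r normrN => epsN; rewrite (le_trans (vC N))//.
rewrite (le_trans (ler_norm _))// normrM.
rewrite ltr_pdivlMr// in epsN; apply: le_trans (ltW epsN).
by rewrite mulrC ler_wpM2l// lerDl.
Qed.

End RenormLimits.

Definition is_unit (R : realType) (B : cstarType R) (e : B) : Prop :=
  forall a : B, cmul e a = a /\ cmul a e = a.

(* A copy of [B] carrying a commutative ring structure, which needs the unit and
   the commutativity of [B] as parameters. *)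
Definition calg (R : realType) (B : cstarType R) (e : B) (_ : is_unit e)
  (_ : commutative_cstar B) : Type := B.

(** * Scalars, involution and square roots in a unital commutative C*-algebra *)

Section Calg.
Context {R : realType} {B : cstarType R} {e : B} (eP : is_unit e)
  (BC : commutative_cstar B).
Local Notation A := (calg eP BC).

HB.instance Definition _ := CStarAlgebra.copy A B.

Let calg_mul1 : left_id (e : A) (@cmul R A).
Proof. by move=> a; case: (eP a). Qed.

HB.instance Definition _ := GRing.Zmodule_isComPzRing.Build A
  (@cmulA R A) BC calg_mul1 (@cmulDl R A).

Lemma calg_scaleAl (k : R[i]) (a b : A) : k *: (a * b) = (k *: a) * b.
Proof. exact: cscalerAl. Qed.


(** Real scalars enter through a ring morphism, so that identities mixing scalars and elements
    reduce to the morphism lemmas and [ring]. *)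
Definition rsc (r : R) : A := r%:C *: (1 : A).

Lemma rscE1 r : rsc r = r%:C *: (1 : A).
Proof. by []. Qed.

Lemma rsc_zmod : zmod_morphism rsc.
Proof. by move=> r s; rewrite /rsc rmorphB/= scalerBl. Qed.

Lemma rsc_monoid : monoid_morphism rsc.
Proof.
split; first by rewrite /rsc rmorph1 scale1r.
by move=> r s; rewrite /rsc rmorphM/= -calg_scaleAl mul1r scalerA.
Qed.

HB.instance Definition _ := GRing.isZmodMorphism.Build R A rsc rsc_zmod.
HB.instance Definition _ := GRing.isMonoidMorphism.Build R A rsc rsc_monoid.


Local Notation nm a := (renorm (a : A)).
Local Notation star a := (cstar (a : A) : A).
Implicit Types (a b x y : A) (r t : R).

Lemma nmM a b : nm (a * b) <= nm a * nm b.
Proof. by rewrite -lecR rmorphM/= -!renormE; exact: cnormM. Qed.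

Lemma nm_starM a : nm (star a * a) = nm a ^+ 2.
Proof.
by apply: complexI; rewrite rmorphXn/= -!renormE; exact: cnorm_star.
Qed.

Lemma nm_star a : nm (star a) = nm a.
Proof.
have le b : nm b <= nm (star b).
  have [b0|b0] := eqVneq (nm b) 0; first by rewrite b0 renorm_ge0.
  have b1 : 0 < nm b by rewrite lt_neqAle eq_sym b0 renorm_ge0.
  by rewrite -(ler_pM2r b1) -expr2 -nm_starM nmM.
by apply/eqP; rewrite eq_le le -{2}(cstarK a) le.
Qed.

Lemma cstar1 : star 1 = 1.
Proof.
have : star (star 1 * 1) = 1 * 1.
  by rewrite mulr1 cstarK mulr1.
have -> : star (star 1 * 1) = star 1 * star (star 1).
  exact: cstarM.
by rewrite cstarK !mulr1.
Qed.

Lemma starM a b : star (a * b) = star a * star b.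
Proof. by rewrite mulrC; exact: cstarM. Qed.

(** Only an inequality, since in the zero algebra the unit has norm 0. *)
Lemma nm1 : nm 1 <= 1.
Proof.
have [->//|n0] := eqVneq (nm 1) 0.
have n1 : 0 < nm 1 by rewrite lt_neqAle eq_sym n0 renorm_ge0.
by rewrite -(ler_pM2r n1) mul1r -expr2 -nm_starM cstar1 mulr1.
Qed.

Lemma rscE r a : rsc r * a = r%:C *: a.
Proof. by rewrite /rsc -calg_scaleAl mul1r. Qed.

Lemma nm_rscM r a : nm (rsc r * a) = `|r| * nm a.
Proof. by rewrite rscE renormZ renorm_real. Qed.

Lemma nm_rsc r : nm (rsc r) <= `|r|.
Proof.
by rewrite -[rsc r]mulr1 nm_rscM ler_piMr// nm1.
Qed.

Definition selfadjoint a := star a = a.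

Lemma sa_rsc r : selfadjoint (rsc r).
Proof. by rewrite /selfadjoint /rsc cstarZ cstar1 conjc_real. Qed.

Lemma saD a b : selfadjoint a -> selfadjoint b -> selfadjoint (a + b).
Proof. by move=> sa_a sa_b; rewrite /selfadjoint cstarD sa_a sa_b. Qed.

Lemma saB a b : selfadjoint a -> selfadjoint b -> selfadjoint (a - b).
Proof. by move=> sa_a sa_b; rewrite /selfadjoint cstarB sa_a sa_b. Qed.

Lemma saM a b : selfadjoint a -> selfadjoint b -> selfadjoint (a * b).
Proof. by move=> sa_a sa_b; rewrite /selfadjoint starM sa_a sa_b. Qed.

Lemma sa1 : selfadjoint 1. Proof. exact: cstar1. Qed.

Lemma sqrt_subproof (x : A) : nm x < 1 ->
  exists2 y : A, x + y * y = rsc 2 * y /\ nm y <= 1 & selfadjoint x ->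
    selfadjoint y.
Proof.
(* This [t] satisfies [nm x + t^2 <= 2 t], so [y |-> (x + y^2) / 2] maps the ball of radius [t] into
   itself, and it contracts that ball by the factor [t < 1]. *)
move=> x1; pose t := (1 + nm x) / 2.
have nx0 := renorm_ge0 x.
have t0 : 0 <= t by rewrite /t; lra.
have t1 : t < 1 by rewrite /t; lra.
have tx : nm x + t ^+ 2 <= 2 * t by rewrite /t; nra.
pose y_ := fix y n :
  A := if n is n'.+1 then rsc 2^-1 * (x + y n' * y n') else 0.
have yS n : y_ n.+1 = rsc 2^-1 * (x + y_ n * y_ n) by [].
have yt n : nm (y_ n) <= t.
  elim: n => [|n IH]; first by rewrite renorm0.
  rewrite yS nm_rscM ger0_norm ?invr_ge0// mulrC ler_pdivrMr//.
  rewrite (le_trans (renormD _ _))// (le_trans _ (le_trans tx _))//; last lra.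
  by rewrite lerD// (le_trans (nmM _ _))// expr2 ler_pM ?renorm_ge0.
have yd n : nm (y_ n.+1 - y_ n) <= t ^+ n.
  elim: n => [|n IH].
    rewrite yS /= subr0 mul0r addr0 nm_rscM ger0_norm ?invr_ge0// expr0.
    lra.
  rewrite (yS n.+1) [in X in _ - X]yS -mulrBr.
  have -> : x + y_ n.+1 * y_ n.+1 - (x + y_ n * y_ n) =
     (y_ n.+1 - y_ n) * (y_ n.+1 + y_ n) by ring.
  rewrite nm_rscM ger0_norm ?invr_ge0// exprSr.
  have := nmM (y_ n.+1 - y_ n) (y_ n.+1 + y_ n).
  have : nm (y_ n.+1 + y_ n) <= t + t.
    by rewrite (le_trans (renormD _ _))// lerD.
  have := renorm_ge0 (y_ n.+1 + y_ n).
  have := renorm_ge0 (y_ n.+1 - y_ n).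
  nra.
have t10 : 0 < 1 - t by lra.
have yk n k : nm (y_ (n + k)%N - y_ n) <= t ^+ n * (1 - t ^+ k) / (1 - t).
  elim: k => [|k IH]; first by rewrite addn0 !subrr renorm0 mulr0 mul0r.
  rewrite addnS (le_trans (renormBD (y_ (n + k)%N) _ _))//.
  rewrite (le_trans (lerD (yd _) IH))// exprD exprS.
  rewrite -(ler_pM2r t10) mulrDl !divfK ?gt_eqF//.
  lra.
pose eps n := t ^+ n * (1 - t)^-1.
have eps0 : eps @ \oo --> (0 : R^o).
  rewrite -[0](mul0r (1 - t)^-1); apply: cvgMl.
  by apply: cvg_expr; rewrite ger0_norm.
have [|y yeps] := @complete_renorm R A y_ eps eps0.
  move=> n m lenm; rewrite -(subnKC lenm) (le_trans (yk _ _))// /eps.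
  rewrite ler_wpM2r ?invr_ge0 ?(ltW t10)// ler_piMr ?exprn_ge0//.
  by rewrite gerBl exprn_ge0.
have eps_ge0 n : 0 <= eps n.
  by rewrite mulr_ge0 ?exprn_ge0 ?invr_ge0 ?(ltW t10).
have yt' : nm y <= t.
  rewrite -subr_le0; apply: (@le_cvg0_le0 _ _ 1 _ eps0) => n.
  rewrite mul1r lerBlDl -[y](subrK (y_ n)) addrC.
  by rewrite (le_trans (renormD _ _))// lerD.
exists y; first split.
- apply/eqP; rewrite -subr_eq0; apply/eqP/renorm_eq0/eqP.
  rewrite eq_le renorm_ge0 andbT.
  (* The residual splits into [(y - y_n) (y + y_n)] and [2 (y_{n+1} - y)]; each has norm at most
     [2 * eps n], whence the 4. *)
  apply: (@le_cvg0_le0 _ _ 4 _ eps0) => n.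
  have -> : x + y * y - rsc 2 * y =
      (y - y_ n) * (y + y_ n) + rsc 2 * (y_ n.+1 - y).
    rewrite yS mulrBr mulrA -rmorphM divff// rmorph1 mul1r; ring.
  rewrite (le_trans (renormD _ _))//.
  rewrite nm_rscM ger0_norm// renormB.
  have := nmM (y - y_ n) (y + y_ n).
  have : nm (y + y_ n) <= 2.
    rewrite (le_trans (renormD _ _))//; have := yt n; lra.
  have : eps n.+1 <= eps n.
    by rewrite ler_wpM2r ?invr_ge0 ?(ltW t10)// exprS ler_piMl ?exprn_ge0 ?(ltW
      t1).
  have := renorm_ge0 (y + y_ n); have := renorm_ge0 (y - y_ n).
  have := yeps n; have := yeps n.+1; nra.
- by rewrite (le_trans yt')// ltW.
move=> xsa; have ysa n : selfadjoint (y_ n).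
  elim: n => [|n IH]; first by rewrite /selfadjoint cstar0.
  by rewrite yS; apply: saM; [exact: sa_rsc|apply: saD => //; exact: saM].
rewrite /selfadjoint; apply/eqP; rewrite -subr_eq0; apply/eqP/renorm_eq0/eqP.
rewrite eq_le renorm_ge0 andbT; apply: (@le_cvg0_le0 _ _ 2 _ eps0) => n.
rewrite (le_trans (renormBD (y_ n) _ _))// -{1}(ysa n) -cstarB nm_star.
by rewrite [X in _ + X]renormB; have := yeps n; lra.
Qed.

(* [y = x/2 + y^2/2] is a contraction near 0, so that [1 - x = (1 - y)^2] has
   a solution without the binomial series. *)
Lemma sqrt_1B x : nm x < 1 -> selfadjoint x ->
  exists s, [/\ selfadjoint s, s * s = 1 - x & nm (1 - s) <= 1].
Proof.
move=> x1 xsa; have [y [xy y1] /(_ xsa) ysa] := sqrt_subproof x1.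
exists (1 - y); split; first exact/saB/ysa/sa1.
  have -> : x = rsc 2 * y - y * y by rewrite -xy; ring.
  rewrite (_ : rsc 2 = 1 + 1); last by rewrite -[2]/(1 + 1) rmorphD/= rmorph1.
  ring.
by rewrite opprB addrCA subrr addr0.
Qed.

End Calg.

(** * Positive elements and the order they define *)

Section Positivity.
Context {R : realType} {B : cstarType R} {e : B} {eP : is_unit e}
  {BC : commutative_cstar B}.
Local Notation A := (calg eP BC).
Local Notation nm a := (renorm (a : A)).
Local Notation star a := (cstar (a : A) : A).
Local Notation rsc := (@rsc R B e eP BC).
Implicit Types (a b c p q x y : A) (r s t d m : R).

Definition cI : A := 'i%C *: (1 : A).

Lemma iiM : cI * cI = -1 :> A.
Proof.
rewrite /cI -calg_scaleAl mul1r scalerA.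
rewrite (_ : 'i%C * 'i%C = -1 :> R[i]) ?scaleN1r//.
by apply/eqP; rewrite eq_complex/= !(mulr0, mul0r, mulr1, addr0, sub0r) oppr0
  !eqxx.
Qed.

Lemma star_ii : star cI = - cI.
Proof.
rewrite /cI cstarZ cstar1 -scaleNr; congr (_ *: _).
by apply/eqP; rewrite eq_complex/= oppr0 !eqxx.
Qed.

Lemma nm_iiM a : nm (cI * a) = nm a.
Proof.
by rewrite /cI -calg_scaleAl mul1r renormZ /renorm norm_i/= mul1r.
Qed.

Lemma starD a b : star (a + b) = star a + star b.
Proof. exact: cstarD. Qed.

Lemma saN a : selfadjoint a -> selfadjoint (- a).
Proof. by move=> sa_a; rewrite -sub0r; apply: saB => //;
  rewrite /selfadjoint cstar0. Qed.

(** By commutativity the cross terms of [(x + i y)^* (x + i y)] cancel. Hence a norm bound on a sum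
    of two self-adjoint squares bounds each root, through [cunit_re] and [cunit_im]. *)
Lemma cunit_sq x y :
  selfadjoint x -> selfadjoint y -> nm (x + cI * y) ^+ 2 = nm (x * x + y * y).
Proof.
move=> xsa ysa; rewrite -nm_starM; congr (renorm _).
rewrite starD starM star_ii xsa ysa.
rewrite (_ : (x + - cI * y) * _ = x * x - (cI * cI) * (y * y)); last ring.
by rewrite iiM mulN1r opprK.
Qed.

Lemma cunit_re x y : selfadjoint x -> selfadjoint y -> nm x <= nm (x + cI * y).
Proof.
move=> xsa ysa; have xE : rsc 2 * x = (x + cI * y) + star (x + cI * y).
  rewrite starD starM star_ii xsa ysa -[2]/(1 + 1) rmorphD/= rmorph1; ring.
have : nm (rsc 2 * x) <= nm (x + cI * y) + nm (x + cI * y).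
  by rewrite xE (le_trans (renormD _ _))// nm_star.
by rewrite nm_rscM ger0_norm// mulr_natl mulr2n; lra.
Qed.

Lemma cunit_im x y : selfadjoint x -> selfadjoint y -> nm y <= nm (x + cI * y).
Proof.
move=> xsa ysa; rewrite -(nm_iiM (x + _)) mulrDr mulrA iiM mulN1r addrC.
rewrite -(renormN y); apply: cunit_re => //; exact: saN.
Qed.

(** Write [t - b^2 = t s^2] with [s] a root of [1 - b^2 / t]. For [x = b / sqrt t] one has
    [x^2 + s^2 = 1], so [x + i s] has norm at most 1, and with it [s]. *)
Lemma sq_bound_lt b t :
  selfadjoint b -> nm (b * b) < t -> nm (rsc t - b * b) <= t.
Proof.
move=> bsa bt; have t0 : 0 < t by rewrite (le_lt_trans _ bt)// renorm_ge0.
have [||s [ssa sE _]] := @sqrt_1B _ _ _ eP BC (rsc t^-1 * (b * b)).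
- by rewrite nm_rscM ger0_norm ?invr_ge0 ?(ltW t0)// mulrC ltr_pdivrMr ?mul1r.
- by apply: saM; [exact: sa_rsc|exact: saM].
have tE : rsc t * rsc t^-1 = 1 by rewrite -rmorphM/= divff ?rmorph1 ?gt_eqF.
have sE' : rsc t - b * b = rsc t * (s * s).
  by rewrite sE mulrBr mulr1 [rsc t * _]mulrA tE mul1r.
rewrite sE' nm_rscM gtr0_norm// ler_piMr ?(ltW t0)//.
pose x : A := rsc (Num.sqrt t^-1) * b.
have xsa : selfadjoint x by apply: saM => //; exact: sa_rsc.
have xx : x * x + s * s = 1.
  rewrite /x mulrACA -rmorphM/= -expr2 sqr_sqrtr ?invr_ge0 ?(ltW t0)//.
  by rewrite sE addrC subrK.
have u1 : nm (x + cI * s) ^+ 2 <= 1 by rewrite cunit_sq// xx nm1.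
have := cunit_im xsa ssa; have := nmM s s; have := renorm_ge0 s; nra.
Qed.


(** Positivity without spectra. With [t] left existential, stability under sums is just the triangle
    inequality. *)
Definition cpositive a := selfadjoint a /\ exists2 t, 0 <= t & nm (rsc t - a)
  <= t.

Lemma pos_sa a : cpositive a -> selfadjoint a. Proof. by case. Qed.

Lemma posD a b : cpositive a -> cpositive b -> cpositive (a + b).
Proof.
move=> [asa [t t0 ta]] [bsa [s s0 sb]]; split; first exact: saD.
exists (t + s); first exact: addr_ge0.
rewrite rmorphD/= opprD addrACA (le_trans (renormD _ _))//; exact: lerD.
Qed.

Lemma pos_rsc r : 0 <= r -> cpositive (rsc r).
Proof.
move=> r0; split; first exact: sa_rsc.
by exists r => //; rewrite subrr renorm0.
Qed.

Lemma pos1 : cpositive 1.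
Proof. by rewrite -(rmorph1 rsc); exact: pos_rsc. Qed.

Lemma pos_rscM r a : 0 <= r -> cpositive a -> cpositive (rsc r * a).
Proof.
move=> r0 [asa [t t0 ta]]; split; first by apply: saM => //; exact: sa_rsc.
exists (r * t); first exact: mulr_ge0.
by rewrite rmorphM/= -mulrBr nm_rscM ger0_norm// ler_wpM2l.
Qed.

Lemma pos_sq b : selfadjoint b -> cpositive (b * b).
Proof.
move=> bsa; split; first exact: saM.
exists (nm (b * b) + 1); first by rewrite addr_ge0// renorm_ge0.
by apply: sq_bound_lt => //; rewrite ltrDl.
Qed.

Lemma pos_nmB a : selfadjoint a -> cpositive (rsc (nm a) - a).
Proof.
move=> asa; split; first by apply: saB => //; exact: sa_rsc.
exists (nm a); first exact: renorm_ge0.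
by rewrite opprB addrC subrK.
Qed.

Lemma pos_nmD a : selfadjoint a -> cpositive (rsc (nm a) + a).
Proof. by move=> /saN /pos_nmB; rewrite renormN opprK. Qed.

(** [a + d = (t + d) (1 - (t - a) / (t + d))], and the slack [d] makes the norm of the subtracted
    term strictly less than 1, as [sqrt_1B] requires. *)
Lemma pos_sqrt a d : 0 < d -> cpositive a ->
  exists x, [/\ selfadjoint x, cpositive x & x * x = a + rsc d].
Proof.
move=> d0 [asa [t t0 ta]]; have td0 : 0 < t + d by rewrite ltr_wpDl.
have tE : rsc (t + d) * rsc (t + d)^-1 = 1.
  by rewrite -rmorphM/= divff ?rmorph1 ?gt_eqF.
have [||s [ssa sE s1]] := @sqrt_1B _ _ _ eP BC (rsc (t + d)^-1 * (rsc t - a)).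
- rewrite nm_rscM ger0_norm ?invr_ge0 ?(ltW td0)//.
  by rewrite mulrC ltr_pdivrMr// mul1r (le_lt_trans ta)// ltrDl.
- by apply: saM; [|apply: saB => //]; exact: sa_rsc.
have sqE : rsc (Num.sqrt (t + d)) * rsc (Num.sqrt (t + d)) = rsc (t + d).
  by rewrite -rmorphM/= -expr2 sqr_sqrtr// ltW.
have sp : cpositive s by split=> //; exists 1 => //; rewrite rmorph1.
exists (rsc (Num.sqrt (t + d)) * s); split.
- by apply: saM => //; exact: sa_rsc.
- by apply: pos_rscM => //; exact: sqrtr_ge0.
- by rewrite mulrACA sqE sE mulrBr mulr1 mulrA tE mul1r rmorphD/=; ring.
Qed.

(** With [x^2 = a + h] and [y^2 = b + h], the product is the limit of the squares [(x y)^2] as [h]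
    tends to 0. The witness [T] exceeds the norms of these squares for all [h <= 1], so it survives
    the limit. *)
Lemma posM a b : cpositive a -> cpositive b -> cpositive (a * b).
Proof.
move=> pa pb; split; first by apply: saM; exact: pos_sa.
pose C := nm a + nm b + 1.
have a0 := renorm_ge0 a; have b0 := renorm_ge0 b.
have C1 : 1 <= C by rewrite /C; lra.
pose T := (nm a + 1) * (nm b + 1) + 1.
have T0 : 0 <= T by rewrite /T; nra.
exists T => //; apply/ler_addgt0Pr => d d0.
(* The error is [h (a + b + h)], of norm at most [h C] since [h <= 1]. *)
pose h := Num.min 1 (d / C); have h0 : 0 < h.
  by rewrite lt_min ltr01 divr_gt0// (lt_le_trans _ C1).
have [x [xsa px xE]] := pos_sqrt h0 pa; have [y [ysa py yE]] := pos_sqrt h0 pb.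
have h1 : h <= 1 by rewrite ge_min lexx.
have hC : h * C <= d.
  by rewrite -ler_pdivlMr ?ge_min ?lexx ?orbT// (lt_le_trans _ C1).
have abE : (x * y) * (x * y) = (a + rsc h) * (b + rsc h).
  by rewrite mulrACA xE yE.
have nh (c : A) : nm (c + rsc h) <= nm c + h.
  by rewrite (le_trans (renormD _ _))// lerD// (le_trans (nm_rsc _ _ _))//
    gtr0_norm.
have : nm (rsc T - (x * y) * (x * y)) <= T.
  apply: sq_bound_lt; first exact: saM.
  rewrite abE (le_lt_trans (nmM _ _))// /T.
  have := nh a; have := nh b; have := renorm_ge0 (a + rsc h).
  have := renorm_ge0 (b + rsc h); nra.
move=> xyT; rewrite (le_trans (renormBD ((x * y) * (x * y)) _ _))// lerD//.
rewrite abE (_ : _ - _ = rsc h * (a + b + rsc h)); last ring.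
rewrite nm_rscM gtr0_norm// (le_trans _ hC)// ler_wpM2l// ?(ltW h0)//.
by rewrite (le_trans (nh _))// lerD// renormD.
Qed.

(** Roots [x] of [a + d/3] and [y] of [m - a + d/3] satisfy [nm (x + i y) ^ 2 <= m + 2 d/3], which
    bounds [x^2]; passing back to [a = x^2 - d/3] costs the last third. *)
Lemma pos_nm_le a m :
  0 <= m -> cpositive a -> cpositive (rsc m - a) -> nm a <= m.
Proof.
move=> m0 pa pma; apply/ler_addgt0Pr => d d0.
have d30 : 0 < d / 3 by rewrite divr_gt0.
have [x [xsa px xE]] := pos_sqrt d30 pa.
have [y [ysa py yE]] := pos_sqrt d30 pma.
have u : nm (x + cI * y) ^+ 2 <= m + 2 * (d / 3).
  rewrite cunit_sq// xE yE.
  have -> : a + rsc (d / 3) + (rsc m - a + rsc (d / 3)) =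
      rsc (m + d / 3 + d / 3) by rewrite !rmorphD/=; ring.
  by rewrite (le_trans (nm_rsc _ _ _))// ger0_norm; lra.
have aE : a = x * x - rsc (d / 3) by rewrite xE addrK.
have h : nm (x * x) <= m + 2 * (d / 3).
  rewrite (le_trans (nmM _ _))// (le_trans _ u)// expr2.
  by rewrite ler_pM ?renorm_ge0 ?cunit_re.
rewrite aE (le_trans (renormD _ _))// renormN.
have := nm_rsc eP BC (d / 3); rewrite gtr0_norm//; lra.
Qed.

Lemma pos_nm_mono a b :
  selfadjoint b -> cpositive a -> cpositive (b - a) -> nm a <= nm b.
Proof.
move=> bsa pa pab; apply: pos_nm_le => //; first exact: renorm_ge0.
rewrite -(subrK b (rsc _)) -addrA; apply: posD => //; exact: pos_nmB.
Qed.

Definition cRe a : A := rsc 2^-1 * (a + star a).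
Definition cIm a : A := rsc 2^-1 * (cI * (star a - a)).

Lemma two_half : rsc 2^-1 + rsc 2^-1 = 1 :> A.
Proof. by rewrite -rmorphD/= -[2^-1]mul1r -splitr rmorph1. Qed.

Lemma re_im a : a = cRe a + cI * cIm a.
Proof.
rewrite /cRe /cIm (_ : _ + _ = rsc 2^-1 * (a + star a) +
  cI * cI * (rsc 2^-1 * (star a - a))); last ring.
rewrite iiM (_ : _ + _ = (rsc 2^-1 + rsc 2^-1) * a); last ring.
by rewrite two_half mul1r.
Qed.

Lemma starB a b : star (a - b) = star a - star b.
Proof. exact: cstarB. Qed.

Lemma sa_re a : selfadjoint (cRe a).
Proof.
rewrite /cRe; apply: saM; first exact: sa_rsc.
by rewrite /selfadjoint starD cstarK addrC.
Qed.

Lemma sa_im a : selfadjoint (cIm a).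
Proof.
rewrite /cIm; apply: saM; first exact: sa_rsc.
rewrite /selfadjoint starM starB star_ii cstarK; ring.
Qed.

Lemma starM_re_im a : star a * a = cRe a * cRe a + cIm a * cIm a.
Proof.
rewrite {1 2}(re_im a) starD starM star_ii (sa_re a) (sa_im a).
rewrite (_ : _ * _ = cRe a * cRe a - (cI * cI) * (cIm a * cIm a)); last ring.
by rewrite iiM mulN1r opprK.
Qed.

Lemma pos_starM a : cpositive (star a * a).
Proof.
rewrite starM_re_im; apply: posD; apply: pos_sq; [exact: sa_re|exact: sa_im].
Qed.

End Positivity.

(** * Maximal preorderings and the characters they define *)

Section Characters.
Context {R : realType} {B : cstarType R} {e : B} {eP : is_unit e}
  {BC : commutative_cstar B}.
Local Notation A := (calg eP BC).
Local Notation nm a := (renorm (a : A)).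
Local Notation star a := (cstar (a : A) : A).
Local Notation rsc := (@rsc R B e eP BC).
Implicit Types (a b c p q x y : A) (r s t d m : R) (M : set A).

(** A proper preordering in the sense of real algebra, on the self-adjoint elements; it contains
    their squares by [pos_sq]. *)
Definition preorder_cone M :=
  [/\ M `<=` [set a | selfadjoint a], [set a | cpositive a] `<=` M,
      forall a b, M a -> M b -> M (a + b),
      forall a b, M a -> M b -> M (a * b)
    & ~ M (- 1)].

Lemma preorder_cone_max M0 : preorder_cone M0 ->
  exists2 M, preorder_cone M /\ M0 `<=` M &
    forall N, preorder_cone N -> M `<=` N -> N `<=` M.
Proof.
move=> pM0; have [M0sa posM0 M0D M0M M0N] := pM0.
(* Zorn is applied to the sets added to [M0], so that the empty chain, whose union is empty, still
   yields the preordering [M0]. *)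
have [F FP Ftot|X [PX Xmax]] :=
    @Zorn_bigcup A [set X | preorder_cone (M0 `|` X)].
  have both a b : (M0 `|` \bigcup_(X in F) X) a ->
      (M0 `|` \bigcup_(X in F) X) b ->
      (M0 a /\ M0 b) \/ exists2 X, F X & (M0 `|` X) a /\ (M0 `|` X) b.
    move=> [M0a|[X FX Xa]] [M0b|[Y FY Yb]].
    - by left.
    - by right; exists Y => //; split; [left|right].
    - by right; exists X => //; split; [right|left].
    - by have [XY|YX] := Ftot _ _ FX FY; right;
        [exists Y|exists X] => //; split; right => //; [exact: XY|exact: YX].
  split.
  - move=> a [/M0sa//|[X FX Xa]].
    by have [+ _ _ _ _] := FP _ FX; apply; right.
  - by move=> a /posM0; left.
  - move=> a b Ma Mb; have [[M0a M0b]|[X FX [Xa Xb]]] := both _ _ Ma Mb.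
      by left; exact: M0D.
    have [_ _ XD _ _] := FP _ FX.
    by case: (XD _ _ Xa Xb); [left|right; exists X].
  - move=> a b Ma Mb; have [[M0a M0b]|[X FX [Xa Xb]]] := both _ _ Ma Mb.
      by left; exact: M0M.
    have [_ _ _ XM _] := FP _ FX.
    by case: (XM _ _ Xa Xb); [left|right; exists X].
  - case=> [//|[X FX XN]]; have [_ _ _ _] := FP _ FX; apply.
    by right.
exists (M0 `|` X); first by split=> //; exact: subsetUl.
move=> N pN XN a Na; apply: contrapT => Xa; apply: (Xmax N).
  split; first by move=> b Xb; apply: XN; right.
  by move=> NX; apply: Xa; right; exact: NX.
rewrite /= (_ : M0 `|` N = N)//; apply/setUidPr => b M0b.
by apply: XN; left.
Qed.

Lemma pos0 : cpositive (0 : A).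
Proof. by rewrite -(rmorph0 rsc); exact: pos_rsc. Qed.

(** If [a] is missing, [M + a M] is stable under sums and products and strictly larger than [M], so
    by maximality it contains [-1]. If [a] and [-a] are both missing, the two resulting identities
    combine to put [-1] in [M] itself. *)
Lemma preorder_cone_total M : preorder_cone M ->
  (forall N, preorder_cone N -> M `<=` N -> N `<=` M) ->
  forall a, selfadjoint a -> M a \/ M (- a).
Proof.
move=> [Msa posM MD MM MN] Mmax.
have ext a : selfadjoint a -> ~ M a -> exists x y, [/\ M x, M y & x + a * y = -
  1].
  move=> asa Ma; apply: contrapT => noN; apply: Ma.
  apply: (Mmax [set z | exists x y, [/\ M x, M y & x + a * y = z]]);
    last 1 first.
  - by exists 0, 1; split; [exact/posM/pos0|exact/posM/pos1|ring].
  - split.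
    + move=> _ [x [y [Mx My <-]]]; apply: saD; first exact: Msa.
      by apply: saM => //; exact: Msa.
    + move=> z pz; exists z, 0; split; [exact: posM|exact/posM/pos0|ring].
    + move=> _ _ [x [y [Mx My <-]]] [x' [y' [Mx' My' <-]]].
      exists (x + x'), (y + y'); split; [exact: MD|exact: MD|ring].
    + move=> _ _ [x [y [Mx My <-]]] [x' [y' [Mx' My' <-]]].
      exists (x * x' + (a * a) * (y * y')), (x * y' + x' * y); split; last ring.
        by apply: (MD); [exact: MM|apply: (MM); [exact/posM/pos_sq|exact: MM]].
      by apply: (MD); exact: MM.
    + exact: noN.
  - by move=> z Mz; exists z, 0; split; [|exact/posM/pos0|ring].
move=> a asa; apply: contrapT => /not_orP[Ma MNa]; apply: MN.
have [x [y [Mx My xy]]] := ext _ asa Ma.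
have [x' [y' [Mx' My' xy']]] := ext _ (saN asa) MNa.
(* Multiply [1 + x = - a y] by [1 + x' = a y']. *)
have -> : - 1 = x + x' + x * x' + (a * a) * (y * y').
  have xE : x = - 1 - a * y by rewrite -xy addrK.
  have xE' : x' = - 1 + a * y' by rewrite -xy' mulNr subrK.
  by rewrite xE xE'; ring.
apply: (MD); last by apply: (MM); [exact/posM/pos_sq|exact: MM].
by apply: (MD); [exact: MD|exact: MM].
Qed.

Section OrderedValue.
Variable M : set A.
Hypotheses (Msa : M `<=` [set a | selfadjoint a]) (posM :
  [set a | cpositive a] `<=` M)
  (MD : forall a b, M a -> M b -> M (a + b))
  (MM : forall a b, M a -> M b -> M (a * b))
  (MN : ~ M (- 1)) (Mtot : forall a, selfadjoint a -> M a \/ M (- a)).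

Lemma cone_rsc r : M (rsc r) -> 0 <= r.
Proof.
move=> Mr; rewrite leNgt; apply/negP => r0; apply: MN.
have -> : - 1 = rsc (- r^-1) * rsc r.
  by rewrite -rmorphM/= mulNr mulVf ?lt_eqF// rmorphN rmorph1.
by apply: (MM) => //; apply/posM/pos_rsc; rewrite oppr_ge0 invr_le0 ltW.
Qed.

Let val_set a := [set r | M (a - rsc r)].
Let v a : R := sup (val_set a).

Let val_ub a r : selfadjoint a -> M (a - rsc r) -> r <= nm a.
Proof.
move=> asa Mr; rewrite -subr_ge0; apply: cone_rsc.
rewrite rmorphB/= -(subrK a (rsc (nm a))) -addrA; apply: (MD) => //.
exact/posM/pos_nmB.
Qed.

Let val_has_sup a : selfadjoint a -> has_sup (val_set a).
Proof.
move=> asa; split; last by exists (nm a) => r; exact: val_ub.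
exists (- nm a); rewrite /val_set/= rmorphN opprK addrC.
exact/posM/pos_nmD.
Qed.

Let v_lo a d : selfadjoint a -> 0 < d -> M (a - rsc (v a - d)).
Proof.
move=> asa d0; have [r Mr vr] := sup_adherent d0 (val_has_sup asa).
rewrite (_ : _ - _ = (a - rsc r) + rsc (r - (v a - d))); last first.
  by rewrite !rmorphB; ring.
by apply: (MD) => //; apply/posM/pos_rsc; rewrite subr_ge0 ltW.
Qed.

Let v_up a d : selfadjoint a -> 0 < d -> M (rsc (v a + d) - a).
Proof.
move=> asa d0; have [] := Mtot (saB (sa_rsc eP BC (v a + d)) asa) => //.
rewrite opprB => Mv; exfalso.
have := ub_le_sup (proj2 (val_has_sup asa)) Mv.
by rewrite -/(v a) gerDl leNgt d0.
Qed.

(** The supremum is not known to be attained, so a value is identified by two bounds up to every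
    slack [d]. *)
Let v_eq a r : selfadjoint a ->
  (forall d, 0 < d -> M (a - rsc (r - d)) /\ M (rsc (r + d) - a)) -> v a = r.
Proof.
move=> asa ar; apply/eqP; rewrite eq_le; apply/andP; split;
  apply/ler_addgt0Pr => d d0; have d20 : 0 < d / 2 by rewrite divr_gt0.
- have [_ up] := ar _ d20; rewrite -subr_ge0; apply: cone_rsc.
  have := MD up (v_lo asa d20); congr M.
  rewrite addrA subrK -rmorphB/=; congr rsc; lra.
- have [lo _] := ar _ d20; rewrite -subr_ge0; apply: cone_rsc.
  have := MD (v_up asa d20) lo; congr M.
  rewrite addrA subrK -rmorphB/=; congr rsc; lra.
Qed.

Let v_ge0 a : M a -> 0 <= v a.
Proof.
move=> Ma; apply: ub_le_sup; first by case: (val_has_sup (Msa Ma)).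
by rewrite /val_set/= rmorph0 subr0.
Qed.

Let vD a b : selfadjoint a -> selfadjoint b -> v (a + b) = v a + v b.
Proof.
move=> asa bsa; apply: v_eq => [|d d0]; first exact: saD.
have d20 : 0 < d / 2 by rewrite divr_gt0.
split.
- have := MD (v_lo asa d20) (v_lo bsa d20); congr M.
  rewrite addrACA -opprD -rmorphD/=; congr (_ - rsc _); lra.
- have := MD (v_up asa d20) (v_up bsa d20); congr M.
  rewrite addrACA -opprD -rmorphD/=; congr (rsc _ - _); lra.
Qed.

Let v_rsc r : v (rsc r) = r.
Proof.
apply: v_eq => [|d d0]; first exact: sa_rsc.
rewrite -!rmorphB/=; split; apply/posM/pos_rsc; lra.
Qed.

Let vN a : selfadjoint a -> v (- a) = - v a.
Proof.
move=> asa; apply/eqP; rewrite -addr_eq0 -vD//; last exact: saN.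
by rewrite addNr -(rmorph0 rsc) v_rsc.
Qed.

Let v_rscM r a : selfadjoint a -> v (rsc r * a) = r * v a.
Proof.
have pos_case t b : 0 < t -> selfadjoint b -> v (rsc t * b) = t * v b.
  move=> t0 bsa; apply: v_eq => [|d d0].
    by apply: saM => //; exact: sa_rsc.
  have dt0 : 0 < d / t by rewrite divr_gt0.
  have Mt : M (rsc t) by apply/posM/pos_rsc/ltW.
  have tE : t * (d / t) = d by rewrite mulrC divfK// gt_eqF.
  split.
  - have := MM Mt (v_lo bsa dt0); congr M.
    by rewrite mulrBr -rmorphM/= mulrBr tE.
  - have := MM Mt (v_up bsa dt0); congr M.
    by rewrite mulrBr -rmorphM/= mulrDr tE.
move=> asa; have [r0|r0|->] := ltrgt0P r.
- exact: pos_case.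
- have := @pos_case (- r) a; rewrite oppr_gt0 => /(_ r0 asa).
  rewrite rmorphN mulNr vN ?mulNr; last by apply: saM => //; exact: sa_rsc.
  by move/oppr_inj.
- by rewrite rmorph0 !mul0r -(rmorph0 rsc) v_rsc.
Qed.

(** For every [h > 0] both [h - a] and [h + a] lie in [M], hence so does their product [h^2 - a^2].
    Shifting by [v a] then gives [v_sq], and polarization the multiplicativity of [v]. *)
Let v_sq0 a : selfadjoint a -> v a = 0 -> v (a * a) = 0.
Proof.
move=> asa va; apply: v_eq => [|d d0]; first exact: saM.
have Maa : M (a * a) by exact/posM/pos_sq.
split; first by rewrite sub0r rmorphN opprK; apply/MD/posM/pos_rsc/ltW.
pose h := Num.min 1 d; have h0 : 0 < h by rewrite lt_min ltr01.
have h1 : h <= 1 by rewrite ge_min lexx.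
have hd : h <= d by rewrite ge_min lexx orbT.
have := v_lo asa h0; have := v_up asa h0; rewrite va add0r sub0r => up lo.
rewrite add0r (_ : _ - _ = (rsc h - a) * (a - rsc (- h)) + rsc (d - h * h)).
  by apply: (MD); [exact: MM|apply/posM/pos_rsc; nra].
by rewrite rmorphB rmorphM rmorphN/=; ring.
Qed.

Let v_sq a : selfadjoint a -> v (a * a) = v a * v a.
Proof.
move=> asa; pose b : A := a - rsc (v a).
have bsa : selfadjoint b by apply: saB => //; exact: sa_rsc.
have vb : v b = 0 by rewrite /b -rmorphN vD ?v_rsc ?subrr//; exact: sa_rsc.
rewrite (_ : a * a = b * b + (rsc (v a) * b + rsc (v a) * a)); last first.
  by rewrite /b; ring.
have rsa c : selfadjoint c -> selfadjoint (rsc (v a) * c) by apply: saM; exact: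
  sa_rsc.
rewrite vD; [|exact: saM|by apply: saD; exact: rsa].
rewrite vD; [|exact: rsa|exact: rsa].
by rewrite v_sq0// !v_rscM// vb mulr0 !add0r.
Qed.

Let vM a b : selfadjoint a -> selfadjoint b -> v (a * b) = v a * v b.
Proof.
move=> asa bsa.
have := v_sq (saD asa bsa); rewrite vD// (_ : (a + b) * (a + b) =
  a * a + (rsc 2 * (a * b) + b * b)); last first.
  rewrite -[2]/(1 + 1) rmorphD/= rmorph1; ring.
have absa : selfadjoint (rsc 2 * (a * b)) by apply: saM; [exact: sa_rsc|exact:
  saM].
rewrite vD; [|exact: saM|by apply: saD => //; exact: saM].
rewrite vD//; last exact: saM.
rewrite v_rscM; last exact: saM.
by rewrite !v_sq//; lra.
Qed.

Definition cone_char a : R[i] := (v (cRe a)) +i* (v (cIm a)).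

Lemma cone_char_sa a : selfadjoint a -> cone_char a = (v a)%:C.
Proof.
move=> asa; rewrite /cone_char.
have -> : cIm a = 0 by rewrite /cIm asa subrr !mulr0.
rewrite -(rmorph0 rsc) v_rsc /cRe asa -[in a + a](mul1r a) -mulrDl.
by rewrite mulrA mulrDr mulr1 two_half mul1r.
Qed.

Let char_reD a b : cRe (a + b) = cRe a + cRe b.
Proof. by rewrite /cRe starD; ring. Qed.

Let char_imD a b : cIm (a + b) = cIm a + cIm b.
Proof. by rewrite /cIm starD; ring. Qed.

Let decomp_uniq a x y :
  selfadjoint x -> selfadjoint y -> a = x + cI * y -> cRe a = x /\ cIm a = y.
Proof.
move=> xsa ysa ->; rewrite /cRe /cIm starD starM star_ii xsa ysa; split.
  rewrite (_ : _ * _ = (rsc 2^-1 + rsc 2^-1) * x); last ring.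
  by rewrite two_half mul1r.
rewrite (_ : _ * _ = - (cI * cI) * ((rsc 2^-1 + rsc 2^-1) * y)); last ring.
by rewrite two_half iiM opprK !mul1r.
Qed.

Lemma cone_charD : {morph cone_char : a b / a + b}.
Proof.
move=> a b; rewrite /cone_char char_reD char_imD !vD//;
  by [exact: sa_re|exact: sa_im].
Qed.

Lemma cone_charM a b : cone_char (a * b) = cone_char a * cone_char b.
Proof.
have ra := sa_re a; have rb := sa_re b; have ia := sa_im a.
have ib := sa_im b; rewrite /cone_char.
have [|||-> ->] := @decomp_uniq (a * b) (cRe a * cRe b - cIm a * cIm b)
  (cRe a * cIm b + cIm a * cRe b).
- by apply: saB; exact: saM.
- by apply: saD; exact: saM.
- rewrite {1}(re_im a) {1}(re_im b).
  rewrite (_ : _ * _ = cRe a * cRe b + (cI * cI) * (cIm a * cIm b) +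
    cI * (cRe a * cIm b + cIm a * cRe b)); last ring.
  by rewrite iiM mulN1r.
rewrite vD; [|exact: saM|exact/saN/saM].
rewrite vN; last exact: saM.
rewrite vD; [|exact: saM|exact: saM].
by rewrite (vM ra rb) (vM ia ib) (vM ra ib) (vM ia rb).
Qed.

Lemma cone_char_star a : cone_char (star a) = (cone_char a)^*%C.
Proof.
have ra := sa_re a; have ia := sa_im a; rewrite /cone_char.
have [|||-> ->] := @decomp_uniq (star a) (cRe a) (- cIm a) => //; first exact:
  saN.
  by rewrite {1}(re_im a) starD starM star_ii ra ia mulNr mulrN.
by rewrite vN.
Qed.

Lemma cone_charZ (k : R[i]) a : cone_char (k *: a) = k * cone_char a.
Proof.
have -> : k *: a = (rsc (complex.Re k) + cI * rsc (complex.Im k)) * a.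
  rewrite mulrDl -mulrA !rscE {1}(complexE k) scalerDl -scalerA; congr (_ + _).
  by rewrite /cI -calg_scaleAl mul1r.
rewrite cone_charM; congr (_ * _); rewrite /cone_char.
have [|||-> ->] := @decomp_uniq (rsc (complex.Re k) + cI * rsc (complex.Im k))
  (rsc (complex.Re k)) (rsc (complex.Im k)) => //.
- exact: sa_rsc.
- exact: sa_rsc.
by rewrite !v_rsc; case: (k).
Qed.

Lemma cone_char1 : cone_char 1 = 1.
Proof.
by rewrite cone_char_sa; [rewrite -(rmorph1 rsc) v_rsc|exact: sa1].
Qed.

Lemma cone_char_ge0 a : M a -> 0 <= complex.Re (cone_char a).
Proof. by move=> Ma; rewrite cone_char_sa ?v_ge0//; exact: Msa. Qed.

End OrderedValue.

End Characters.

Lemma conjM_renorm (R : realType) (z : R[i]) :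
  z^*%C * z = (renorm (z : R[i]^o) ^+ 2)%:C.
Proof.
case: z => x y; rewrite /renorm normc_def/= sqr_sqrtr ?addr_ge0 ?sqr_ge0//.
by apply/eqP; rewrite eq_complex/=; apply/andP; split; apply/eqP; ring.
Qed.

Lemma exp_small (R : realType) (r C d : R) : 0 <= r -> r < 1 -> 0 < d ->
  exists n, r ^+ n * C <= d.
Proof.
move=> r0 r1 d0; have C0 : 0 < `|C| + 1 by rewrite ltr_wpDl.
have : (fun n => r ^+ n) @ \oo --> (0 : R^o) by apply: cvg_expr;
  rewrite ger0_norm.
have dC0 : 0 < d / (`|C| + 1) by rewrite divr_gt0.
move=> /cvgrPdist_lt/(_ _ dC0)[N _ /(_ N (leqnn N))/=].
rewrite sub0r normrN ger0_norm ?exprn_ge0// ltr_pdivlMr// => rN.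
exists N; rewrite (le_trans _ (ltW rN))// ler_wpM2l ?exprn_ge0//.
by rewrite (le_trans (ler_norm _))// lerDl.
Qed.

(** A bare type: continuity of a function on it is replaced by [represented]. Because of [char1] it
    is empty when [B] is the zero algebra. *)
Record spectrum (R : realType) (B : cstarType R) (e : B) (eP : is_unit e)
    (BC : commutative_cstar B) := Character {
  character_fun :> calg eP BC -> R[i];
  charD : {morph character_fun : a b / a + b};
  charZ : forall (k : R[i]) a, character_fun (k *: a) = k * character_fun a;
  charM : {morph character_fun : a b / a * b};
  char_star : forall a : calg eP BC,
    character_fun (cstar a) = (character_fun a)^*%C;
  char1 : character_fun 1 = 1
}.

(** * Gelfand theory: norm, ideals and functions on the spectrum *)

Section Gelfand.
Context {R : realType} {B : cstarType R} {e : B} {eP : is_unit e}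
  {BC : commutative_cstar B}.
Local Notation A := (calg eP BC).
Local Notation nm a := (renorm (a : A)).
Local Notation star a := (cstar (a : A) : A).
Local Notation rsc := (@rsc R B e eP BC).
Local Notation S := (spectrum eP BC).
Implicit Types (a b c p q x y : A) (r s t d m : R) (M : set A) (chi : S).

Lemma char0 chi : chi 0 = 0.
Proof. by apply: (addrI (chi 0)); rewrite -charD !addr0. Qed.

Lemma charN chi a : chi (- a) = - chi a.
Proof. by apply/eqP; rewrite -addr_eq0 -charD addNr char0. Qed.

Lemma charB chi a b : chi (a - b) = chi a - chi b.
Proof. by rewrite charD charN. Qed.

Lemma char_rsc chi r : chi (rsc r) = r%:C.
Proof. by rewrite rscE1 charZ char1 mulr1. Qed.

Lemma charX chi a n : chi (a ^+ n) = chi a ^+ n.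
Proof. by elim: n => [|n IH]; rewrite ?expr0 ?char1// !exprS charM IH. Qed.

Lemma char_sa chi a : selfadjoint a -> chi a = (complex.Re (chi a))%:C.
Proof.
move=> asa; have := char_star chi a; rewrite asa; case: (chi a) => x y /=.
by move=> [yN]; congr Complex; lra.
Qed.

Lemma char_ge0 chi a : cpositive a -> 0 <= complex.Re (chi a).
Proof.
move=> pa; apply/ler_addgt0Pr => d d0.
have [x [xsa _ xE]] := pos_sqrt d0 pa.
have := congr1 chi xE; rewrite charM charD char_rsc (char_sa chi xsa).
rewrite (char_sa chi (pos_sa pa)) -rmorphM -rmorphD => -[<-].
by rewrite -expr2 sqr_ge0.
Qed.

Lemma char_starM chi a : chi (star a * a) = (renorm (chi a : R[i]^o) ^+ 2)%:C.
Proof.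
by rewrite charM char_star conjM_renorm.
Qed.

Lemma preorder_cone_char M : preorder_cone M ->
  exists chi, forall a, M a -> 0 <= complex.Re (chi a).
Proof.
move=> /preorder_cone_max[M' [pM' MM'] M'max].
have tot := preorder_cone_total pM' M'max.
have [Msa posM MD MM MN] := pM'.
exists (Character (cone_charD posM MD MM MN tot)
  (cone_charZ posM MD MM MN tot) (cone_charM posM MD MM MN tot)
  (cone_char_star posM MD MM MN tot) (cone_char1 posM MD MM MN tot)).
by move=> a /MM'; exact: cone_char_ge0.
Qed.

Lemma char_norm_le chi a : renorm (chi a : R[i]^o) <= nm a.
Proof.
have := char_ge0 chi (pos_nmB (pos_sa (pos_starM a))).
rewrite charB char_rsc char_starM -rmorphB/= subr_ge0 nm_starM.
by rewrite ler_pXn2r ?nnegrE ?renorm_ge0.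
Qed.

Lemma nm_exp2 c n : selfadjoint c -> nm (c ^+ (2 ^ n)) = nm c ^+ (2 ^ n).
Proof.
move=> csa; have saX k : selfadjoint (c ^+ k).
  by elim: k => [|k IH]; rewrite ?expr0 ?exprS; [exact: sa1|exact: saM].
elim: n => [|n IH]; first by rewrite expn0 !expr1.
rewrite expnS mulnC !exprM -IH -nm_starM saX.
by rewrite expr2.
Qed.

Lemma pos_exp c n : cpositive c -> cpositive (c ^+ n).
Proof.
move=> pc; elim: n => [|n IH]; rewrite ?expr0 ?exprS; first exact: pos1.
exact: posM.
Qed.

(* Multiplying [q (m - c) = 1 + p] by the powers of [c] gives
   [c^k <= m^(k+1) q], which is absurd for large [k] when [m < |c|]. *)
Lemma no_witness c p q m :
  0 <= m -> m < nm c -> cpositive c -> cpositive p -> cpositive q ->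
  p + q * (c - rsc m) <> - 1.
Proof.
move=> m0 mc pc pp pq pqE.
have {pqE}qE : q * (rsc m - c) = 1 + p.
  by rewrite -[q * _]opprK -mulrN opprB -[q * _](addKr p) pqE; ring.
have step k : cpositive (rsc (m ^+ k) * q - q * c ^+ k).
  elim: k => [|k IH]; first by rewrite !expr0 rmorph1 mul1r mulr1 subrr; exact:
    pos0.
  rewrite (_ : _ - _ = rsc m * (rsc (m ^+ k) * q - q * c ^+ k) +
    c ^+ k * (q * (rsc m - c))); last by rewrite exprS rmorphM/= exprS; ring.
  rewrite qE; apply: posD; first exact: pos_rscM.
  by apply: posM; [exact: pos_exp|apply: posD => //; exact: pos1].
have bound k : nm (c ^+ k) <= m ^+ k.+1 * nm q.
  have -> : m ^+ k.+1 * nm q = nm (rsc (m ^+ k.+1) * q).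
    by rewrite nm_rscM ger0_norm// exprn_ge0.
  apply: pos_nm_mono; first by apply: saM; [exact: sa_rsc|exact: pos_sa].
    exact: pos_exp.
  rewrite (_ : _ - _ = rsc m * (rsc (m ^+ k) * q - q * c ^+ k) +
    (p + q * c) * c ^+ k).
    apply: posD; first exact: pos_rscM.
    by apply: posM; [apply: posD => //; exact: posM|exact: pos_exp].
  have -> : p = q * (rsc m - c) - 1 by rewrite qE; ring.
  by rewrite exprS rmorphM/=; ring.
have c0 : 0 < nm c by exact: le_lt_trans mc.
have r1 : m / nm c < 1 by rewrite ltr_pdivrMr// mul1r.
have r0 : 0 <= m / nm c by rewrite divr_ge0 ?(ltW c0).
have [k kh] : exists k, (m / nm c) ^+ k * (m * nm q) <= 2^-1.
  by apply: exp_small => //; rewrite invr_gt0.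
(* The norm of a power of [c] is computed only for the exponents [2 ^ k], by [nm_exp2]; as the ratio
   is below 1, the estimate at [k] passes to [2 ^ k]. *)
have kK : (k <= 2 ^ k)%N by exact/ltnW/ltn_expl.
have q0 : 0 <= m * nm q by rewrite mulr_ge0 ?renorm_ge0.
have rk := ler_wpM2r q0 (ler_wiXn2l r0 (ltW r1) kK).
have := bound (2 ^ k)%N; rewrite nm_exp2; last exact: pos_sa.
have cK0 : 0 < nm c ^+ (2 ^ k) by exact: exprn_gt0.
rewrite -(ler_pM2r (x := (nm c ^+ (2 ^ k))^-1)) ?invr_gt0//.
rewrite mulfV ?gt_eqF//.
have -> : m ^+ (2 ^ k).+1 * nm q / nm c ^+ (2 ^ k) =
    (m / nm c) ^+ (2 ^ k) * (m * nm q) by rewrite expr_div_n exprSr; ring.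
move=> h; suff : (1 : R) <= 2^-1 by lra.
exact: le_trans h (le_trans rk kh).
Qed.

(** No higher powers of [c] are needed, because [c^2] is positive and is absorbed by [p]. [I] is [0]
    where the norm is computed and the self-adjoint part of an ideal where its hull is studied. *)
Lemma preorder_cone_gen c (I : set A) : selfadjoint c ->
  (forall a, I a -> selfadjoint a) -> I 0 -> (forall a b, I a -> I b -> I (a +
    b)) ->
  (forall a b, I a -> selfadjoint b -> I (a * b)) ->
  ~ (exists p j q, [/\ cpositive p, I j, cpositive q & p + j + q * c = - 1]) ->
  preorder_cone
    [set a | exists p j q, [/\ cpositive p, I j, cpositive q & p + j + q * c =
      a]].
Proof.
move=> csa Isa I0 ID IM noN; split.
- move=> _ [p [j [q [pp Ij pq <-]]]]; apply: saD.
    by apply: saD; [exact: pos_sa|exact: Isa].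
  by apply: saM => //; exact: pos_sa.
- move=> p pp; exists p, 0, 0; split => //; [exact: pos0|ring].
- move=> _ _ [p [j [q [pp Ij pq <-]]]] [p' [j' [q' [pp' Ij' pq' <-]]]].
  exists (p + p'), (j + j'), (q + q'); split;
    [exact: posD|exact: ID|exact: posD|ring].
- move=> _ _ [p [j [q [pp Ij pq <-]]]] [p' [j' [q' [pp' Ij' pq' <-]]]].
  exists (p * p' + (q * q') * (c * c)),
    (j * (p' + q' * c) + j' * (p + q * c) + j * j'),
    (p * q' + p' * q); split; last ring.
  + by apply: posD; apply: posM => //; [exact: posM|exact: pos_sq].
  + have sapc x y : cpositive x -> cpositive y -> selfadjoint (x + y * c).
      by move=> px py; apply: saD; [|apply: saM => //]; exact: pos_sa.
    apply: (ID); last by apply: IM => //; exact: Isa.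
    by apply: ID; apply: IM => //; exact: sapc.
  + by apply: posD; exact: posM.
- exact: noN.
Qed.

Lemma char_norm_lt a m : 0 <= m -> m < nm a ->
  exists chi, m < renorm (chi a : R[i]^o).
Proof.
(* [m1] is strictly between [m^2] and [nm c]: below [nm c] for [no_witness], above [m^2] for the
   strict inequality of the conclusion. *)
move=> m0 ma; pose c := star a * a; pose m1 := (m ^+ 2 + nm a ^+ 2) / 2.
have m2 : m ^+ 2 < nm a ^+ 2 by rewrite ltr_pXn2r ?nnegrE ?renorm_ge0.
have pc : cpositive c by exact: pos_starM.
have m10 : 0 <= m1 by rewrite /m1; have := sqr_ge0 m; lra.
have cm1 : m1 < nm c by rewrite nm_starM /m1; lra.
have [||||||chi chiM] := @preorder_cone_char _
    (@preorder_cone_gen (c - rsc m1) [set 0] _ _ _ _ _ _).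
- by apply: saB; [exact: pos_sa|exact: sa_rsc].
- by move=> _ ->; exact: pos_sa pos0.
- by [].
- by move=> _ _ -> ->; rewrite addr0.
- by move=> _ b -> _; rewrite mul0r.
- by move=> [p [j [q [pp -> pq]]]]; rewrite addr0; exact: no_witness.
exists chi; have m1chi : m1 <= renorm (chi a : R[i]^o) ^+ 2.
  have := chiM (c - rsc m1).
  rewrite charB char_rsc char_starM -rmorphB/= subr_ge0; apply.
  exists 0, 0, 1; split => //; [exact: pos0|exact: pos1|ring].
rewrite ltNge; apply/negP => chim.
have : renorm (chi a : R[i]^o) ^+ 2 <= m ^+ 2.
  by rewrite ler_pXn2r ?nnegrE ?renorm_ge0.
by rewrite /m1 in m1chi; lra.
Qed.

Lemma nm_le a m : 0 <= m -> (forall chi, renorm (chi a : R[i]^o) <= m) ->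
  nm a <= m.
Proof.
move=> m0 chim; rewrite leNgt; apply/negP => /(char_norm_lt m0)[chi].
by rewrite ltNge chim.
Qed.

Section Ideals.
Variable J : cideal B.

(** These characters stand in for the spectrum of [B/J]. *)
Definition hull : set S := [set chi | forall j : A, J j -> chi j = 0].

Lemma idealM a b : J a -> J (a * b). Proof. exact: cidealMr. Qed.

(** Adjoin [c - m'^2] and the self-adjoint part of [J] to the positive cone. If [-1] does not
    appear, some character of the hull has modulus at least [m'] at [a], against the bound [m].
    Otherwise the identity for [-1] yields [j] in [J] with [chi j <= -1] wherever [|chi a| > m'],
    and multiplying [a] by a high power of [1 - j^2 / L] pushes it below [m'] there without leaving
    [a + J]. *)
Lemma hull_dist a m m' : 0 <= m -> m < m' ->
  (forall chi, hull chi -> renorm (chi a : R[i]^o) <= m) ->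
  exists2 j : A, J j & nm (a - j) <= m'.
Proof.
move=> m0 mm' am; pose c := star a * a.
have csa : selfadjoint (c - rsc (m' ^+ 2)).
  by apply: saB; [exact/pos_sa/pos_starM|exact: sa_rsc].
have [[p [j [q [pp [Jj jsa] pq pE]]]]|noN] := pselect (exists p (j : A) q,
    [/\ cpositive p, J j /\ selfadjoint j, cpositive q & p + j + q * (c - rsc
      (m' ^+ 2)) = - 1]);
  last first.
  have /preorder_cone_char[chi chiM] := @preorder_cone_gen (c - rsc (m' ^+ 2))
    [set j : A | J j /\ selfadjoint j] csa (fun b => @proj2 _ _)
    (conj (cideal0 J) (pos_sa pos0))
    (fun x y Ix Iy => conj (cidealD (proj1 Ix) (proj1 Iy))
                           (saD (proj2 Ix) (proj2 Iy)))
    (fun x y Ix ysa => conj (idealM y (proj1 Ix)) (saM (proj2 Ix) ysa)) noN.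
  have chiJ (j : A) : J j -> selfadjoint j -> chi j = 0.
    have ge0 (k : A) : J k -> selfadjoint k -> 0 <= complex.Re (chi k).
      move=> Jk ksa; apply: chiM; exists 0, k, 0.
      by split=> //; [exact: pos0|exact: pos0|ring].
    move=> Jj jsa; rewrite (char_sa chi jsa); congr (_%:C).
    have := ge0 _ Jj jsa; have := ge0 (- j) _ (saN jsa).
    rewrite charN (char_sa chi jsa) -rmorphN/= => h1 h2.
    apply/eqP; rewrite eq_le h2 andbT -oppr_ge0; apply: h1.
    by rewrite -sub0r; apply: cidealB => //; exact: cideal0.
  have /am : hull chi.
    move=> j Jj; have /chiJ : J (star j * j) by exact: cidealMl.
    move=> /(_ (pos_sa (pos_starM j))).
    rewrite char_starM => -[/eqP]; rewrite sqrf_eq0 => /eqP.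
    exact: (@renorm_eq0 R R[i]^o).
  have m'chi : m' ^+ 2 <= renorm (chi a : R[i]^o) ^+ 2.
    have := chiM (c - rsc (m' ^+ 2)).
    rewrite charB char_rsc char_starM -rmorphB/= subr_ge0; apply.
    exists 0, 0, 1; split; [exact: pos0| |exact: pos1|ring].
    by split; [exact: cideal0|exact: (pos_sa pos0)].
  move=> chim.
  have : renorm (chi a : R[i]^o) ^+ 2 <= m ^+ 2.
    by rewrite ler_pXn2r ?nnegrE ?renorm_ge0.
  have : m ^+ 2 < m' ^+ 2 by rewrite ltr_pXn2r ?nnegrE//; lra.
  lra.
(* [L] exceeds every [chi j ^ 2], so [1 - j^2 / L] takes its values in [[0, 1]]; where
   [chi j ^ 2 >= 1] they are at most [1 - 1 / L]. *)
pose L := nm (j * j) + 1; have L1 : 1 <= L by rewrite lerDr renorm_ge0.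
have L0 : 0 < L by lra.
have m'0 : 0 < m' by exact: le_lt_trans mm'.
have Linv0 : 0 < L^-1 by rewrite invr_gt0.
have Linv1 : L^-1 <= 1 by rewrite invf_le1.
have rL0 : 0 <= 1 - L^-1 by rewrite subr_ge0.
have rL1 : 1 - L^-1 < 1 by lra.
have [k kh] := exp_small (nm a) rL0 rL1 m'0.
pose x := rsc L^-1 * (j * j).
have Jx : J x by apply: cidealMl; exact: idealM.
have Je n : J (1 - (1 - x) ^+ n).
  elim: n => [|n IH]; first by rewrite expr0 subrr; exact: cideal0.
  rewrite (_ : _ - _ = (1 - (1 - x) ^+ n) + x * (1 - x) ^+ n).
    by apply: cidealD => //; exact: idealM.
  by rewrite exprS; ring.
exists (a * (1 - (1 - x) ^+ k)); first exact: cidealMl.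
rewrite (_ : a - _ = a * (1 - x) ^+ k); last ring.
apply: nm_le => [|chi]; first exact: ltW.
pose r := complex.Re (chi j).
have chiE : chi (a * (1 - x) ^+ k) = chi a * ((1 - L^-1 * r ^+ 2) ^+ k)%:C.
  rewrite charM charX charB char1 charM char_rsc charM (char_sa chi jsa) -/r.
  by rewrite rmorphXn rmorphB/= rmorph1 rmorphM/= expr2 rmorphM.
have rL : r ^+ 2 <= L.
  have := char_norm_le chi (j * j); rewrite charM (char_sa chi jsa) -/r.
  rewrite -rmorphM renorm_real -expr2 ger0_norm ?sqr_ge0// => /le_trans; apply.
  by rewrite lerDl.
have y0 : 0 <= 1 - L^-1 * r ^+ 2.
  by rewrite subr_ge0 mulrC ler_pdivrMr// mul1r.
have y1 : 1 - L^-1 * r ^+ 2 <= 1 by rewrite gerBl mulr_ge0 ?sqr_ge0// ltW.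
rewrite chiE renormM renorm_real ger0_norm ?exprn_ge0//.
have [am'|am'] := leP (renorm (chi a : R[i]^o)) m'.
  by rewrite (le_trans _ am')// ler_piMr ?renorm_ge0 ?exprn_ile1.
have r1 : 1 <= r ^+ 2.
  have := congr1 (fun u : A => complex.Re (chi u)) pE;
    rewrite charD charM charB char_rsc.
  rewrite char_starM charD charN char1 (char_sa chi jsa) (char_sa chi (pos_sa
    pp)).
  rewrite (char_sa chi (pos_sa pq)) -rmorphB -rmorphM -!rmorphD/= -/r.
  move=> h; have p0 := char_ge0 chi pp.
  have : m' ^+ 2 < renorm (chi a : R[i]^o) ^+ 2.
    by rewrite ltr_pXn2r ?nnegrE ?renorm_ge0// ltW.
  rewrite -subr_gt0 => /ltW/(mulr_ge0 (char_ge0 chi pq)) q0.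
  have : r <= - 1 by lra.
  by rewrite -sqrrN => r1; rewrite expr_ge1//; lra.
rewrite (le_trans _ kh)// mulrC ler_pM ?renorm_ge0 ?exprn_ge0 ?char_norm_le//.
rewrite lerXn2r ?nnegrE// lerD2l lerNl opprK ler_peMr// ltW//.
Qed.

(** The case [m = 0] of [hull_dist] puts [a] at distance 0 from [J], which is closed. Membership in
    an ideal thus becomes a test on characters. *)
Lemma hull_mem a : (forall chi, hull chi -> chi a = 0) -> J a.
Proof.
move=> a0; apply: (@cideal_closed R B J) =>
  U /nbhs_ballP[_ /gt0_complexE[d d0 ->] dU].
have d20 : 0 < d / 2 by rewrite divr_gt0.
have [chi /a0 ->|j Jj aj] := @hull_dist a _ _ (lexx 0) d20;
  first by rewrite renorm0.
exists j; split => //; apply: dU; rewrite -ball_normE/= renorm_lt.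
by rewrite (le_lt_trans aj)// [ltRHS]splitr ltrDl.
Qed.

Lemma hull_dist_mem a j chi d : J j -> nm (a - j) <= d -> hull chi ->
  renorm (chi a : R[i]^o) <= d.
Proof.
move=> Jj aj chiJ; rewrite (le_trans _ aj)// -[chi a]subr0 -(chiJ _ Jj) -charB.
exact: char_norm_le.
Qed.

End Ideals.

(** The real-valued Gelfand transforms; they play the part of the continuous functions on the
    spectrum. *)
Definition represented (u : S -> R) : Prop :=
  exists b : A, forall chi, chi b = (u chi)%:C.

Lemma represented_ext u v : u =1 v -> represented u -> represented v.
Proof. by move=> uv [b bu]; exists b => chi; rewrite bu uv. Qed.

Lemma represented_re a : represented (fun chi => complex.Re (chi a)).
Proof.
exists (cRe a) => chi; rewrite /cRe charM char_rsc charD char_star.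
case: (chi a) => x y; apply/eqP; rewrite eq_complex/=.
by apply/andP; split; apply/eqP; field.
Qed.

Lemma represented_cst r : represented (fun=> r).
Proof. by exists (rsc r) => chi; rewrite char_rsc. Qed.

Lemma representedD u v : represented u -> represented v ->
  represented (fun chi => u chi + v chi).
Proof.
by move=> [a au] [b bv]; exists (a + b) => chi; rewrite charD au bv rmorphD.
Qed.

Lemma representedM u v : represented u -> represented v ->
  represented (fun chi => u chi * v chi).
Proof.
by move=> [a au] [b bv]; exists (a * b) => chi; rewrite charM au bv rmorphM.
Qed.

Lemma representedB u v : represented u -> represented v ->
  represented (fun chi => u chi - v chi).
Proof.
by move=> [a au] [b bv]; exists (a - b) => chi; rewrite charB au bv rmorphB.
Qed.

(** Values on characters control the norm by [nm_le], so representatives of a uniformly convergent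
    sequence are Cauchy in the complete algebra. *)
Lemma represented_lim (u : S -> R) :
  (forall d, 0 < d ->
    exists2 v, represented v & forall chi, `|u chi - v chi| <= d) ->
  represented u.
Proof.
move=> ulim; have approx n : exists b : A, forall chi,
    renorm ((u chi)%:C - chi b : R[i]^o) <= n.+1%:R^-1.
  have [|v [b bv] uv] := ulim n.+1%:R^-1; first by rewrite invr_gt0.
  by exists b => chi; rewrite bv -rmorphB renorm_real.
have [b_ bP] := choice approx.
(* Twice the rate of approximation: for [n <= k] both [b_ n] and [b_ k] are within [1 / (n + 1)] of
   [u]. *)
pose eps n : R := 2 * n.+1%:R^-1.
have eps0 : eps @ \oo --> (0 : R^o).
  by rewrite -[0](mulr0 2); apply: cvgMr; exact: cvg_harmonic.
have [|b beps] := @complete_renorm R A b_ eps eps0.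
  move=> n k nk; apply: nm_le => [|chi]; first by rewrite mulr_ge0 ?invr_ge0.
  rewrite charB (le_trans (renormBD (u chi)%:C _ _))//.
  rewrite renormB /eps mulr_natl mulr2n lerD//.
  rewrite (le_trans (bP _ _))// lef_pV2 ?posrE ?ltr0n// ler_nat.
  exact: leq_ltn_trans nk _.
exists b => chi; apply/eqP; rewrite -subr_eq0; apply/eqP.
apply: (@renorm_eq0 R R[i]^o); apply/eqP; rewrite eq_le renorm_ge0 andbT.
apply: (@le_cvg0_le0 _ _ 2 _ eps0) => n.
rewrite (le_trans (renormBD (chi (b_ n)) _ _))//.
rewrite -charB [X in _ + X]renormB.
rewrite (le_trans (lerD (le_trans (char_norm_le _ _) (beps n)) (bP n chi)))//.
have : 0 <= n.+1%:R^-1 :> R by rewrite invr_ge0.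
by rewrite /eps; move: (n.+1%:R^-1) => t t0; lra.
Qed.

(** [|u|] is within [d] of [sqrt (u^2 + d^2)], which [pos_sqrt] represents. *)
Lemma represented_norm u : represented u -> represented (fun chi => `|u chi|).
Proof.
move=> [a au]; apply: represented_lim => d d0.
pose b := cRe a; have bsa : selfadjoint b by exact: sa_re.
have bu chi : chi b = (u chi)%:C.
  rewrite /b /cRe charM char_rsc charD char_star au conjc_real -rmorphD
    -rmorphM.
  by congr (_%:C); field.
have d20 : 0 < d ^+ 2 by rewrite exprn_gt0.
have [x [xsa px xE]] := pos_sqrt d20 (pos_sq bsa).
exists (fun chi => complex.Re (chi x)) => [|chi]; first exact: represented_re.
have := congr1 (fun y : A => chi y) xE.
rewrite charM charD charM char_rsc bu (char_sa chi xsa) -!rmorphM -rmorphD.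
move=> [] h; have x0 := char_ge0 chi px.
have nu0 := normr_ge0 (u chi); have nu2 := real_normK (num_real (u chi)).
move: h nu2; rewrite !expr2 => h nu2.
by rewrite ler_norml; apply/andP; split; nra.
Qed.

Lemma represented_min u v : represented u -> represented v ->
  represented (fun chi => Num.min (u chi) (v chi)).
Proof.
move=> ru rv; have ruv := represented_norm (representedB ru rv).
have := representedM (represented_cst 2^-1)
  (representedB (representedD ru rv) ruv).
apply: represented_ext => chi /=.
have [uv|uv] := leP (u chi) (v chi); first by rewrite ler0_norm; lra.
by rewrite gtr0_norm; lra.
Qed.

Lemma represented_max u v : represented u -> represented v ->
  represented (fun chi => Num.max (u chi) (v chi)).
Proof.
move=> ru rv; have ruv := represented_norm (representedB ru rv).
have := representedM (represented_cst 2^-1)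
  (representedD (representedD ru rv) ruv).
apply: represented_ext => chi /=.
have [uv|uv] := leP (u chi) (v chi); first by rewrite ler0_norm; lra.
by rewrite gtr0_norm; lra.
Qed.

End Gelfand.

(** * The Hilbert cube and compact metric spaces *)

Lemma near_mdist (R : realType) (V : metricType R) (x : V) (d : R) : 0 < d ->
  \forall y \near x, mdist x y < d.
Proof.
by move=> d0; have := nbhsx_ballx x _ d0; rewrite ballEmdist.
Qed.

Record hilbert_cube (R : realType) := HilbertCube {
  hc_fun :> nat -> R;
  hc_itv : forall n, 0 <= hc_fun n <= 1
}.

HB.instance Definition _ (R : realType) := gen_eqMixin (hilbert_cube R).
HB.instance Definition _ (R : realType) := gen_choiceMixin (hilbert_cube R).

Section HilbertCube.
Context {R : realType}.
Implicit Types x y z : hilbert_cube R.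

Lemma hilbert_cube_ext x y : x =1 y -> x = y.
Proof.
case: x y => [x x01] [y y01]/= xy; move: x01; have -> : x = y by exact/funext.
by move=> x01; congr HilbertCube; exact: Prop_irrelevance.
Qed.

Let term x y n : R := 2^-1 ^+ n * `|x n - y n|.
(** A weighted supremum instead of the usual series: bounds are checked coordinate by coordinate,
    and finite maxima approximate it uniformly, which later makes distances [represented]. *)
Definition hc_dist x y : R := sup (range (term x y)).

Let half0 : 0 <= 2^-1 :> R. Proof. by rewrite invr_ge0. Qed.
Let half1 : 2^-1 < 1 :> R. Proof. lra. Qed.

Let term_ge0 x y n : 0 <= term x y n.
Proof. by rewrite mulr_ge0 ?exprn_ge0. Qed.

Let coord_le1 x y n : `|x n - y n| <= 1.
Proof.
have /andP[x0 x1] := hc_itv x n; have /andP[y0 y1] := hc_itv y n.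
by rewrite ler_norml; apply/andP; split; lra.
Qed.

Let term_le x y n : term x y n <= 2^-1 ^+ n.
Proof. by rewrite ler_piMr ?exprn_ge0// coord_le1. Qed.

Let term_sup x y : has_sup (range (term x y)).
Proof.
split; first by exists (term x y 0); exists 0%N.
exists 1 => _ [n _ <-]; rewrite (le_trans (term_le _ _ _))//.
by rewrite exprn_ile1// ltW.
Qed.

Lemma hc_dist_coord x y n : 2^-1 ^+ n * `|x n - y n| <= hc_dist x y.
Proof. by apply: ub_le_sup; [case: (term_sup x y)|exists n]. Qed.

Lemma hc_dist_le x y M : (forall n, 2^-1 ^+ n * `|x n - y n| <= M) ->
  hc_dist x y <= M.
Proof.
move=> xyM; apply: ge_sup; first by case: (term_sup x y).
by move=> _ [n _ <-]; exact: xyM.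
Qed.

Lemma hc_distxx x : hc_dist x x = 0.
Proof.
apply/eqP; rewrite eq_le; apply/andP; split.
  by apply: hc_dist_le => n; rewrite subrr normr0 mulr0.
exact: le_trans (term_ge0 x x 0) (hc_dist_coord x x 0).
Qed.

Lemma hc_dist_eq0 x y : hc_dist x y = 0 -> x = y.
Proof.
move=> xy; apply: hilbert_cube_ext => n; apply/eqP;
  rewrite -subr_eq0 -normr_le0.
by have := hc_dist_coord x y n; rewrite xy pmulr_rle0.
Qed.

Lemma hc_dist_sym x y : hc_dist x y = hc_dist y x.
Proof.
by rewrite /hc_dist (_ : term x y = term y x)//; apply/funext => n;
  rewrite /term distrC.
Qed.

Lemma hc_dist_triangle y x z : hc_dist x z <= hc_dist x y + hc_dist y z.
Proof.
apply: hc_dist_le => n.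
rewrite (le_trans _ (lerD (hc_dist_coord x y n) (hc_dist_coord y z n)))//.
rewrite -mulrDr ler_wpM2l ?exprn_ge0// (le_trans _ (ler_normD _ _))//.
by rewrite addrA subrK.
Qed.

HB.instance Definition _ := isMetric.Build R (hilbert_cube R)
  hc_distxx hc_dist_eq0 hc_dist_sym hc_dist_triangle.

Lemma hc_mdistE x y : mdist x y = hc_dist x y.
Proof. by []. Qed.

Lemma near_forall_ltn T (F : set_system T) {FF : Filter F}
    (P : nat -> T -> Prop) :
  (forall n, \forall t \near F, P n t) ->
  forall N, \forall t \near F, forall n, (n < N)%N -> P n t.
Proof.
move=> FP; elim=> [|N IH]; first exact: filterE.
apply: filterS2 IH (FP N) => t Pt PN n; rewrite ltnS leq_eqVlt.
by move=> /predU1P[->//|]; exact: Pt.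
Qed.

Lemma hc_continuous (T : topologicalType) (f : T -> hilbert_cube R) :
  (forall n, continuous (fun t => f t n : R^o)) -> continuous f.
Proof.
move=> cf t; apply/metricType_numDomainType.cvgrPdist_lt => d d0.
have d20 : 0 < d / 2 by rewrite divr_gt0.
have [N Nd] := exp_small 1 half0 half1 d20; rewrite mulr1 in Nd.
have near_n n : \forall s \near t, `|f t n - f s n| < d / 2.
  by have /cvgrPdist_lt/(_ _ d20) := cf n t.
have near_t := @near_forall_ltn _ (nbhs t) (nbhs_filter t) _ near_n N.
suff sub s : (forall n, (n < N)%N -> `|f t n - f s n| < d / 2) ->
    mdist (f t) (f s) < d.
  exact: (@filterS _ (nbhs t) (nbhs_filter t) _ _ sub near_t).
move=> ts; rewrite hc_mdistE.
have : hc_dist (f t) (f s) <= d / 2.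
  apply: hc_dist_le => n; have [nN|Nn] := ltnP n N.
    rewrite (le_trans _ (ltW (ts n nN)))// ler_piMl//.
    by rewrite exprn_ile1// ltW.
  rewrite (le_trans (term_le _ _ _))// (le_trans _ Nd)//.
  by rewrite ler_wiXn2l// ltW.
by move=> /le_lt_trans; apply; rewrite ltr_pdivrMr// ltr_pMr// ltr1n.
Qed.

(** Clamping the coordinates to [[0, 1]] is continuous on the whole product of lines and maps
    Tychonoff's compact cube onto the Hilbert cube. *)
Lemma hilbert_cube_compact : compact [set: hilbert_cube R].
Proof.
pose P := prod_topology (fun _ : nat => R^o).
pose C : set P := [set f | forall n, `[0, 1]%classic (f n)].
have cC : compact C.
  exact: (@tychonoff nat (fun=> R^o) (fun=> `[0, 1]%classic)
    (fun=> @segment_compact R 0 1)).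
have clamp_itv (f : nat -> R) n : 0 <= Num.min 1 (Num.max 0 (f n)) <= 1.
  by rewrite le_min ler01 le_max lexx ge_min lexx.
pose clamp (f : P) := HilbertCube (clamp_itv f).
have -> : [set: hilbert_cube R] = clamp @` C.
  apply/seteqP; split=> // x _; exists (x : nat -> R^o).
    by move=> n /=; rewrite in_itv/= hc_itv.
  apply: hilbert_cube_ext => n /=; have /andP[x0 x1] := hc_itv x n.
  by rewrite max_r// min_r.
apply: continuous_compact; last exact: cC.
apply: continuous_subspaceT.
apply: hc_continuous => n f.
apply: (@continuous_min R P (fun=> 1) (fun f => Num.max 0 (f n)) f).
  exact: (@cst_continuous P R^o 1 f).
apply: (@continuous_max R P (fun=> 0) (fun f => f n) f).
  exact: (@cst_continuous P R^o 0 f).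
exact: (@proj_continuous _ _ n f).
Qed.

End HilbertCube.

(** * Uniform continuity, finite nets and distance functions *)

Section CompactMetric.
Context {R : realType} {Y : metricType R}.
Hypothesis cptY : compact [set: Y].

(** Heine-Cantor for a continuous pseudometric, so that one argument serves real and complex
    functions, with [p] the distance of the values. *)
Lemma compact_unif (p : Y -> Y -> R) :
  (forall x y, p x y = p y x) ->
  (forall x y z, p x z <= p x y + p y z) ->
  (forall x (d : R), 0 < d -> \forall y \near x, p x y < d) ->
  forall d : R, 0 < d ->
  exists2 delta : R, 0 < delta & forall x y, mdist x y < delta -> p x y < d.
Proof.
move=> psym ptri pcont d d0; have d20 : 0 < d / 2 by rewrite divr_gt0.
have /compact_near_coveringP/(_ R (0 : R)^'+
  (fun delta x => forall y, mdist x y < delta -> p x y < d) _) near_cov := cptY.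
have [x _|delta0 /= delta0_gt0 delta0P] := near_cov _.
  have /metricType_numDomainType.nbhs_mdistP[r /= r0 rP] := pcont x _ d20.
  have r20 : 0 < r / 2 by rewrite divr_gt0.
  exists ([set y | mdist x y < r / 2], [set delta | delta < r / 2]).
    by split; [exact: near_mdist|exact: nbhs_right_lt].
  move=> [y delta] /= [xy deltar] z yz.
  have xz : mdist x z < r.
    rewrite (le_lt_trans (metric_triangle _ y _))// (splitr r) ltrD//.
    exact: lt_trans yz deltar.
  have xyr : mdist x y < r by rewrite (lt_trans xy)// ltr_pdivrMr// ltr_pMr//
    ltr1n.
  rewrite (le_lt_trans (ptri _ x _))// (splitr d) ltrD//; last exact: rP.
  by rewrite psym; exact: rP.
exists (delta0 / 2); first by rewrite divr_gt0.
move=> x y xy; apply: (delta0P (delta0 / 2)) => //=.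
  rewrite sub0r normrN gtr0_norm ?divr_gt0//.
  by rewrite ltr_pdivrMr// ltr_pMr// ltr1n.
by rewrite divr_gt0.
Qed.

Lemma finite_net (d : R) : 0 < d ->
  exists s : seq Y, forall y, exists2 q, q \in s & mdist q y < d.
Proof.
move=> d0; pose F := filter_from [set: seq Y] (fun s => [set t :
  seq Y | {subset s <= t}]).
have FF : Filter F.
  apply: filter_from_filter; first by exists [::].
  move=> s t _ _; exists (s ++ t) => // r rP; split=> x xs; apply: rP;
    by rewrite mem_cat xs ?orbT.
have /compact_near_coveringP/(_ (seq Y) F
  (fun s y => exists2 q, q \in s & mdist q y < d) FF) near_cov := cptY.
have [x _|s _ sP] := near_cov _.
  exists ([set y | mdist x y < d], [set t : seq Y | {subset [:: x] <= t}]).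
    by split; [exact: near_mdist|exists [:: x]].
  move=> [y t] /= [xy tx]; exists x => //; apply: tx; exact: mem_head.
by exists s => y; exact: (sP s).
Qed.

Lemma real_unif (u : Y -> R^o) : continuous u -> forall d : R, 0 < d ->
  exists2 delta : R, 0 < delta &
  forall x y, mdist x y < delta -> `|u x - u y| < d.
Proof.
move=> cu; apply: compact_unif => [x y|x y z|x d d0].
- exact: distrC.
- exact: ler_distD.
- by have /cvgrPdist_lt := cu x; apply.
Qed.

Lemma complex_unif (u : Y -> R[i]^o) : continuous u -> forall d : R, 0 < d ->
  exists2 delta : R, 0 < delta &
  forall x y, mdist x y < delta -> renorm (u x - u y) < d.
Proof.
move=> cu; apply: compact_unif => [x y|x y z|x d d0].
- exact: renormB.
- exact: renormBD.
- by have /cvg_renormP := cu x; apply.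
Qed.

Lemma real_bounded (u : Y -> R^o) : continuous u ->
  exists2 M : R, 0 < M & forall y, `|u y| <= M.
Proof.
move=> cu; have : compact (u @` [set: Y]).
  apply: continuous_compact; last exact: cptY.
  exact: continuous_subspaceT.
move=> /compact_bounded[M [_ /(_ (M + 1))]].
rewrite ltrDl ltr01 => /(_ isT) Mb.
exists (Num.max 1 (M + 1)); first by rewrite lt_max ltr01.
by move=> y; rewrite le_max; apply/orP; right; apply: Mb; exists y.
Qed.

(* A continuous function is uniformly approximated by the lower envelope of
   finitely many cones [u q + L d(q, -)]; this replaces Stone-Weierstrass. *)
Lemma min_cones_dense (C : (Y -> R) -> Prop) (y0 : Y) :
  (forall q (c L d : R), 0 < d ->
    exists2 v, C v & forall y, `|c + L * mdist q y - v y| <= d) ->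
  (forall v w, C v -> C w -> C (fun y => Num.min (v y) (w y))) ->
  forall u : Y -> R^o, continuous u -> forall d : R, 0 < d ->
  exists2 v, C v & forall y, `|u y - v y| <= d.
Proof.
move=> Ccone Cmin u cu d d0.
have d30 : 0 < d / 3 by rewrite divr_gt0.
have [delta delta0 udelta] := real_unif cu d30.
have [M M0 uM] := real_bounded cu.
(* With this slope a cone has risen by [2 M], a bound for the oscillation of [u], at distance
   [delta] from its apex; nearer than [delta], uniform continuity keeps it above [u - d/3]. *)
pose L := 2 * M / delta.
have L0 : 0 < L by rewrite divr_gt0// mulr_gt0.
(* Within this radius of its apex a cone climbs by at most [d/3]. *)
have r0 : 0 < Num.min delta (d / 3 / L) by rewrite lt_min delta0 divr_gt0.
have [s sP] := finite_net r0.
pose cone q y : R := u q + L * mdist q y.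
have cone_lo q y : u y - d / 3 <= cone q y.
  have [qy|qy] := ltP (mdist q y) delta.
    have := udelta _ _ qy; rewrite ltr_norml => /andP[h _].
    have := mulr_ge0 (ltW L0) (mdist_ge0 q y); rewrite /cone; lra.
  have : 2 * M <= L * mdist q y.
    by rewrite -(divfK (lt0r_neq0 delta0) (2 * M)) ler_wpM2l// ltW.
  have := uM y; have := uM q; rewrite !ler_norml /cone => /andP[? ?] /andP[? ?].
  lra.
have approx (t : seq Y) :
  exists2 v, C v & (forall y, u y - (d / 3 + d / 3) <= v y) /\
    (forall y q, q \in t -> v y <= cone q y + d / 3).
  (* The empty list gets a cone at [y0], since [C] offers no empty minimum. *)
  elim: t => [|q t [v Cv [vlo vup]]].
    have [v Cv vP] := Ccone y0 (u y0) L _ d30; exists v => //; split => // y.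
    have := vP y; have := cone_lo y0 y; rewrite ler_norml /cone => ? /andP[? ?].
    lra.
  have [w Cw wP] := Ccone q (u q) L _ d30.
  exists (fun y => Num.min (w y) (v y)); first exact: Cmin.
  have wlo y : cone q y - d / 3 <= w y /\ w y <= cone q y + d / 3.
    by have := wP y; rewrite ler_norml /cone => /andP[? ?]; split; lra.
  split => y.
    rewrite le_min vlo andbT; have [? _] := wlo y; have := cone_lo q y; lra.
  move=> q'; rewrite inE ge_min => /predU1P[->|q't].
    by have [_ ->] := wlo y.
  by rewrite vup ?orbT.
have [v Cv [vlo vup]] := approx s; exists v => // y.
have [q qs] := sP y; rewrite lt_min => /andP[qdelta qL].
have := vup y q qs; have := vlo y.
have := udelta _ _ qdelta; rewrite ltr_norml => /andP[? ?].
have : L * mdist q y <= d / 3.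
  by rewrite mulrC -ler_pdivlMr// ltW.
rewrite /cone ler_norml => ? ? ?; apply/andP; split; lra.
Qed.

Definition set_dist (A : set Y) (y : Y) : R := inf [set mdist y z | z in A].

Section SetDist.
Variable A : set Y.
Hypothesis A0 : A !=set0.

Let has_inf_dist y : has_inf [set mdist y z | z in A].
Proof.
split; first by have [z Az] := A0; exists (mdist y z), z.
by exists 0 => _ [z _ <-]; exact: mdist_ge0.
Qed.

Lemma set_dist_le y z : A z -> set_dist A y <= mdist y z.
Proof. by move=> Az; apply: ge_inf; [case: (has_inf_dist y)|exists z]. Qed.

Lemma set_dist_lt y d : set_dist A y < d -> exists2 z, A z & mdist y z < d.
Proof.
move=> yd; have yd0 : 0 < d - set_dist A y by rewrite subr_gt0.
have [_ [z Az <-] zd] := inf_adherent yd0 (has_inf_dist y).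
by exists z => //; move: zd; rewrite -/(set_dist A y) addrC subrK.
Qed.

Lemma set_dist_ge0 y : 0 <= set_dist A y.
Proof.
by apply: lb_le_inf; [case: (has_inf_dist y)|move=> _ [z _ <-]; exact:
  mdist_ge0].
Qed.

Lemma set_dist0 y : A y -> set_dist A y = 0.
Proof.
move=> Ay; apply/eqP; rewrite eq_le set_dist_ge0 andbT.
by rewrite (le_trans (set_dist_le _ Ay))// mdistxx.
Qed.

Lemma set_dist_lip x y : set_dist A x <= mdist x y + set_dist A y.
Proof.
apply/ler_addgt0Pr => d d0.
have [|z Az yz] := @set_dist_lt y (set_dist A y + d); first by rewrite ltrDl.
rewrite (le_trans (set_dist_le _ Az))// (le_trans (metric_triangle _ y _))//.
by rewrite -addrA lerD2l ltW.
Qed.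

Lemma set_dist_continuous : continuous (set_dist A : Y -> R^o).
Proof.
move=> x; apply/cvgrPdist_lt => d d0.
apply: filterS (near_mdist x d0) => y xy.
rewrite (le_lt_trans _ xy)// ler_norml.
have := set_dist_lip x y; have := set_dist_lip y x.
by rewrite (metric_sym y x) => ? ?; apply/andP; split; lra.
Qed.

Lemma closed_nbhdE d : closed_nbhd A d = [set y | set_dist A y <= d].
Proof.
apply/seteqP; split => y /= yd.
  apply/ler_addgt0Pr => r r0; rewrite leNgt; apply/negP => dr.
  have : ((d + r)%:E <= ereal_inf [set (mdist y z)%:E | z in A])%E.
    apply: le_ereal_inf_tmp => _ [z Az <-]; rewrite lee_fin.
    by rewrite (le_trans (ltW dr))// set_dist_le.
  move=> /le_trans/(_ yd); rewrite lee_fin; lra.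
apply/lee_addgt0Pr => r r0.
have [|z Az yz] := @set_dist_lt y (d + r);
  first by rewrite (le_lt_trans yd)// ltrDl.
apply: (@le_trans _ _ (mdist y z)%:E).
  by apply: ereal_inf_lbound; exists z.
by rewrite -EFinD lee_fin ltW.
Qed.

Lemma closed_closed_nbhd d : closed (closed_nbhd A d).
Proof.
rewrite closed_nbhdE; apply: (@closed_comp Y R^o _ [set r | r <= d]).
  by move=> y _; exact: set_dist_continuous.
exact: closed_le.
Qed.

End SetDist.

End CompactMetric.

Lemma compact_top_embedding (K Y : topologicalType) (f : K -> Y) :
  compact [set: K] -> hausdorff_space Y -> continuous f -> injective f ->
  top_embedding f.
Proof.
move=> cptK hY cf fI; split=> // U; split=> [oU|[V oV <-]]; last first.
  by apply: open_comp => // x _; exact: cf.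
have cU : compact (~` U).
  exact: (subclosed_compact (open_closedC oU) cptK (@subsetT _ _)).
have cfU : compact (f @` (~` U)).
  exact: (continuous_compact (continuous_subspaceT cf) cU).
exists (~` (f @` (~` U))); first exact: closed_openC (compact_closed hY cfU).
apply/seteqP; split => x /=.
  by move=> fx; apply: contrapT => Ux; apply: fx; exists x.
by move=> Ux [y nUy /fI yx]; apply: nUy; rewrite yx.
Qed.

Lemma countable_enum (T : Type) (D : set T) : countable D ->
  exists s : nat -> option T, forall x, D x -> exists n, s n = Some x.
Proof.
move=> /countable_injP[f fI].
have ex n : exists o : option T, forall x, D x -> f x = n -> o = Some x.
  have [[x [Dx fx]]|no] := pselect (exists x, D x /\ f x = n).
    exists (Some x) => y Dy fy; congr Some; apply: fI; rewrite ?inE//.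
    by rewrite fx fy.
  by exists None => x Dx fx; exfalso; apply: no; exists x.
have [s sP] := choice ex; exists s => x Dx; exists (f x); exact: sP.
Qed.

(** * Functions on a space and on its one-point compactification *)

Section ComplexContinuity.
Context {R : realType} {T : topologicalType}.

Lemma continuous_Re (f : T -> R[i]^o) : continuous f ->
  continuous (fun t => complex.Re (f t) : R^o).
Proof.
move=> cf t; apply/cvgrPdist_lt => d d0.
have /cvg_renormP/(_ _ d0) := cf t; apply: filterS => s; apply: le_lt_trans.
by have := renorm_Re (f t - f s); case: (f t) => ? ?; case: (f s).
Qed.

Lemma continuous_Im (f : T -> R[i]^o) : continuous f ->
  continuous (fun t => complex.Im (f t) : R^o).
Proof.
move=> cf t; apply/cvgrPdist_lt => d d0.
have /cvg_renormP/(_ _ d0) := cf t; apply: filterS => s; apply: le_lt_trans.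
by have := renorm_Im (f t - f s); case: (f t) => ? ?; case: (f s).
Qed.

Lemma continuous_Complex (u v : T -> R^o) : continuous u -> continuous v ->
  continuous (fun t => (u t +i* v t) : R[i]^o).
Proof.
move=> cu cv t; apply/cvg_renormP => d d0.
have d20 : 0 < d / 2 by rewrite divr_gt0.
have /cvgrPdist_lt/(_ _ d20) := cu t; have /cvgrPdist_lt/(_ _ d20) := cv t.
apply: filterS2 => s vs us; rewrite (le_lt_trans (renorm_ReIm _))//.
by rewrite (splitr d) ltrD.
Qed.

Lemma C0_continuous (f : C0 R T) : continuous f.
Proof. by have [] := C0_predP _ (C0P f). Qed.

End ComplexContinuity.
Arguments C0_continuous {R T} f.

Section CompactC0.
Context {R : realType} {K : topologicalType}.
Hypothesis cptK : compact [set: K].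

Lemma compact_C0_subproof (f : K -> R[i]^o) : continuous f -> f \in C0_pred.
Proof.
by move=> cf; apply/C0_predP; split=> // d d0; exists [set: K] => // x [].
Qed.

Definition compact_C0 (f : K -> R[i]^o) (cf : continuous f) : C0 R K :=
  MkC0 (compact_C0_subproof cf).

Definition C0_one : C0 R K :=
  compact_C0 (fun x => @cst_continuous K R[i]^o 1 x).

Lemma C0_one_unit : is_unit C0_one.
Proof.
move=> f; split; apply: C0_ext => x; [exact: mul1r|exact: mulr1].
Qed.

(* For [F] in the kernel, [F] has a zero (otherwise it is invertible), and
   [|F|^2 + |G|^2] is in the kernel with [F] and [G]: the zero sets form a
   filter base, and a cluster point of it is the required point. *)
Lemma compact_C0_char (chi : C0 R K -> R[i]) :
  {morph chi : f g / f + g} ->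
  (forall k f, chi (k *: f) = k * chi f) ->
  (forall f g, chi (cmul f g) = chi f * chi g) ->
  chi C0_one = 1 ->
  exists p, forall f, chi f = f p.
Proof.
move=> chiD chiZ chiM chi1.
pose Z (f : C0 R K) := [set p | f p = 0].
pose ker := [set f | chi f = 0].
pose F := filter_from ker Z.
have ZN0 f : ker f -> Z f !=set0.
  move=> kf; apply: contrapT => noZ.
  have f0 p : f p != 0 by apply/eqP => fp; apply: noZ; exists p.
  have cfV : continuous (fun p => (f p : R[i])^-1 : R[i]^o).
    by move=> p; apply: (@cvgV _ _ (nbhs p) _ _ (f p) (f0 p)); exact:
      (C0_continuous f).
  have fV : cmul f (compact_C0 cfV) = C0_one.
    by apply: C0_ext => p; apply: mulfV; exact: f0.
  have := chiM f (compact_C0 cfV); rewrite fV chi1 kf mul0r.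
  by move/eqP; rewrite oner_eq0.
have FF : ProperFilter F.
  apply: filter_from_proper; last exact: ZN0.
  have chi0 : chi 0 = 0 by rewrite -(scale0r 0) chiZ mul0r.
  apply: filter_from_filter; first by exists 0.
  move=> f g kf kg; exists (cmul (cstar f) f + cmul (cstar g) g).
    by rewrite /ker/= chiD !chiM kf kg !mulr0 addr0.
  move=> p /= fg0.
  have : renorm (f p) ^+ 2 + renorm (g p) ^+ 2 = 0.
    apply: complexI; rewrite rmorphD/= -!conjM_renorm; exact: fg0.
  move/eqP; rewrite paddr_eq0 ?sqr_ge0// !sqrf_eq0 => /andP[/eqP f0 /eqP g0].
  by split; exact: renorm_eq0.
have [p [_ pF]] := cptK FF (filterT).
have kp f : ker f -> f p = 0.
  move=> kf; apply: contrapT => /eqP fp0.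
  have [q [Zq]] : (Z f) `&` [set q | renorm (f q) != 0] !=set0.
    apply: pF; first by exists f.
    have : renorm (f p) != 0 by apply: contra_neq fp0; exact: renorm_eq0.
    have := continuous_renorm (C0_continuous f).
    by move=> /(_ p)/cvgr_neq0; apply.
  by rewrite /= Zq renorm0 eqxx.
exists p => f; have : ker (f - chi f *: C0_one).
  by rewrite /ker/= chiD -scaleN1r !chiZ chi1 mulr1 mulN1r subrr.
move=> /kp/eqP; rewrite subr_eq0 => /eqP.
by move=> /esym <-; exact/esym/mulr1.
Qed.

End CompactC0.

Section OnePoint.
Context {R : realType} {X : topologicalType}.
Hypothesis hX : hausdorff_space X.
Local Notation aX := (one_point_compactification X).

Definition ext (f : X -> R[i]^o) (p : aX) : R[i]^o :=
  if p is Some x then f x else 0.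

Lemma ext_continuous (f : C0 R X) : continuous (ext f).
Proof.
move=> [x|]; first exact: (C0_continuous f x).
apply/(@cvg_renormP _ _ _ (nbhs (None : aX)) _ _ (nbhs_filter _)) => d d0.
have [_ /(_ _ d0)[K cK fK]] := C0_predP _ (C0P f).
exists K; first by split=> //; exact: compact_closed.
move=> _ [[x nKx <-]|->] /=; last by rewrite subrr renorm0.
by rewrite sub0r renormN -renorm_lt; exact: fK.
Qed.

Let cptaX : compact [set: aX] := @one_point_compactification_compact X.

Definition extC (f : C0 R X) : C0 R aX := compact_C0 cptaX (@ext_continuous f).

Lemma res_subproof (F : aX -> R[i]^o) : continuous F ->
  (fun x : X => F (Some x) - F None) \in C0_pred.
Proof.
move=> cF; apply/C0_predP; split.
  move=> x; apply: (@cvgB _ _ _ (nbhs x)); last exact: cvg_cst.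
  exact: (cF (Some x)).
move=> d d0; have /(@cvg_renormP _ _ _ (nbhs (None :
  aX)) _ _ (nbhs_filter _)) := cF None. 
move=> /(_ _ d0)[U [cU _] UP]; exists U => // x nUx; rewrite renorm_lt renormB.
by apply: (UP (Some x)); left; exists x.
Qed.

Definition res (F : aX -> R[i]^o) (cF : continuous F) : C0 R X :=
  MkC0 (res_subproof cF).

(** Writing [F] as [F(infinity)] plus a function vanishing there extends [chi] to a unital
    functional on the functions on the compactification, which is an evaluation by
    [compact_C0_char]. The zero functional corresponds to the point at infinity. *)
Lemma C0_char (chi : C0 R X -> R[i]) :
  {morph chi : f g / f + g} ->
  (forall k f, chi (k *: f) = k * chi f) ->
  (forall f g, chi (cmul f g) = chi f * chi g) ->
  exists p : aX, forall f, chi f = ext f p.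
Proof.
move=> chiD chiZ chiM; pose r (F : C0 R aX) := res (C0_continuous F).
pose chi' (F : C0 R aX) := F None + chi (r F).
have [|||| p pP] := @compact_C0_char R aX cptaX chi'.
- move=> F G; rewrite /chi'.
  have -> : r (F + G) = r F + r G by apply: C0_ext => x; rewrite /= opprD;
    exact: addrACA.
  by rewrite chiD; exact: addrACA.
- move=> k F; rewrite /chi'.
  have -> : r (k *: F) = k *: r F by apply: C0_ext => x; exact/esym/scalerBr.
  by rewrite chiZ; exact/esym/mulrDr.
- move=> F G; rewrite /chi'.
  have -> : r (cmul F G) = F None *: r G + (G None *: r F + cmul (r F) (r G)).
    have E (a b c d : R[i]) : a * b - c * d =
        c * (b - d) + (d * (a - c) + (a - c) * (b - d)) by ring.
    by apply: C0_ext => x; exact: E.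
  have E (a b x y : R[i]) : a * b + (a * y + (b * x + x * y)) =
    (a + x) * (b + y) by ring.
  by rewrite !chiD !chiZ chiM; exact: E.
- rewrite /chi'; have -> : r (C0_one cptaX) = 0.
    by apply: C0_ext => x; exact: subrr.
  by rewrite -(scale0r 0) chiZ mul0r; exact: addr0.
exists p => f; have := pP (extC f); rewrite /chi' /=.
have -> : r (extC f) = f by apply: C0_ext => x; exact: subr0.
by rewrite add0r.
Qed.

End OnePoint.

(** * Tietze extension along an embedding *)

Section Extension.
Context {R : realType} {K : topologicalType} {Y : metricType R} (theta :
  K -> Y).
Hypotheses (cptK : compact [set: K]) (cptY : compact [set: Y])
  (ctheta : continuous theta) (thetaI : injective theta).

Lemma real_extension (u : K -> R^o) : continuous u ->
  exists2 v : Y -> R^o, continuous v & forall x, v (theta x) = u x.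
Proof.
move=> cu; have hY : hausdorff_space Y := @metric_hausdorff _ Y.
have [_ emb] := compact_top_embedding cptK hY ctheta thetaI.
pose A := range theta.
have cA : compact A.
  exact: (continuous_compact (continuous_subspaceT ctheta) cptK).
(* [u] is transported to the image of [theta], with the junk value 0 elsewhere; only the restriction
   to the image has to be continuous. *)
have fex y : exists r, forall x, theta x = y -> r = u x.
  have [[x xy]|no] := pselect (exists x, theta x = y).
    by exists (u x) => x' x'y; congr u; apply: thetaI; rewrite xy x'y.
  by exists 0 => x xy; exfalso; apply: no; exists x.
have [f fP] := choice fex.
have fE x : f (theta x) = u x by exact: fP.
have cf : {within A, continuous (f : Y -> R^o)}.
  apply/subspace_continuousP => _ [x _ <-] V /= fV.
  have uV : nbhs (u x) V by rewrite -fE.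
  have := cu x _ uV; rewrite /= nbhsE => -[U [oU Ux] UV].
  have [W oW WU] := (emb U).1 oU.
  have nW : nbhs (theta x) W.
    by apply: open_nbhs_nbhs; split=> //; move: Ux; rewrite -WU.
  have near_f : \forall z \near theta x, A z -> V (f z).
    apply: filterS nW => z Wz [x' _ x'z]; rewrite -x'z fE; apply: UV.
    by rewrite -WU /= x'z.
  exact: near_f.
have [M M0 uM] : exists2 M : R, 0 < M & forall x, `|u x| <= M.
  have /compact_bounded[M [_ /(_ (M + 1))]] : compact (u @` [set: K]).
    exact: (continuous_compact (continuous_subspaceT cu) cptK).
  rewrite ltrDl ltr01 => /(_ isT) Mb.
  exists (Num.max 1 (M + 1)); first by rewrite lt_max ltr01.
  by move=> y; rewrite le_max; apply/orP; right; apply: Mb; exists y.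
have fM y : A y -> `|f y| <= M by move=> [x _ <-]; rewrite fE.
have [g [gf cg _]] := continuous_bounded_extension
  (compact_normal hY cptY) (compact_closed hY cA) M0 cf fM.
by exists g => // x; rewrite -gf ?fE// inE; exists x.
Qed.

Lemma complex_extension (u : K -> R[i]^o) : continuous u ->
  exists2 v : Y -> R[i]^o, continuous v & forall x, v (theta x) = u x.
Proof.
move=> cu; have [v1 cv1 v1u] := real_extension (continuous_Re cu).
have [v2 cv2 v2u] := real_extension (continuous_Im cu).
exists (fun y => v1 y +i* v2 y); first exact: continuous_Complex.
by move=> x; rewrite v1u v2u; case: (u x).
Qed.

End Extension.

(** * Separability of the functions on a compact metric space *)

Section Separability.
Context {R : realType}.

Lemma renorm_C0 (T : topologicalType) (f : C0 R T) (M : R) : 0 <= M ->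
  (forall x, renorm (f x) <= M) -> renorm f <= M.
Proof. exact: C0_sup_ge. Qed.

Lemma renorm_C0_le (T : topologicalType) (f : C0 R T) x :
  renorm (f x) <= renorm f.
Proof. exact: C0_sup_le. Qed.

Lemma separable_renorm (V : normedModType R[i]) (D : set V) : countable D ->
  (forall v (d : R), 0 < d -> exists2 w, D w & renorm (v - w) < d) ->
  separable_space V.
Proof.
move=> cD Ddense; exists D => // O [v Ov].
rewrite openE => /(_ _ Ov)/nbhs_ballP[_ /gt0_complexE[d d0 ->] dO].
have [w Dw vw] := Ddense v _ d0; exists w; split => //.
by apply: dO; rewrite -ball_normE/= renorm_lt.
Qed.

Lemma separable_renormP (V : normedModType R[i]) : separable_space V ->
  exists2 D : set V, countable D &
  forall v (d : R), 0 < d -> exists2 w, D w & renorm (v - w) < d.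
Proof.
move=> [D cD Dd]; exists D => // v d d0.
have d0' : 0 < d%:C :> R[i] by rewrite ltcR.
have oB : open (ball v d%:C) by apply: ball_open.
have [|w [vw Dw]] := Dd (ball v d%:C) _ oB.
  by exists v; exact: ballxx.
by exists w => //; move: vw; rewrite -ball_normE/= renorm_lt.
Qed.

Section CompactMetricSeparable.
Context {Y : metricType R}.
Hypothesis cptY : compact [set: Y].
Variable y0 : Y.

Lemma dense_sequence : exists pt : nat -> nat -> Y, forall y (d : R), 0 < d ->
  exists n i, mdist (pt n i) y < d.
Proof.
have net n : exists s : seq Y, forall y, exists2 q, q \in s &
    mdist q y < n.+1%:R^-1.
  by apply: finite_net => //; rewrite invr_gt0.
have [s sP] := choice net; exists (fun n i => nth y0 (s n) i) => y d d0.
have [n nd] : exists n, n.+1%:R^-1 < d.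
  have /cvgrPdist_lt/(_ _ d0)[n _ /(_ n (leqnn n))/=] := @cvg_harmonic R.
  by rewrite sub0r normrN ger0_norm ?invr_ge0// => nd; exists n.
have [q qs qy] := sP n y; exists n, (index q (s n)).
by rewrite nth_index// (lt_trans qy).
Qed.

(** Finite minima of cones with rational height, rational slope and apex in a countable dense family
    form a countable set stable under minima, so [min_cones_dense] applies to real and imaginary
    parts. *)
Lemma C0_compact_separable : separable_space (C0 R Y).
Proof.
have [pt ptP] := dense_sequence.
pose code : Type := (rat * rat * nat * nat)%type.
pose cone (t : rat * rat * nat * nat) (y : Y) : R :=
  ratr t.1.1.1 + ratr t.1.1.2 * mdist (pt t.1.2 t.2) y.
pose env (t : code * seq code) (y : Y) : R :=
  foldr (fun a m => Num.min (cone a y) m) (cone t.1 y) t.2.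
have env_min t t' : exists t'', forall y,
    env t'' y = Num.min (env t y) (env t' y).
  case: t t' => a ts [b ts']; exists (b, ts ++ a :: ts') => y; rewrite /env/=.
  by elim: ts => [//|c ts IH] /=; rewrite IH minA.
have cone_cont t : continuous (cone t : Y -> R^o).
  move=> y; apply: (@cvgD _ _ _ (nbhs y)); first exact: cvg_cst.
  apply: (@cvgMr _ _ (nbhs y)).
  apply/cvgrPdist_lt => d d0; apply: filterS (near_mdist y d0) => z yz.
  rewrite (le_lt_trans _ yz)// ler_norml.
  have := metric_triangle (pt t.1.2 t.2) y z.
  have := metric_triangle (pt t.1.2 t.2) z y; rewrite (metric_sym z y).
  by move=> ? ?; apply/andP; split; lra.
have env_cont t : continuous (env t : Y -> R^o).
  case: t => a ts; rewrite /env/=; elim: ts => [|b ts IH] /=.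
    exact: cone_cont.
  move=> y; exact: (@continuous_min _ _ (cone b) _ y (cone_cont b y) (IH y)).
have env_dense (u : Y -> R^o) : continuous u -> forall d : R, 0 < d ->
    exists t, forall y, `|u y - env t y| <= d.
  move=> cu d d0; have [||v [t tv] uv] := @min_cones_dense R Y cptY
    (fun v => exists t, env t = v) y0 _ _ u cu d d0; last 1 first.
  - by exists t => y; rewrite tv.
  (* One third of the error each for apex, slope and height. The slope error is multiplied by a
     distance, hence the bound [2 * D0] on the diameter. *)
  - move=> q c L r r0; have r30 : 0 < r / 3 by rewrite divr_gt0.
    have [D0 D00 D0P] : exists2 M : R, 0 < M & forall y, mdist y0 y <= M.
      have [|M M0 MP] := @real_bounded R Y cptY (fun y => mdist y0 y).
        move=> y; apply/cvgrPdist_lt => h h0.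
        apply: filterS (near_mdist y h0) => z yz.
        rewrite (le_lt_trans _ yz)// ler_norml.
        have := metric_triangle y0 y z; have := metric_triangle y0 z y.
        by rewrite (metric_sym z y) => ? ?; apply/andP; split; lra.
      by exists M => // y; rewrite (le_trans (ler_norm _)).
    have DP (x y : Y) : mdist x y <= 2 * D0.
      rewrite (le_trans (metric_triangle _ y0 _))//.
      have := D0P x; have := D0P y; rewrite (metric_sym x y0); lra.
    have L0 : 0 < `|L| + 1 by rewrite ltr_wpDl.
    have [n [i qi]] := ptP q _ (divr_gt0 r30 L0).
    have [c' /= ] := @rat_in_itvoo R (c - r / 3) c ltac:(lra).
    rewrite in_itv/= => /andP[c'1 c'2].
    have D30 : 0 < r / 3 / (2 * D0) by rewrite divr_gt0// mulr_gt0.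
    have [L' /=] := @rat_in_itvoo R (L - r / 3 / (2 * D0)) L ltac:(lra).
    rewrite in_itv/= => /andP[L'1 L'2].
    exists (env ((c', L', n, i), [::])); first by eexists.
    move=> y; rewrite /env/= /cone/=.
    have e1 : `|L * mdist q y - L * mdist (pt n i) y| <= r / 3.
      rewrite -mulrBr normrM.
      have h1 : `|mdist q y - mdist (pt n i) y| <= mdist (pt n i) q.
        rewrite ler_norml; have := metric_triangle q (pt n i) y.
        have := metric_triangle (pt n i) q y; rewrite (metric_sym q (pt n i)).
        by move=> ? ?; apply/andP; split; lra.
      rewrite (le_trans (ler_wpM2l _ h1))//.
      have : mdist (pt n i) q * (`|L| + 1) <= r / 3.
        by rewrite -ler_pdivlMr// ltW.
      by have := mdist_ge0 (pt n i) q; lra.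
    have e2 : `|L * mdist (pt n i) y - ratr L' * mdist (pt n i) y| <= r / 3.
      rewrite -mulrBl ger0_norm; last by rewrite mulr_ge0 ?mdist_ge0//; lra.
      rewrite (le_trans (ler_wpM2l _ (DP _ _)))//; first lra.
      by rewrite -ler_pdivlMr ?mulr_gt0//; lra.
    move: e1 e2; rewrite !ler_norml => /andP[? ?] /andP[? ?].
    by apply/andP; split; lra.
  - move=> _ _ [t <-] [t' <-]; have [t'' tE] := env_min t t'.
    by exists t''; apply/funext.
pose E (t : (code * seq code) * (code * seq code)) : C0 R Y := compact_C0 cptY
  (continuous_Complex (env_cont t.1) (env_cont t.2)).
apply: (@separable_renorm _ (range E)).
  apply: (sub_countable (card_image_le E setT)); exact: countableP.
move=> f d d0; have d30 : 0 < d / 3 by rewrite divr_gt0.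
have [t tP] := env_dense _ (continuous_Re (C0_continuous f)) _ d30.
have [t' t'P] := env_dense _ (continuous_Im (C0_continuous f)) _ d30.
exists (E (t, t')); first by exists (t, t').
have : renorm (f - E (t, t')) <= d / 3 + d / 3.
  apply: renorm_C0 => [|y]; first by rewrite addr_ge0 ?(ltW d30).
  have -> : (f - E (t, t')) y = f y - (env t y +i* env t' y) by [].
  rewrite (le_trans (renorm_ReIm _))// lerD//.
    by have := tP y; case: (f y).
  by have := t'P y; case: (f y).
by move/le_lt_trans; apply; lra.
Qed.

End CompactMetricSeparable.

End Separability.

(** * Embedding the compactification in the Hilbert cube *)

Section Embedding.
Context {R : realType} {X : topologicalType}.
Local Notation aX := (one_point_compactification X).
Hypotheses (X_separable : separable_space X)
    (X_locally_compact : locally_compact [set: X])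
    (X_metrizable : metrizable R X).

Lemma metrizable_hausdorff : hausdorff_space X.
Proof.
have [d [d0 dsym dtri dnbhs]] := X_metrizable => x y xy.
apply/d0/eqP; rewrite eq_le; apply/andP; split; last first.
  have := dtri x y x; rewrite (dsym y x) (proj2 (d0 x x) erefl); lra.
rewrite leNgt; apply/negP => dxy.
have h0 : 0 < d x y / 2 by rewrite divr_gt0.
have Ux : nbhs x [set z | d x z < d x y / 2] by apply/dnbhs; exists (d x y / 2).
have Uy : nbhs y [set z | d y z < d x y / 2] by apply/dnbhs; exists (d x y / 2).
have [z [/= xz yz]] := xy _ _ Ux Uy.
have := dtri x z y; rewrite (dsym z y); lra.
Qed.

(* The functions [max 0 (r - d(x, -))], for [x] in a countable dense set and
   [r = 1/(k+1)] small enough for the ball to be relatively compact, separate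
   the points of the compactification. *)
Lemma separating_sequence : exists h : nat -> C0 R X,
  (forall n x, exists2 r : R, 0 <= r <= 1 & h n x = r%:C) /\
  (forall p q : aX, (forall n, ext (h n) p = ext (h n) q) -> p = q).
Proof.
have [d [d0 dsym dtri dnbhs]] := X_metrizable.
have hX := metrizable_hausdorff.
have d_ge0 x y : 0 <= d x y.
  have := dtri x y x; rewrite (dsym y x) (proj2 (d0 x x) erefl); lra.
have cd x : continuous (d x : X -> R^o).
  move=> y; apply/cvgrPdist_lt => r r0.
  have : nbhs y [set z | d y z < r] by apply/dnbhs; exists r.
  apply: filterS => z /= yz; rewrite (le_lt_trans _ yz)// ler_norml.
  have := dtri x y z; have := dtri x z y; rewrite (dsym z y) => ? ?.
  by apply/andP; split; lra.
have [D cD Dd] := X_separable; have [s sP] := countable_enum cD.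
pose good x k := compact [set y | d x y <= k.+1%:R^-1].
pose bump x k y : R := Num.max 0 (k.+1%:R^-1 - d x y).
have bump_C0 x k : good x k -> (fun y => (bump x k y)%:C : R[i]^o) \in C0_pred.
  move=> gxk; apply/C0_predP; split.
    apply: (@continuous_Complex _ _ (bump x k) (fun=> 0)); last first.
      by move=> y; exact: (@cst_continuous X R^o 0 y).
    move=> y; apply: (@continuous_max _ _ (fun=> 0) _ y).
      exact: (@cst_continuous X R^o 0 y).
    apply: (@cvgB _ _ _ (nbhs y)); last exact: cd.
    exact: (@cst_continuous X R^o _ y).
  move=> e e0; exists [set y | d x y <= k.+1%:R^-1] => // y /negP.
  rewrite -ltNge => xy; rewrite norm_real ltcR /bump max_l ?normr0//.
  by rewrite subr_le0 ltW.
(* The index [n] codes a dense point and a radius; indices coding no such pair, or a closed ball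
   that is not compact, get the zero function. *)
have ex n : exists h : C0 R X,
    (forall x, exists2 r : R, 0 <= r <= 1 & h x = r%:C) /\
    (forall m k x, unpickle n = Some (m, k) -> s m = Some x -> good x k ->
      forall y, h y = (bump x k y)%:C).
  have zero : exists h : C0 R X,
      (forall x, exists2 r : R, 0 <= r <= 1 & h x = r%:C) /\ h = 0.
    by exists 0; split=> // x; exists 0; rewrite ?lexx ?ler01.
  have [h0 [h0r _]] := zero.
  case mkE : (unpickle n : option (nat * nat)) => [[m k]|]; last by exists h0.
  case smE : (s m) => [x|]; last first.
    by exists h0; split=> // m' k' x [<- _]; rewrite smE.
  have [g|ng] := pselect (good x k); last first.
    by exists h0; split=> // m' k' x' [<- <-]; rewrite smE => -[<-].
  exists (MkC0 (bump_C0 _ _ g)); split; last first.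
    by move=> m' k' x' [<- <-]; rewrite smE => -[<-].
  move=> y; exists (bump x k y) => //;
    rewrite /bump le_max lexx/= ge_max ler01/=.
  have : k.+1%:R^-1 <= 1 :> R by rewrite invf_le1// ler1n.
  by have := d_ge0 x y; move: (k.+1%:R^-1) => ?; lra.
have [h hP] := choice ex; exists h; split; first by move=> n; have [] := hP n.
have sep (x : X) (e : R) : 0 < e -> exists n,
    0 < complex.Re (h n x) /\ forall y, e <= d x y -> h n y = 0.
  move=> e0.
  have [U [xU [cU clU]]] : exists U, nbhs x U /\ compact U /\ closed U.
    have [U xU cU] := X_locally_compact (I : [set: X] x).
    have {}xU : \forall y \near x, [set: X] y -> U y := xU.
    by exists U; split=> //; apply: filterS xU => y; apply.
  have /dnbhs[r r0 rU] := xU.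
  (* Half, because the centre [y] is only near [x]: two radii must stay below [e] for the bump to
     vanish at distance [e] from [x], and below [r] for its ball to lie in [U]. *)
  have er0 : 0 < Num.min e r / 2 by rewrite divr_gt0// lt_min e0.
  have [k kP] : exists k, k.+1%:R^-1 < Num.min e r / 2.
    have /cvgrPdist_lt/(_ _ er0)[n _ /(_ n (leqnn n))/=] := @cvg_harmonic R.
    by rewrite sub0r normrN ger0_norm ?invr_ge0// => nd; exists n.
  have k0 : 0 < k.+1%:R^-1 :> R by rewrite invr_gt0.
  have ke : k.+1%:R^-1 + k.+1%:R^-1 < e.
    have : Num.min e r <= e by rewrite ge_min lexx.
    move: kP; move: (Num.min e r) (k.+1%:R^-1) => ? ?; lra.
  have kr : k.+1%:R^-1 + k.+1%:R^-1 < r.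
    have : Num.min e r <= r by rewrite ge_min lexx orbT.
    move: kP; move: (Num.min e r) (k.+1%:R^-1) => ? ?; lra.
  have /nbhs_interior : nbhs x [set y | d x y < k.+1%:R^-1].
    by apply/dnbhs; exists k.+1%:R^-1.
  move=> xk; have [||y [xy Dy]] := Dd ([set y | d x y < k.+1%:R^-1]^°).
  - by exists x; exact: nbhs_singleton.
  - exact: open_interior.
  have {}xy : d x y < k.+1%:R^-1 := interior_subset xy.
  have [m sm] := sP _ Dy.
  have g : good y k.
    apply: (subclosed_compact _ cU).
      apply: (@closed_comp X R^o _ [set r | r <= k.+1%:R^-1]).
        by move=> z _; exact: cd.
      exact: closed_le.
    move=> z /= yz; apply: rU => /=; have := dtri x y z.
    move: (k.+1%:R^-1) xy yz kr => ? ? ? ?; lra.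
  have [_ /(_ m k y) hn] := hP (pickle (m, k)).
  have {}hn := hn (pickleK _) sm g.
  exists (pickle (m, k)); split.
    by rewrite hn/= lt_max dsym subr_gt0 xy orbT.
  move=> z ez; rewrite hn /bump max_l//.
  have := dtri x y z; move: (k.+1%:R^-1) xy ez ke => ? ? ? ?; lra.
have sepS (x : X) (q : aX) : (forall n, ext (h n) (Some x) = ext (h n) q) ->
    Some x = q.
  case: q => [y|] xy.
    congr Some; apply/d0/eqP; rewrite eq_le d_ge0 andbT leNgt; apply/negP =>
      dxy.
    have [n [hx /(_ y (lexx _)) hy]] := sep x _ dxy.
    by have := xy n; rewrite /= hy => hx0; rewrite hx0 ltxx in hx.
  have [n [hx _]] := sep x 1 ltr01.
  by have := xy n; rewrite /= => hx0; rewrite hx0 ltxx in hx.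
move=> [x|] q; first exact: sepS.
by case: q => [y|//] xy; apply/esym/sepS => n; exact/esym/xy.
Qed.

Lemma hilbert_cube_embedding : exists h : nat -> C0 R X,
  exists theta : aX -> hilbert_cube R,
  [/\ continuous theta, injective theta
    & forall n p, ext (h n) p = (theta p n)%:C].
Proof.
have [h [h01 hsep]] := separating_sequence; have hX := metrizable_hausdorff.
have ext01 n p : exists2 r : R, 0 <= r <= 1 & ext (h n) p = r%:C.
  case: p => [x|] /=; first exact: h01.
  by exists 0; rewrite ?lexx ?ler01.
have theta01 p n : 0 <= complex.Re (ext (h n) p) <= 1.
  by have [r r01 ->] := ext01 n p.
exists h, (fun p => HilbertCube (theta01 p)).
have E n p : ext (h n) p = (complex.Re (ext (h n) p))%:C.
  by have [r _ ->] := ext01 n p.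
split=> //.
  apply: hc_continuous => n; apply: continuous_Re; exact: ext_continuous.
move=> p q [pq]; apply: hsep => n; rewrite E [RHS]E.
by congr (_%:C); have := congr1 (fun f => f n) pq.
Qed.

End Embedding.

Section SeparableC0.
Context {R : realType} {X : topologicalType}.
Local Notation aX := (one_point_compactification X).
Hypotheses (X_separable : separable_space X)
    (X_locally_compact : locally_compact [set: X])
    (X_metrizable : metrizable R X).

(* Restricting functions on the Hilbert cube to the compactification, minus
   their value at infinity, is a continuous surjection onto [C0 R X]. *)
Lemma C0_separable : separable_space (C0 R X).
Proof.
have hX := metrizable_hausdorff X_metrizable.
have [h [theta [ctheta thetaI _]]] :=
  hilbert_cube_embedding X_separable X_locally_compact X_metrizable.
have cptQ := @hilbert_cube_compact R.
have [D cD Dd] := separable_renormP (C0_compact_separable cptQ (theta None)).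
have cT (G : C0 R (hilbert_cube R)) : continuous (fun p => G (theta p)).
  move=> p; exact: (continuous_comp (ctheta p) (C0_continuous G (theta p))).
pose T (G : C0 R (hilbert_cube R)) : C0 R X := res (cT G).
apply: (@separable_renorm _ _ (T @` D)).
  exact: (sub_countable (card_image_le T D)).
move=> f d d0; have d30 : 0 < d / 3 by rewrite divr_gt0.
have [G cG Gf] := complex_extension (@one_point_compactification_compact X)
  cptQ ctheta thetaI (@ext_continuous _ _ hX f).
have [w Dw Gw] := Dd (compact_C0 cptQ cG) _ d30.
exists (T w); first by exists w.
have : renorm (f - T w) <= d / 3 + d / 3.
  apply: renorm_C0 => [|x]; first by rewrite addr_ge0 ?(ltW d30).
  have -> : (f - T w) x = (compact_C0 cptQ cG - w) (theta (Some x)) -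
      (compact_C0 cptQ cG - w) (theta None).
    rewrite [RHS](_ : _ = (G (theta (Some x)) - w (theta (Some x))) -
      (G (theta None) - w (theta None)))// !Gf /=.
    rewrite [LHS](_ : _ = f x - (w (theta (Some x)) - w (theta None)))//.
    by rewrite sub0r opprK opprB addrA addrAC.
  rewrite (le_trans (renormD _ _))// renormN lerD//;
    by rewrite (le_trans (renorm_C0_le _ _))// ltW.
by move/le_lt_trans; apply; lra.
Qed.

End SeparableC0.

(** * WSP1 implies AANR *)

Section Quotients.
Context {R : realType} {A B : cstarType R} {J : cideal B}.
Variable chi : B -> R[i].
Hypotheses (chiD : {morph chi : a b / a + b})
  (chiZ : forall k a, chi (k *: a) = k * chi a)
  (chiM : forall a b, chi (cmul a b) = chi a * chi b)
  (chiJ : forall j, J j -> chi j = 0).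

Let chiN a : chi (- a) = - chi a.
Proof. by rewrite -scaleN1r chiZ mulN1r. Qed.

Lemma char_quo_eq a b : quo_pi J a = quo_pi J b -> chi a = chi b.
Proof.
move=> /quo_piP/chiJ; rewrite chiD chiN => /eqP.
by rewrite subr_eq0 => /eqP.
Qed.

Lemma char_quo_repr a : chi (repr (quo_pi J a)) = chi a.
Proof. by apply: char_quo_eq; rewrite quo_piK. Qed.

Lemma char_quo_norm a : (forall b, renorm (chi b : R[i]^o) <= renorm b) ->
  renorm (chi a : R[i]^o) <= quo_norm (quo_pi J a).
Proof.
move=> chi1; apply: lb_le_inf; first by exists (renorm a), a.
by move=> _ [b /= ab <-]; rewrite -(char_quo_eq ab).
Qed.

(** A multiplicative functional killing [J] passes to the quotient, where any representative
    computes it. As [chi] is a bare function, this covers evaluations of functions as well as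
    elements of [spectrum]. *)
Lemma quo_hom_char (phi : A -> quo J) : is_star_hom_quo phi ->
  [/\ {morph (fun a => chi (repr (phi a))) : a b / a + b},
      forall k a, chi (repr (phi (k *: a))) = k * chi (repr (phi a))
    & forall a b, chi (repr (phi (cmul a b))) =
        chi (repr (phi a)) * chi (repr (phi b))].
Proof.
move=> [philin phiM _].
have phiD a b : phi (a + b) = phi a + phi b.
  by have := philin 1 a b; rewrite !scale1r.
have phi0 : phi 0 = 0 by apply: (addrI (phi 0)); rewrite -phiD !addr0.
have phiZ k a : phi (k *: a) = quo_scale k (phi a).
  by have := philin k a 0; rewrite phi0 !addr0.
split=> [a b|k a|a b].
- rewrite phiD -[in LHS](quo_piK (phi a)) -[in LHS](quo_piK (phi b)).
  by rewrite -quo_piD char_quo_repr chiD.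
- by rewrite phiZ -[in LHS](quo_piK (phi a)) quo_scaleE char_quo_repr chiZ.
- rewrite phiM -[in LHS](quo_piK (phi a)) -[in LHS](quo_piK (phi b)).
  by rewrite quo_mulE char_quo_repr chiM.
Qed.

End Quotients.

Lemma quo_norm_ge0 (R : realType) (B : cstarType R) (J : cideal B) (u : quo J) :
  0 <= quo_norm u.
Proof.
apply: lb_le_inf; first by exists (renorm (repr u)), (repr u);
  rewrite //= quo_piK.
by move=> _ [a _ <-]; exact: renorm_ge0.
Qed.

Lemma quo_norm_le (R : realType) (B : cstarType R) (J : cideal B) (a b : B) :
  J (a - b) -> quo_norm (quo_pi J a) <= renorm b.
Proof.
move=> ab; apply: ge_inf.
  by exists 0 => _ [c _ <-]; exact: renorm_ge0.
by exists b => //=; apply/esym/quo_piP.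
Qed.

Section EmbeddingMetric.
Context {R : realType} {T : topologicalType} {Y : metricType R} (theta :
  T -> Y).
Hypothesis emb : top_embedding theta.

Lemma top_embedding_continuous : continuous theta.
Proof.
by apply/continuousP => V oV; apply/(proj2 emb); exists V.
Qed.

Lemma top_embedding_nbhs (p : T) (U : set T) : nbhs p U <->
  exists2 e : R, 0 < e & [set q | mdist (theta p) (theta q) < e] `<=` U.
Proof.
split=> [|[e e0 eU]].
  rewrite nbhsE => -[U' [oU' U'p] U'U].
  have [V oV VU'] := (proj2 emb U').1 oU'.
  have /metricType_numDomainType.nbhs_mdistP[e /= e0 eV] : nbhs (theta p) V.
    by apply: open_nbhs_nbhs; split=> //; rewrite -VU' in U'p.
  by exists e => // q /= pq; apply: U'U; rewrite -VU'; exact: eV.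
apply: filterS eU _.
exact: (top_embedding_continuous (near_mdist (theta p) e0)).
Qed.

Lemma top_embedding_metrizable : metrizable R T.
Proof.
exists (fun p q => mdist (theta p) (theta q)); split.
- move=> x y; split=> [/mdist_positivity/(proj1 emb)//|->]; exact: mdistxx.
- by move=> x y; exact: metric_sym.
- by move=> x y z; exact: metric_triangle.
- exact: top_embedding_nbhs.
Qed.

End EmbeddingMetric.

(** * Ideals of functions vanishing on a set and on its neighbourhoods *)

Section VanishingIdeal.
Context {R : realType} {Y : topologicalType}.
Implicit Types A : set Y.

Let vanishing A (F : C0 R Y) : Prop := forall y, A y -> F y = 0.

Let vanishing_closed A : closed (vanishing A).
Proof.
move=> F clF y Ay; apply: (@renorm_eq0 R R[i]^o); apply/eqP.
rewrite eq_le renorm_ge0 andbT; apply/ler_addgt0Pr => d d0; rewrite add0r.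
have d0' : 0 < d%:C :> R[i] by rewrite ltcR.
have [G [GA]] := clF _ (nbhsx_ballx F _ d0').
rewrite -ball_normE/= renorm_lt => FG.
have -> : F y = (F - G) y by rewrite [RHS](_ : _ = F y - G y)// GA// subr0.
by rewrite (le_trans (renorm_C0_le _ _))// ltW.
Qed.

Let vanishing0 A : vanishing A 0. Proof. by []. Qed.

Let vanishingD A F G : vanishing A F -> vanishing A G -> vanishing A (F + G).
Proof.
by move=> FA GA y Ay; rewrite [LHS](_ : _ = F y + G y)// FA// GA// addr0.
Qed.

Let vanishingZ A k F : vanishing A F -> vanishing A (k *: F).
Proof.
move=> FA y Ay; rewrite [LHS](_ : _ = k *: F y)// FA//; exact: scaler0.
Qed.

Let vanishingMl A F G : vanishing A G -> vanishing A (cmul F G).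
Proof.
move=> GA y Ay; rewrite [LHS](_ : _ = (F y : R[i]) * G y)// GA//.
exact: mulr0.
Qed.

Let vanishingMr A F G : vanishing A F -> vanishing A (cmul F G).
Proof.
move=> FA y Ay; rewrite [LHS](_ : _ = (F y : R[i]) * G y)// FA//.
exact: mul0r.
Qed.

Definition vanishing_ideal A : cideal (C0 R Y) :=
  CIdeal (@vanishing0 A) (@vanishingD A) (@vanishingZ A) (@vanishingMl A)
    (@vanishingMr A) (@vanishing_closed A).

Lemma vanishing_idealP A (F : C0 R Y) :
  vanishing_ideal A F <-> forall y, A y -> F y = 0.
Proof. by []. Qed.

End VanishingIdeal.

Section VanishingIdealClosure.
Context {R : realType} {Y : metricType R}.
Hypothesis cptY : compact [set: Y].

(** [F] is shrunk to [t F] with [t = 1 - (d/2) / max(|F|, d/2)]. This vanishes where [|F| <= d/2],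
    in particular near [A] by uniform continuity, and differs from [F] by at most [d/2]. *)
Lemma vanishing_ideal_closure (A : set Y) : A !=set0 ->
  cideal_set (@vanishing_ideal R Y A) = closure (\bigcup_n
    cideal_set (@vanishing_ideal R Y (closed_nbhd A n.+1%:R^-1))).
Proof.
move=> A0; apply/seteqP; split; last first.
  move=> F clF; apply: (@cideal_closed _ _ (@vanishing_ideal R Y A)) => V nV.
  have [G [[n _ /vanishing_idealP GA] VG]] := clF V nV.
  exists G; split; last exact: VG.
  apply/vanishing_idealP => y Ay; apply: GA.
  by rewrite closed_nbhdE//= set_dist0// invr_ge0.
move=> F /vanishing_idealP FA V /nbhs_ballP[_ /gt0_complexE[d d0 ->] dV].
have d20 : 0 < d / 2 by rewrite divr_gt0.
have [delta delta0 Fdelta] := complex_unif cptY (C0_continuous F) d20.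
have [n ndelta] : exists n, n.+1%:R^-1 < delta.
  have /cvgrPdist_lt/(_ _ delta0)[n _ /(_ n (leqnn n))/=] := @cvg_harmonic R.
  by rewrite sub0r normrN ger0_norm ?invr_ge0// => nd; exists n.
pose m y : R := Num.max (renorm (F y)) (d / 2).
have m0 y : 0 < m y by rewrite lt_max d20 orbT.
pose t y : R := 1 - d / 2 * (m y)^-1.
have ct : continuous (t : Y -> R^o).
  have cm : continuous (m : Y -> R^o).
    move=> y; apply: (@continuous_max _ _ (fun y => renorm (F y)) (fun=>
      d / 2) y).
      exact: (continuous_renorm (C0_continuous F)).
    exact: (@cst_continuous Y R^o _ y).
  move=> y; apply: (@cvgB _ _ _ (nbhs y)); first exact:
    (@cst_continuous Y R^o _ y).
  apply: (@cvgMr _ _ (nbhs y)).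
  by apply: (@cvgV _ _ (nbhs y)); [exact: lt0r_neq0|exact: cm].
have cG : continuous (fun y => (t y)%:C *: F y : R[i]^o).
  move=> y; apply: (@cvgZ R[i] R[i]^o Y (nbhs y) _); last exact: C0_continuous.
  apply: (@continuous_Complex _ _ t (fun=> 0)) => //.
  by move=> z; exact: (@cst_continuous Y R^o _ z).
exists (compact_C0 cptY cG); split.
  exists n => //; apply/vanishing_idealP => y; rewrite closed_nbhdE//= =>
    ydelta.
  have [|z Az yz] := @set_dist_lt _ _ A A0 y delta.
    exact: le_lt_trans ydelta ndelta.
  have := Fdelta _ _ yz; rewrite (FA _ Az) subr0 => Fy.
  rewrite /= /t /m max_r ?ltW// mulfV ?lt0r_neq0// subrr scale0r.
  by [].
apply: dV; rewrite -ball_normE/= renorm_lt.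
apply: (@le_lt_trans _ _ (d / 2)); last first.
  by rewrite ltr_pdivrMr// ltr_pMr// ltr1n.
apply: renorm_C0 => [|y]; first exact: ltW.
have -> : (F - compact_C0 cptY cG) y = (d / 2 * (m y)^-1)%:C *: F y.
  rewrite [LHS](_ : _ = F y - (t y)%:C *: F y)// /t rmorphB/= scalerBl scale1r.
  by rewrite opprB addrCA subrr addr0.
rewrite renormZ renorm_real ger0_norm; last first.
  by rewrite mulr_ge0 ?invr_ge0 ?(ltW d20) ?(ltW (m0 y)).
rewrite -mulrA ler_piMr ?(ltW d20)// mulrC ler_pdivrMr// mul1r.
by rewrite le_max lexx.
Qed.

End VanishingIdealClosure.

Lemma quo_piB (R : realType) (B : cstarType R) (J : cideal B) :
  {morph quo_pi J : a b / a - b}.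
Proof.
by move=> a b; apply/eqP; rewrite eq_sym subr_eq -quo_piD subrK.
Qed.

Lemma near_forall_in (I : eqType) T (F : set_system T) {FF : Filter F}
    (s : seq I) (P : I -> T -> Prop) :
  (forall i, \forall t \near F, P i t) ->
  \forall t \near F, forall i, i \in s -> P i t.
Proof.
move=> FP; elim: s => [|i s IH]; first exact: filterE.
apply: filterS2 IH (FP i) => t Pt Pit j; rewrite inE.
by move=> /predU1P[->//|]; exact: Pt.
Qed.

(** * Construction of the approximate retraction *)

Section WSP1ToAANR.
Context {R : realType} {X : topologicalType}.
Local Notation aX := (one_point_compactification X).
Hypotheses (hX : hausdorff_space X) (wsp : WSP1 (C0 R X)).
Context {Y : metricType R} (theta : aX -> Y).
Hypotheses (cptY : compact [set: Y]) (emb : top_embedding theta).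

Let A : set Y := range theta.
Let A0 : A !=set0. Proof. by exists (theta None), None. Qed.
Let ctheta : continuous theta := top_embedding_continuous emb.
Let J : cideal (C0 R Y) := vanishing_ideal A.
Let Jn n : cideal (C0 R Y) := vanishing_ideal (closed_nbhd A n.+1%:R^-1).

Let JP F : J F <-> forall p, F (theta p) = 0.
Proof.
split=> [/vanishing_idealP FA p|FA]; first by apply: FA; exists p.
by apply/vanishing_idealP => _ [p _ <-].
Qed.

Let Jn_S n : cideal_set (Jn n) `<=` cideal_set (Jn n.+1).
Proof.
move=> F /vanishing_idealP FA; apply/vanishing_idealP => y yn; apply: FA.
move: yn; rewrite !closed_nbhdE//= => /le_trans; apply.
by rewrite lef_pV2 ?posrE ?ltr0n// ler_nat.
Qed.

Let extension (f : C0 R X) : exists F : C0 R Y, forall p, F (theta p) = ext f p.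
Proof.
have [F cF FE] := complex_extension (@one_point_compactification_compact X)
  cptY ctheta (proj1 emb) (@ext_continuous _ _ hX f).
by exists (compact_C0 cptY cF).
Qed.

(* Restriction of functions from [Y] to [theta @` aX] identifies the quotient by
   [J] with the functions on [aX]; [C0 R X] is the ideal vanishing at infinity.
   *)
Let phi_exists : exists2 phi : C0 R X -> quo J, is_star_hom_quo phi &
  forall (f : C0 R X) (F : C0 R Y),
    (forall p, F (theta p) = ext f p) -> phi f = quo_pi J F.
Proof.
have [Phi PhiE] := choice extension.
have phiE (f : C0 R X) (F : C0 R Y) : (forall p, F (theta p) = ext f p) ->
    quo_pi J (Phi f) = quo_pi J F.
  move=> FE; apply/quo_piP/JP => p.
  by rewrite [LHS](_ : _ = Phi f (theta p) - F (theta p))// PhiE FE subrr.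
exists (fun f => quo_pi J (Phi f)) => //; split.
- move=> k f g.
  have -> : k *: quo_pi J (Phi f) = quo_pi J (k *: Phi f).
    exact: quo_scaleE.
  rewrite -quo_piD; apply: phiE => -[x|].
    rewrite [LHS](_ : _ = k *:
      Phi f (theta (Some x)) + Phi g (theta (Some x)))//.
    by rewrite !PhiE.
  rewrite [LHS](_ : _ = k *: Phi f (theta None) + Phi g (theta None))//.
  by rewrite !PhiE /= scaler0 addr0.
- move=> f g; rewrite quo_mulE; apply: phiE => p.
  rewrite [LHS](_ : _ = (Phi f (theta p) : R[i]) * Phi g (theta p))// !PhiE.
  by case: p => [x|] //=; exact: mulr0.
- move=> f; rewrite quo_starE; last first.
    move=> F /JP FA; apply/JP => p.
    by rewrite [LHS](_ : _ = (F (theta p))^*%C)// FA; exact: conjc0.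
  apply: phiE => p; rewrite [LHS](_ : _ = (Phi f (theta p))^*%C)// PhiE.
  by case: p => [x|] //=; exact: conjc0.
Qed.

Let cone_fun (z : Y) (p : aX) : R[i]^o := (mdist z (theta p))%:C.

Let mdist_cont (z : Y) : continuous (mdist z : Y -> R^o).
Proof.
move=> y; apply/cvgrPdist_lt => h h0.
apply: filterS (near_mdist y h0) => x yx.
rewrite (le_lt_trans _ yx)// ler_norml.
have := metric_triangle z y x; have := metric_triangle z x y.
by rewrite (metric_sym x y) => ? ?; apply/andP; split; lra.
Qed.

Let cone_cont z : continuous (cone_fun z).
Proof.
apply: (@continuous_Complex _ _ (fun p => mdist z (theta p)) (fun=> 0)).
  move=> p; apply: (@continuous_comp aX Y R^o theta (mdist z) p).
    exact: ctheta.
  exact: mdist_cont.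
by move=> p; exact: (@cst_continuous aX R^o _ p).
Qed.

(** Subtracting the value at infinity lands in [C0 R X]; by [cone_dist] this is harmless, as only
    differences of values are used. *)
Let cone z : C0 R X := res (@cone_cont z).

Let coneE z p :
  ext (cone z) p = (mdist z (theta p) - mdist z (theta None))%:C.
Proof.
case: p => [x|] /=; first by rewrite rmorphB.
by rewrite subrr.
Qed.

Let cone_dist z p q : renorm (ext (cone z) p - ext (cone z) q) =
  `|mdist z (theta p) - mdist z (theta q)|.
Proof.
rewrite !coneE -rmorphB renorm_real; congr `|_|.
by rewrite opprB addrA subrK.
Qed.

Lemma AANR_retraction (eps : R) : 0 < eps ->
  exists2 delta : R, 0 < delta &
  exists2 r : closed_nbhd A delta -> aX, continuous r &
  forall (x : aX) (u : closed_nbhd A delta),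
    \val u = theta x -> mdist (theta (r u)) (theta x) <= eps.
Proof.
move=> eps0; have [_ /(_ (C0 R Y) _ _)] := wsp.
move=> /(_ (ex_intro _ _ (C0_one_unit cptY))).
move=> /(_ (C0_compact_separable cptY (theta None))).
have [phi phi_hom phiE] := phi_exists.
move=> /(_ Jn J Jn_S (vanishing_ideal_closure cptY A0) phi phi_hom).
move=> [psi psi_hom psi_cvg].
(* For [z] in the net within [eps/3] of [theta q], the distance from [z] to [theta (r u)] exceeds
   that to [theta q] by less than [eps/3]; the triangle inequality through [z] adds up to three
   thirds. *)
have e30 : 0 < eps / 3 by rewrite divr_gt0.
have [s sP] := finite_net cptY e30.
have [n _ /(_ n (leqnn n)) nP] : \forall n \near \oo, forall z, z \in s ->
    quo_norm (quo_map J (psi n (cone z)) - phi (cone z)) < eps / 3.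
  apply: near_forall_in => z.
  have /cvgrPdist_lt/(_ _ e30) := psi_cvg (cone z); apply: filterS => n.
  by rewrite sub0r normrN; apply: le_lt_trans; exact: ler_norm.
have evJ (y : Y) : closed_nbhd A n.+1%:R^-1 y ->
    forall F : C0 R Y, Jn n F -> F y = 0.
  by move=> yn F /vanishing_idealP; apply.
exists n.+1%:R^-1; first by rewrite invr_gt0.
have rex (u : closed_nbhd A n.+1%:R^-1) : exists p : aX, forall f,
    (repr (psi n f) : C0 R Y) (\val u) = ext f p.
  have un : closed_nbhd A n.+1%:R^-1 (\val u) by exact: set_valP.
  have [chiD chiZ chiM] := @quo_hom_char R (C0 R X) (C0 R Y) (Jn n)
    (fun F => F (\val u)) (fun _ _ => erefl) (fun _ _ => erefl)
    (fun _ _ => erefl) (evJ _ un) (psi n) (psi_hom n).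
  exact: (C0_char hX chiD chiZ chiM).
have [r rP] := choice rex; exists r.
(* One test function suffices at [u], the distance to [z = theta (r u)]: its values at [r u] and
   [r v] differ by exactly the distance between the images of these points. *)
- move=> u V /(top_embedding_nbhs emb)[e e0 eV].
  pose z := theta (r u).
  have cz : continuous (fun v : closed_nbhd A n.+1%:R^-1 =>
      (repr (psi n (cone z)) : C0 R Y) (\val v)).
    move=> v; apply: (@continuous_comp _ _ _ set_val).
      exact: initial_continuous.
    exact: C0_continuous.
  have /cvg_renormP/(_ _ e0) := cz u; apply: filterS => v.
  rewrite !rP cone_dist mdistxx sub0r normrN ger0_norm ?mdist_ge0//.
  exact: eV.
- move=> q u uq; have [z zs zq] := sP (theta q).
  have := nP z zs.
  have [F FE] := extension (cone z).
  rewrite (phiE _ _ FE).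
  have -> : quo_map J (psi n (cone z)) - quo_pi J F =
      quo_pi J (repr (psi n (cone z)) - F).
    by rewrite /quo_map; rewrite quo_piB.
  have evq : forall G : C0 R Y, J G -> G (theta q) = 0.
    by move=> G /JP.
  have := @char_quo_norm R (C0 R Y) J (fun G => G (theta q))
    (fun _ _ => erefl) (fun _ _ => erefl) evq (repr (psi n (cone z)) - F)
    (fun G => renorm_C0_le G _).
  rewrite [X in renorm X](_ : _ = (repr (psi n (cone z)) : C0 R Y) (theta q) -
    F (theta q))// -uq rP uq FE cone_dist => /le_lt_trans/[apply].
  rewrite ltr_norml => /andP[_ h].
  have := metric_triangle (theta (r u)) z (theta q).
  rewrite (metric_sym (theta (r u)) z); lra.
Qed.

End WSP1ToAANR.

Lemma WSP1_AANR (R : realType) (X : topologicalType)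
    (X_separable : separable_space X)
    (X_locally_compact : locally_compact [set: X])
    (X_metrizable : metrizable R X) :
  WSP1 (C0 R X) -> AANR R (one_point_compactification X).
Proof.
move=> wsp; have hX := metrizable_hausdorff X_metrizable.
have [h [theta [ctheta thetaI _]]] :=
  hilbert_cube_embedding X_separable X_locally_compact X_metrizable.
split=> [|Y theta' cptY emb eps eps0].
  split; first exact: one_point_compactification_compact.
  apply: top_embedding_metrizable.
  exact: (compact_top_embedding (@one_point_compactification_compact X)
    (@metric_hausdorff _ _) ctheta thetaI).
exact: AANR_retraction.
Qed.

(** * AANR implies WSP1 in the commutative category *)

Lemma compact_set_type (T : topologicalType) (A : set T) :
  compact A -> compact [set: A].
Proof.
move=> cA F PF _.
pose G := fmap (\val : A -> T) F.
have PG : ProperFilter G := fmap_proper_filter _ PF.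
have GA : G A.
  by apply: (@filterS _ F _ setT) => [u _|]; [exact: set_valP|exact: filterT].
have [y [Ay Fy]] := cA G PG GA.
exists (exist _ y (mem_set Ay)); split=> // P U FP.
rewrite nbhsE => -[_ [[W oW <-] Wy] WU].
have FP' : G (\val @` P).
  by apply: (@filterS _ F _ P) => // u Pu; exists u.
have [_ [[v Pv <-] Wv]] := Fy _ W FP' (open_nbhs_nbhs (conj oW Wy)).
by exists v; split=> //; exact: WU.
Qed.

(** [kappa n] is the largest [k <= n] with [P k n], or 0 if there is none; it tends to infinity
    because each [P k] holds eventually. *)
Lemma near_diagonal (P : nat -> nat -> Prop) :
  (forall k, \forall n \near \oo, P k n) ->
  exists kappa : nat -> nat, forall k,
    \forall n \near \oo, (k <= kappa n)%N /\ P (kappa n) n.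
Proof.
move=> Pnear; have ex n : exists m, forall k, (k <= n)%N -> P k n ->
    (k <= m)%N /\ P m n.
  pose b k := (k <= n)%N && `[< P k n >].
  have [[k bk]|no] := pselect (exists k, b k); last first.
    by exists 0%N => k kn Pk; case: no; exists k; rewrite /b kn; exact/asboolP.
  have bn k' : b k' -> (k' <= n)%N by move=> /andP[].
  have := @ex_maxnP b n (ex_intro _ k bk) bn.
  case=> m /andP[mn /asboolP Pm] mmax; exists m => k' k'n Pk'; split=> //.
  by apply: mmax; rewrite /b k'n; exact/asboolP.
have [kappa kappaP] := choice ex; exists kappa => k.
near=> n; apply: kappaP; near: n; first exact: nbhs_infty_ge.
exact: Pnear.
Unshelve. all: by end_near. Qed.

(** * Continuous functional calculus in countably many elements *)

Section HilbertCubeCalculus.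
Context {R : realType} {B : cstarType R} {e : B} {eP : is_unit e}
  {BC : commutative_cstar B}.
Local Notation S := (spectrum eP BC).
Local Notation A := (calg eP BC).
Variable g : S -> hilbert_cube R.
Hypothesis g_represented : forall n, represented (fun chi => g chi n).

(** The maximum of the first [N] terms is represented, and it misses the distance by at most
    [1 / 2^N], the bound on all later terms. *)
Let hc_dist_represented x : represented (fun chi => mdist x (g chi)).
Proof.
pose term n (chi : S) : R := 2^-1 ^+ n * `|x n - g chi n|.
pose m := fix m N (chi : S) : R :=
  if N is n.+1 then Num.max (m n chi) (term n chi) else 0.
have mrep N : represented (m N).
  elim: N => [|N IH]; first exact: represented_cst.
  apply: represented_max => //; apply: representedM; first exact:
    represented_cst.
  by apply/represented_norm/representedB => //; exact: represented_cst.
have m_ge N chi n : (n < N)%N -> term n chi <= m N chi.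
  elim: N => [//|N IH]; rewrite ltnS leq_eqVlt => /predU1P[->|/IH nN] /=.
    by rewrite le_max lexx orbT.
  by rewrite le_max nN.
have m_le N chi : m N chi <= mdist x (g chi).
  elim: N => [|N IH] /=; first exact: mdist_ge0.
  by rewrite ge_max IH; exact: hc_dist_coord.
have half0 : 0 <= 2^-1 :> R by rewrite invr_ge0.
have half1 : 2^-1 < 1 :> R by lra.
apply: represented_lim => d d0.
have [N Nd] := exp_small 1 half0 half1 d0; rewrite mulr1 in Nd.
exists (m N) => // chi; rewrite ger0_norm ?subr_ge0// lerBlDr.
have m0 : 0 <= m N chi.
  by case: (N) => [//|n] /=;
    rewrite le_max [X in _ || X]mulr_ge0 ?exprn_ge0 ?orbT.
apply: hc_dist_le => n; have [nN|Nn] := ltnP n N.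
  by rewrite (le_trans (m_ge _ chi _ nN))// lerDr ltW.
have x01 := hc_itv x n; have g01 := hc_itv (g chi) n.
have : `|x n - g chi n| <= 1.
  move: x01 g01 => /andP[? ?] /andP[? ?].
  by rewrite ler_norml; apply/andP; split; lra.
move=> /(ler_wpM2l (exprn_ge0 n half0)) /le_trans; apply; rewrite mulr1.
have : 2^-1 ^+ n <= 2^-1 ^+ N :> R by rewrite ler_wiXn2l// ltW.
by move: Nd m0; lra.
Qed.

(** Cones composed with [g] are represented, and represented functions are stable under minima, so
    [min_cones_dense] reaches every continuous [u]. *)
Lemma continuous_represented (u : hilbert_cube R -> R^o) : continuous u ->
  represented (fun chi => u (g chi)).
Proof.
move=> cu; apply: represented_lim => d d0.
have itv0 (n : nat) : 0 <= (0 : R) <= 1 by rewrite lexx ler01.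
pose x := HilbertCube itv0.
have [||v vrep uv] := @min_cones_dense R _ (@hilbert_cube_compact R)
  (fun v => represented (fun chi => v (g chi))) x _ _ u cu d d0; last first.
- by exists (fun chi => v (g chi)).
- by move=> v w rv rw; exact: represented_min.
move=> q c L r r0; exists (fun y => c + L * mdist q y); last first.
  by move=> y; rewrite subrr normr0 ltW.
by apply: representedD; [|apply: representedM => //]; exact: represented_cst.
Qed.

Lemma continuous_represented_complex (F : hilbert_cube R -> R[i]^o) :
  continuous F -> exists b : A, forall chi : S, chi b = F (g chi).
Proof.
move=> cF.
have [a aF] := continuous_represented (continuous_Re cF).
have [b bF] := continuous_represented (continuous_Im cF).
exists (a + cI * b) => chi; rewrite charD charM aF bF /cI charZ char1 mulr1.
by rewrite [RHS]complexE.
Qed.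

End HilbertCubeCalculus.

(** Characters respect the involution, so those of the hull vanish at the adjoint of [b] too.
    [quo_starE] depends on this. *)
Lemma hull_star (R : realType) (B : cstarType R) (e : B) (eP : is_unit e)
    (BC : commutative_cstar B) (J : cideal B) (b : B) :
  J b -> J (cstar b).
Proof.
move=> Jb; apply: (@hull_mem _ _ _ eP BC) => chi chiJ.
by rewrite char_star chiJ// conjc0.
Qed.

(** * Construction of the lifts *)

Section AANRLifts.
Context {R : realType} {X : topologicalType}.
Local Notation aX := (one_point_compactification X).
Hypotheses (hX : hausdorff_space X) (aanr : AANR R aX).
Variables (h : nat -> C0 R X) (theta : aX -> hilbert_cube R).
Hypotheses (ctheta : continuous theta) (thetaI : injective theta)
  (hE : forall n p, ext (h n) p = (theta p n)%:C).
Context {B : cstarType R} {e : B} (eP : is_unit e) (BC : commutative_cstar B).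
Local Notation S := (spectrum eP BC).
Local Notation A := (calg eP BC).
Variables (Jn : nat -> cideal B) (J : cideal B).
Hypotheses (Jn_S : forall n, cideal_set (Jn n) `<=` cideal_set (Jn n.+1))
  (JE : cideal_set J = closure (\bigcup_n cideal_set (Jn n))).
Variable phi : C0 R X -> quo J.
Hypothesis phi_hom : is_star_hom_quo phi.

Let cptaX : compact [set: aX] := @one_point_compactification_compact X.
Let cptQ : compact [set: hilbert_cube R] := @hilbert_cube_compact R.
Let K : set (hilbert_cube R) := range theta.
Let K0 : K !=set0. Proof. by exists (theta None), None. Qed.

Let Jn_le n m : (n <= m)%N -> cideal_set (Jn n) `<=` cideal_set (Jn m).
Proof.
move=> /subnK <-; elim: (m - n)%N => [//|k IH] b /IH; exact: Jn_S.
Qed.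

Let Jn_J n : cideal_set (Jn n) `<=` cideal_set J.
Proof. by rewrite JE => b Jb; apply: subset_closure; exists n. Qed.

Let hull_J (chi : S) n : hull J chi -> hull (Jn n) chi.
Proof. by move=> chiJ j /Jn_J; exact: chiJ. Qed.

Let phi_point (chi : S) : hull J chi ->
  exists p : aX, forall f, chi (repr (phi f) : A) = ext f p.
Proof.
move=> chiJ; have [chiD chiZ chiM] := @quo_hom_char R (C0 R X) B J
  (chi : B -> R[i]) (charD chi) (charZ chi) (charM chi) chiJ phi phi_hom.
exact: (C0_char hX chiD chiZ chiM).
Qed.

Let clamp (r : R) : R := Num.min 1 (Num.max 0 r).

Let clamp_itv r : 0 <= clamp r <= 1.
Proof. by rewrite /clamp le_min ler01 le_max lexx ge_min lexx. Qed.

(* The coordinates of the embedding, transported by [phi] and lifted to [B]. *)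
Let g (chi : S) : hilbert_cube R :=
  HilbertCube (fun n => clamp_itv (complex.Re (chi (repr (phi (h n)) : A)))).

Let g_represented n : represented (fun chi => g chi n).
Proof.
apply: represented_min; first exact: represented_cst.
by apply: represented_max; [exact: represented_cst|exact: represented_re].
Qed.

Let gE (chi : S) p : (forall f, chi (repr (phi f) : A) = ext f p) ->
  g chi = theta p.
Proof.
move=> chip; apply: hilbert_cube_ext => n; rewrite /g/= chip hE /clamp/=.
by have /andP[t0 t1] := hc_itv (theta p) n; rewrite max_r// min_r.
Qed.

Let near_K (delta : R) : 0 < delta -> \forall n \near \oo,
  forall chi : S, hull (Jn n) chi -> closed_nbhd K delta (g chi).
Proof.
move=> delta0.
have [b bE] := continuous_represented g_represented (@set_dist_continuous _ _ _
  K0).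
have : J b.
  apply: (@hull_mem _ _ _ eP BC) => chi chiJ; have [p pE] := phi_point chiJ.
  by rewrite bE (gE pE) set_dist0//; exists p.
(* [b] is within [delta] of some [j] in [Jn N], so [|chi b| <= delta] on the hull of every [Jn n]
   with [n >= N]. *)
rewrite JE => /(_ (ball b delta%:C)) [|j [[N _ Jj]]].
  by apply: nbhsx_ballx; rewrite ltcR.
rewrite -ball_normE/= renorm_lt => bj; exists N => // n Nn chi chin.
rewrite closed_nbhdE//=.
have := @hull_dist_mem _ _ _ eP BC (Jn n) b j chi delta.
move=> /(_ (Jn_le Nn Jj) (ltW bj) chin); rewrite bE renorm_real.
by apply: le_trans; exact: ler_norm.
Qed.

(** The error is compared with the oscillation of [f] at scale [d]; as [d] does not depend on [f],
    one homomorphism serves all [f] at once. *)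
Let approximates (n : nat) (d : R) (psi : C0 R X -> quo (Jn n)) : Prop :=
  forall (f : C0 R X) (M : R), 0 <= M ->
  (forall p q, mdist (theta p) (theta q) <= d ->
    renorm (ext f p - ext f q) <= M) ->
  quo_norm (quo_map J (psi f) - phi f) <= M.

Let quo_eq n (a b : A) :
  (forall chi : S, hull (Jn n) chi -> chi a = chi b) ->
  quo_pi (Jn n) a = quo_pi (Jn n) b.
Proof.
move=> ab; apply/quo_piP/(@hull_mem _ _ _ eP BC) => chi chin.
by rewrite charB ab// subrr.
Qed.

(** [f o r] lives on a closed neighbourhood only, so it is extended to the cube by Tietze before
    composing with [g]. The extension is arbitrary, but on the hull of [Jn n] its values are
    prescribed, so the class modulo [Jn n] is determined and depends on [f] as a homomorphism. *)
Let near_lift (d : R) : 0 < d -> \forall n \near \oo,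
  exists2 psi : C0 R X -> quo (Jn n), is_star_hom_quo psi & approximates d psi.
Proof.
move=> d0; have emb := compact_top_embedding cptaX (@metric_hausdorff _ _)
  ctheta thetaI.
have [delta delta0 [r cr rE]] := (proj2 aanr) _ theta cptQ emb _ d0.
apply: filterS (near_K delta0) => n gK.
have cptU : compact [set: closed_nbhd K delta].
  exact: (compact_set_type (subclosed_compact
    (@closed_closed_nbhd _ _ _ K0 delta) cptQ (@subsetT _ _))).
have lift (f : C0 R X) : exists b : A, forall (chi : S) u,
    hull (Jn n) chi -> \val u = g chi -> chi b = ext f (r u).
  have cf : continuous (fun u => ext f (r u)).
    move=> u; apply: (@continuous_comp _ _ R[i]^o r (ext f) u).
      exact: cr.
    exact: ext_continuous.
  have [F cF FE] := @complex_extension _ _ _ (\val : closed_nbhd K delta -> _)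
    cptU cptQ (@initial_continuous _ _ _) val_inj _ cf.
  have [b bF] := continuous_represented_complex g_represented cF.
  by exists b => chi u _ ug; rewrite bF -ug FE.
have [b bE] := choice lift.
have point (chi : S) : hull (Jn n) chi ->
    exists u : closed_nbhd K delta, \val u = g chi.
  by move=> /gK gchi; exists (exist _ (g chi) (mem_set gchi)).
exists (fun f => quo_pi (Jn n) (b f)).
  split.
  - move=> k f1 f2; have -> : k *: quo_pi (Jn n) (b f1) = quo_pi (Jn n) (k *:
    b f1).
      exact: quo_scaleE.
    rewrite -quo_piD; apply: quo_eq => chi chin; have [u ug] := point _ chin.
    rewrite charD charZ !(bE _ _ u)//; case: (r u) => [x|]//=.
    by rewrite mulr0 addr0.
  - move=> f1 f2; rewrite quo_mulE; apply: quo_eq => chi chin.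
    have [u ug] := point _ chin.
    rewrite [RHS](charM chi (b f1) (b f2)) !(bE _ _ u)//.
    by case: (r u) => [x|]//=; rewrite mulr0.
  - move=> f; rewrite quo_starE; last exact: (hull_star eP BC).
    apply: quo_eq => chi chin; have [u ug] := point _ chin.
    rewrite char_star !(bE _ _ u)//.
    by case: (r u) => [x|]//=; exact/esym/conjc0.
move=> f M M0 fM; rewrite (quo_mapE _ (@Jn_J n)).
rewrite -[phi f]quo_piK -quo_piB; apply/ler_addgt0Pr => m m0.
(* On the hull of [J] the point [g chi] is some [theta p], which [r] moves by at most [d];
   [hull_dist] converts the resulting bound on characters into one on the quotient norm. *)
have [||chi chiJ|j Jj aj] := @hull_dist _ _ _ eP BC J (b f - repr (phi f) : A)
    M (M + m) => //; first by rewrite ltrDl.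
  have [p pE] := phi_point chiJ; have [u ug] := point _ (hull_J chiJ).
  rewrite charB pE (bE _ _ u)//; last exact: hull_J.
  by apply: fM; apply: rE; rewrite ug (gE pE).
rewrite (le_trans _ aj)//; apply: quo_norm_le.
by rewrite opprB addrCA subrr addr0.
Qed.

(** Default lift for those [n] at which [near_lift] provides nothing. *)
Let zero_hom n : is_star_hom_quo (fun _ : C0 R X => 0 : quo (Jn n)).
Proof.
have quo0 : (0 : quo (Jn n)) = quo_pi (Jn n) 0.
  by apply: (addrI (quo_pi (Jn n) 0)); rewrite -quo_piD !addr0.
split=> [k a b|a b|a]; first by rewrite scaler0 addr0.
  rewrite quo0 quo_mulE; congr quo_pi; have := cscalerAl 0 (0 : B) 0.
  by rewrite !scale0r => <-.
by rewrite quo0 quo_starE ?cstar0//; exact: (hull_star eP BC).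
Qed.

Let ext_unif (f : C0 R X) (d : R) : 0 < d -> exists2 delta : R, 0 < delta &
  forall p q, mdist (theta p) (theta q) < delta -> renorm (ext f p - ext f q) <
    d.
Proof.
move=> d0; have [F cF FE] := complex_extension cptaX cptQ ctheta thetaI
  (@ext_continuous _ _ hX f).
have [delta delta0 Fd] := complex_unif cptQ cF d0; exists delta => // p q pq.
by rewrite -!FE; exact: Fd.
Qed.

Lemma AANR_lift : exists2 psi : forall n, C0 R X -> quo (Jn n),
  (forall n, is_star_hom_quo (psi n)) &
  forall f : C0 R X,
    (fun n => quo_norm (quo_map J (psi n f) - phi f)) @ \oo --> (0 : R).
Proof.
have inv0 k : 0 < k.+1%:R^-1 :> R by rewrite invr_gt0.
have [kappa kappaP] := near_diagonal (fun k => near_lift (inv0 k)).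
have ex n : exists psi : C0 R X -> quo (Jn n), is_star_hom_quo psi /\
    ((exists2 psi' : C0 R X -> quo (Jn n), is_star_hom_quo psi' &
      approximates (kappa n).+1%:R^-1 psi') ->
     approximates (kappa n).+1%:R^-1 psi).
  have [[psi psih psia]|no] := pselect (exists2 psi' : C0 R X -> quo (Jn n),
      is_star_hom_quo psi' & approximates (kappa n).+1%:R^-1 psi').
    by exists psi.
  by exists (fun=> 0); split; [exact: zero_hom|move=> /no].
exists (fun n => projT1 (cid (ex n))) => [n|f].
  by case: (projT2 (cid (ex n))).
apply/cvgrPdist_lt => d d0; have d20 : 0 < d / 2 by rewrite divr_gt0.
have [delta delta0 fdelta] := ext_unif f d20.
have [k kdelta] : exists k, k.+1%:R^-1 < delta.
  have /cvgrPdist_lt/(_ _ delta0)[n _ /(_ n (leqnn n))/=] := @cvg_harmonic R.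
  by rewrite sub0r normrN ger0_norm ?invr_ge0// => nd; exists n.
apply: filterS (kappaP k) => n [kn liftn].
rewrite sub0r normrN ger0_norm ?quo_norm_ge0//.
have [_ /(_ liftn) appr] := projT2 (cid (ex n)).
apply: (@le_lt_trans _ _ (d / 2)); last first.
  by rewrite ltr_pdivrMr// ltr_pMr// ltr1n.
apply: appr => [|p q pq]; first exact: ltW.
apply/ltW/fdelta; rewrite (le_lt_trans pq)// (le_lt_trans _ kdelta)//.
by rewrite lef_pV2 ?posrE ?ltr0n// ler_nat.
Qed.

End AANRLifts.

Lemma AANR_WSP1_commutative (R : realType) (X : topologicalType)
    (X_separable : separable_space X)
    (X_locally_compact : locally_compact [set: X])
    (X_metrizable : metrizable R X) :
  AANR R (one_point_compactification X) -> WSP1_commutative (C0 R X).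
Proof.
move=> aanr; have hX := metrizable_hausdorff X_metrizable.
have [h [theta [ctheta thetaI hE]]] :=
  hilbert_cube_embedding X_separable X_locally_compact X_metrizable.
split; first exact: C0_separable.
  by move=> f g; apply: C0_ext => x; exact: mulrC.
move=> B [e eP] _ BC Jn J Jn_S JE phi phi_hom.
exact: (AANR_lift hX aanr ctheta thetaI hE eP BC Jn_S JE phi_hom).
Qed.

Theorem theorem4p16 (R : realType) (X : topologicalType)
    (X_separable : separable_space X)
    (X_locally_compact : locally_compact [set: X])
    (X_metrizable : metrizable R X) :
  (WSP1 (C0 R X) -> AANR R (one_point_compactification X)) /\
  (AANR R (one_point_compactification X) -> WSP1_commutative (C0 R X)).
Proof.
by split; [exact: WSP1_AANR|exact: AANR_WSP1_commutative].
Qed.
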